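(* There are bijections between the set $\mathcal T''_{\infty,\infty}$ of graph limits of bipartite threshold graphs and each of the following sets. (i) The set $\mathcal P$ of probability distributions on $[0,1]$. (ii) The set $\mathcal C_{\mathcal B}$ of increasing closed sets $S\subseteq[0,1]^2$ that contain the upper and right edges $[0,1]\times\{1\}\cup\{1\}\times[0,1]$. (iii) The set $\mathcal O_{\mathcal B}$ of increasing open sets $S\subseteq(0,1)^2$. (iv) The set $\mathcal W_{\mathcal B}$ of increasing $0$–$1$ valued functions $W:[0,1]^2\to\{0,1\}$ modulo a.e. equality. More precisely, there are commuting bijections between these sets given by the following mappings and their compositions: $$\begin{aligned} \iota_{\mathcal B\mathcal P}&:\mathcal T''_{\infty,\infty}\to\mathcal P, & \iota_{\mathcal B\mathcal P}(\Gamma)&:=\nu_1(\Gamma);\\ \iota_{\mathcal P\mathcal C}&:\mathcal P\to\mathcal C_{\mathcal B}, & \iota_{\mathcal P\mathcal C}(\mu)&:=S_\mu;\\ \iota_{\mathcal C\mathcal O}&:\mathcal C_{\mathcal B}\to\mathcal O_{\mathcal B}, & \iota_{\mathcal C\mathcal O}(S)&:=S^\circ;\\ \iota_{\mathcal C\mathcal W}&:\mathcal C_{\mathcal B}\to\mathcal W_{\mathcal B}, & \iota_{\mathcal C\mathcal W}(S)&:=\mathbf 1_S;\\ \iota_{\mathcal O\mathcal W}&:\mathcal O_{\mathcal B}\to\mathcal W_{\mathcal B}, & \iota_{\mathcal O\mathcal W}(S)&:=\mathbf 1_S;\\ \iota_{\mathcal W\mathcal B}&:\mathcal W_{\mathcal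 B}\to\mathcal T''_{\infty,\infty}, & \iota_{\mathcal W\mathcal B}(W)&:=\Gamma''_W. \end{aligned}$$ (That is, the diagram formed by the cycle $\mathcal T''_{\infty,\infty}\to\mathcal P\to\mathcal C_{\mathcal B}\to\mathcal O_{\mathcal B}\to\mathcal W_{\mathcal B}\to\mathcal T''_{\infty,\infty}$ together with $\iota_{\mathcal C\mathcal W}$ commutes.) In particular, a probability distribution $\mu\in\mathcal P$ corresponds to $\Gamma''_\mu\in\mathcal T''_{\infty,\infty}$ and to $S_\mu\in\mathcal C_{\mathcal B}$, $S_\mu^\circ\in\mathcal O_{\mathcal B}$, and $W_\mu\in\mathcal W_{\mathcal B}$. Conversely, $\Gamma\in\mathcal T''_{\infty,\infty}$ corresponds to $\nu_1(\Gamma)\in\mathcal P$. Thus the mappings $\Gamma\mapsto\nu_1(\Gamma)$ and $\mu\mapsto\Gamma''_\mu$ are the inverses of each other. Moreover, these bijections are homeomorphisms, with any of the following topologies or metrics: the standard (weak) topology on $\mathcal P$; the Hausdorff metric, or the Fell topology, or the measure distance on $\mathcal C_{\mathcal B}$; the measure distance on $\mathcal O_{\mathcal B}$; the $L^1$-distance or the cut-distance $\delta''_\square$ on the set $\mathcal W_{\mathcal B}$ (and on $\mathcal T''_{\infty,\infty}$ the subspace topology from the space of bipartite graph limits).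
   Context: A bipartite graph $G$ is a finite graph with an explicit bipartition $V(G)=V_1(G)\cup V_2(G)$ into nonempty parts and $E(G)\subseteq V_1(G)\times V_2(G)$; $v_j(G)=|V_j(G)|$. It is a bipartite threshold graph if there are real weights $w'_i$ ($i\in V_1$), $w''_j$ ($j\in V_2$) and $t\in\mathbb R$ such that $ij$ is an edge iff $w'_i+w''_j>t$. For bipartite $F,G$, $t(F,G)$ is the probability that a pair of independent uniformly random maps $\phi_j:V_j(F)\to V_j(G)$, $j=1,2$, defines a graph homomorphism. Let $\mathcal B$ be the countable set of unlabeled bipartite graphs (isomorphisms preserve the ordered bipartition). $\overline{\mathcal B}$ is the compact metric space obtained as the closure of the image of $\mathcal B$ under the embedding $G\mapsto\big((t(F,G))_{F\in\mathcal B},1/v_1(G),1/v_2(G)\big)$ into $[0,1]^{\mathcal B}\times[0,1]^2$. $\mathcal B_{\infty\infty}\subset\overline{\mathcal B}$ is the compact set of all limits of sequences $(G_n)$ in $\mathcal B$ with $v_1(G_n),v_2(G_n)\to\infty$; its elements are called bipartite graph limits. The functionals $t(F,\cdot)$ extend continuously to $\overline{\mathcal B}$; $G_n\to\Gamma\in\mathcal B_{\infty\infty}$ iff $v_1(G_n),v_2(G_n)\to\infty$ and $t(F,G_n)\to t(F,\Gamma)$ for every $F\in\mathcal B$, and $\Gamma\in\mathcal B_{\infty\infty}$ is determined by the values $t(F,\Gamma)$. $\mathcal T''_{\infty,\infty}\subset\mathcal B_{\infty\infty}$ is the set of limits in $\mathcal B_{\infty\infty}$ of sequences of bipartite threshold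 graphs. For measurable $W:[0,1]^2\to[0,1]$, $\Gamma''_W\in\mathcal B_{\infty\infty}$ is the bipartite graph limit with, for every bipartite graph $F$, $$t(F,\Gamma''_W)=\int_{[0,1]^{v_1(F)+v_2(F)}}\prod_{ij\in E(F)}W(x_i,y_j)\,dx_1\cdots dx_{v_1(F)}\,dy_1\cdots dy_{v_2(F)}.$$ $\mathcal P$ is the set of (Borel) probability measures on $[0,1]$ with the topology of weak convergence. For $\Gamma\in\mathcal B_{\infty\infty}$, $\nu_1(\Gamma)\in\mathcal P$ is the (first) degree distribution: the unique element of $\mathcal P$ with $\int_0^1 s^k\,d\nu_1(\Gamma)(s)=t(K_{1,k},\Gamma)$ for all $k\ge1$, where $K_{1,k}$ is the star with one vertex in $V_1$ joined to $k$ vertices in $V_2$. ''Increasing'' is in the weak sense: $W:[0,1]^2\to\mathbb R$ is increasing if $W(x,y)\le W(x',y')$ whenever $x\le x'$, $y\le y'$; a set $S$ is increasing if its indicator $\mathbf 1_S$ is increasing, i.e. $(x,y)\in S$, $x\le x'$, $y\le y'$ imply $(x',y')\in S$ (for points of $[0,1]^2$, resp. of $(0,1)^2$ for subsets of $(0,1)^2$; the indicator of a subset of $(0,1)^2$ is then regarded as a function on $[0,1]^2$ modulo a.e. equality). $S^\circ$ is the interior of $S$ in $\mathbb R^2$. For $\mu\in\mathcal P$ put $F_\mu(x)=\mu([0,x])$, $F_\mu(x-)=\mu([0,x))$, $$S_\mu:=\{(x,y)\in[0,1]^2: x\ge F_\mu((1-y)-)\},\qquad W_\mu:=\mathbf 1_{S_\mu},\qquad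 \Gamma''_\mu:=\Gamma''_{W_\mu}.$$ The Hausdorff metric is the usual one on non-empty compact subsets of $[0,1]^2$; the Fell topology is the usual one on closed subsets. The measure distance of $S_1,S_2$ is $\lambda_2(S_1\triangle S_2)$ with $\lambda_2$ Lebesgue measure. The $L^1$-distance is $\int_{[0,1]^2}|W_1-W_2|$. The cut-distance is $\delta''_\square(W_1,W_2)=\inf_{\varphi,\psi}\sup_{A,B}\big|\int_{A\times B}\big(W_1(x,y)-W_2(\varphi(x),\psi(y))\big)\,dx\,dy\big|$, where $\varphi,\psi$ range over measure-preserving bijections of $[0,1]$ and $A,B$ over measurable subsets of $[0,1]$. *)

(* Defs.v *)
From HB Require Import structures.
From mathcomp Require Import all_boot all_order all_algebra.
From mathcomp Require Import all_classical all_reals all_analysis.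

Set Implicit Arguments.
Unset Strict Implicit.
Unset Printing Implicit Defensive.

Import Order.TTheory GRing.Theory Num.Theory.
Import numFieldNormedType.Exports.

Local Open Scope classical_set_scope.
Local Open Scope ring_scope.

Definition generated_topology (T : Type) (B : set (set T)) : Type := T.

HB.instance Definition _ (T : choiceType) (B : set (set T)) :=
  Choice.on (generated_topology B).
HB.instance Definition _ (T : choiceType) (B : set (set T)) :=
  isSubBaseTopological.Build (generated_topology B) B (fun U : set T => U).

(* The open sets of the metric [d].  This family is stable under arbitrary
   unions and finite intersections whatever [d] is, so
   [generated_topology (metric_open d)] has exactly these open sets. *)
Definition metric_open (R : realType) (T : Type) (d : T -> T -> R) :
    set (set T) :=
  [set U | forall x, U x ->
     exists2 e : R, 0 < e & forall y, d x y < e -> U y].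

Definition homeomorphism (X Y : topologicalType) (f : X -> Y) : Prop :=
  exists g : Y -> X,
    [/\ cancel f g, cancel g f, continuous f & continuous g].

(* Unlabeled graphs are represented by their labelings with vertex sets
   ['I_v1] and ['I_v2].  All notions below that depend on a graph are invariant
   under isomorphism, so this only repeats coordinates in [graph_space]. *)
Record bigraph := Bigraph {
  v1 : nat;
  v2 : nat;
  v1_gt0 : (0 < v1)%N;
  v2_gt0 : (0 < v2)%N;
  edges : {set 'I_v1 * 'I_v2} }.
HB.instance Definition _ := gen_eqMixin bigraph.
HB.instance Definition _ := gen_choiceMixin bigraph.

(* The star $K_{1,k}$ with $k = n + 1$ leaves, its centre being in the first
   part. *)
Definition star (n : nat) : bigraph :=
  @Bigraph 1 n.+1 isT isT [set: 'I_1 * 'I_n.+1].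

Definition threshold_graph (R : realType) (G : bigraph) : Prop :=
  exists (w1 : 'I_(v1 G) -> R) (w2 : 'I_(v2 G) -> R) (t : R),
    forall i j, ((i, j) \in edges G) = (t < w1 i + w2 j).

Section GraphLimits.
Variable R : realType.

Definition hom_density (F G : bigraph) : R :=
  #|[set f : {ffun 'I_(v1 F) -> 'I_(v1 G)} * {ffun 'I_(v2 F) -> 'I_(v2 G)} |
      [forall e in edges F, (f.1 e.1, f.2 e.2) \in edges G]]|%:R
  / #|{: {ffun 'I_(v1 F) -> 'I_(v1 G)} * {ffun 'I_(v2 F) -> 'I_(v2 G)}}|%:R.

Definition graph_space : Type := ({ptws bigraph -> R} * (R * R))%type.
HB.instance Definition _ := Topological.on graph_space.

Definition graph_point (G : bigraph) : graph_space :=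
  (fun F => hom_density F G, ((v1 G)%:R^-1, (v2 G)%:R^-1)).

Definition density (F : bigraph) (Gam : graph_space) : R := Gam.1 F.

Definition bigraph_limits : set graph_space :=
  [set Gam | exists G : nat -> bigraph,
    [/\ v1 (G n) @[n --> \oo] --> \oo, v2 (G n) @[n --> \oo] --> \oo
      & graph_point (G n) @[n --> \oo] --> Gam]].

Definition threshold_limits : set graph_space :=
  [set Gam | bigraph_limits Gam /\
    exists2 G : nat -> bigraph, (forall n, threshold_graph R (G n))
      & graph_point (G n) @[n --> \oo] --> Gam].

End GraphLimits.

Arguments bigraph_limits R : clear implicits.
Arguments threshold_limits R : clear implicits.

Section Bijections.
Variable R : realType.

Notation leb := (@lebesgue_measure R).

Definition unit_itv : set R := `[0, 1]%classic.
Definition unit_square : set (R * R) := unit_itv `*` unit_itv.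
Definition open_square : set (R * R) := `]0, 1[%classic `*` `]0, 1[%classic.
Definition leb2 := (leb \x leb)%E.

(* The library has no product of n measures, so
   $\int_{[0,1]^n} f(x_1, \dots, x_n)\,dx_1\cdots dx_n$ is an iterated
   integral. *)
Fixpoint cube_integral (n : nat) : (n.-tuple R -> R) -> R :=
  match n with
  | 0 => fun f => f [tuple]
  | n'.+1 => fun f =>
      \int[leb]_(x in unit_itv) cube_integral (fun t => f [tuple of x :: t])
  end.

Definition graphon_density (F : bigraph) (W : R * R -> R) : R :=
  cube_integral (fun x : (v1 F).-tuple R =>
    cube_integral (fun y : (v2 F).-tuple R =>
      \prod_(e in edges F) W (tnth x e.1, tnth y e.2))).

(* Elements of [bigraph_limits] have $1/v_1 = 1/v_2 = 0$. *)
Definition Gamma (W : R * R -> R) : graph_space R :=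
  (fun F : bigraph => graphon_density F W, (0, 0)).

(* A [probability] is a function on all sets, of which only the values on
   measurable sets are meaningful; the last condition selects one function for
   each Borel probability measure, so that equality in [unit_probabilities] is
   equality of measures. *)
Definition unit_probabilities : set (probability (measurableTypeR R) R) :=
  [set mu | mu unit_itv = 1%E /\
    forall A : set (measurableTypeR R), ~ measurable A -> mu A = 0%E].

Definition increasing_set (X S : set (R * R)) : Prop :=
  forall p q, S p -> X q -> p.1 <= q.1 -> p.2 <= q.2 -> S q.

Definition increasing_closed_sets : set (set (R * R)) :=
  [set S | [/\ S `<=` unit_square, closed S, increasing_set unit_square S
    & (unit_itv `*` [set 1]) `|` ([set 1] `*` unit_itv) `<=` S]].

Definition increasing_open_sets : set (set (R * R)) :=
  [set S | [/\ S `<=` open_square, open S & increasing_set open_square S]].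

(* No measurability is required: an increasing function is Lebesgue measurable,
   i.e. a.e. equal to a Borel function.  The library integral, a supremum over
   simple functions below the integrand, is still the Lebesgue integral for
   bounded functions that are a.e. equal to a Borel function. *)
Definition increasing01 (W : R * R -> R) : Prop :=
  (forall p, unit_square p -> W p = 0 \/ W p = 1) /\
  (forall p q, unit_square p -> unit_square q ->
     p.1 <= q.1 -> p.2 <= q.2 -> W p <= W q).

(* The class of [W] modulo a.e. equality on the unit square; values outside the
   square are irrelevant. *)
Definition ae_class (W : R * R -> R) : set (R * R -> R) :=
  [set W' | W' = W %[ae leb2 in unit_square]].

Definition increasing01_classes : set (set (R * R -> R)) :=
  [set ae_class W | W in increasing01].

Definition is_degree_distribution (Gam : threshold_limits R)
    (mu : unit_probabilities) : Prop :=
  forall k, \int[val mu]_(s in unit_itv) (s ^+ k.+1)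
    = density (star k) (val Gam).

(* [mu `[0, 1 - y[] is $F_\mu((1 - y)-)$. *)
Definition S_ (mu : unit_probabilities) : set (R * R) :=
  [set p | unit_square p /\
    (val mu `[0%R, (1 - p.2)%R[%classic <= p.1%:E)%E].

Definition W_ (mu : unit_probabilities) : R * R -> R := \1_(S_ mu).

Definition Gamma_ (mu : unit_probabilities) : graph_space R := Gamma (W_ mu).

Definition unit_continuous : Type :=
  {f : R -> R | {within unit_itv, continuous f}}.
HB.instance Definition _ := gen_eqMixin unit_continuous.
HB.instance Definition _ := gen_choiceMixin unit_continuous.

(* Weak convergence: the coarsest topology for which
   $\mu \mapsto \int f\,d\mu$ is continuous for every continuous [f]. *)
Definition weak_integrals (mu : unit_probabilities) :
    {ptws unit_continuous -> R} :=
  fun f => \int[val mu]_(s in unit_itv) sval f s.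

Definition weak_probabilities : Type := initial_topology weak_integrals.
HB.instance Definition _ := Topological.on weak_probabilities.

Definition euclidean_dist (p q : R * R) : R :=
  Num.sqrt ((p.1 - q.1) ^+ 2 + (p.2 - q.2) ^+ 2).

Definition dist_to_set (p : R * R) (S : set (R * R)) : R :=
  inf [set euclidean_dist p q | q in S].

Definition hausdorff_dist (S1 S2 : increasing_closed_sets) : R :=
  Num.max (sup [set dist_to_set p (val S2) | p in val S1])
          (sup [set dist_to_set p (val S1) | p in val S2]).

Definition fell_subbase : set (set increasing_closed_sets) :=
  [set [set S : increasing_closed_sets | val S `&` K = set0]
    | K in [set K : set (R * R) | K `<=` unit_square /\ compact K]] `|`
  [set [set S : increasing_closed_sets | val S `&` U !=set0]
    | U in [set U : set (R * R) | open U]].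

Definition measure_dist (A : set (set (R * R))) (S1 S2 : A) : R :=
  fine (leb2 (val S1 `+` val S2)).

(* The [xget] always finds an increasing representative; the distances below do
   not depend on which one. *)
Definition representative (w : increasing01_classes) : R * R -> R :=
  xget (cst 0) [set W | increasing01 W /\ val w = ae_class W].

Definition L1_dist (w1 w2 : increasing01_classes) : R :=
  \int[leb2]_(p in unit_square) `|representative w1 p - representative w2 p|.

Definition measure_preserving_bijection (phi : R -> R) : Prop :=
  [/\ set_bij unit_itv unit_itv phi,
      measurable_fun (unit_itv : set (measurableTypeR R))
        (phi : _ -> measurableTypeR R)
    & forall A : set (measurableTypeR R), measurable A -> A `<=` unit_itv ->
        leb (unit_itv `&` phi @^-1` A) = leb A].

Definition cut_norm (U : R * R -> R) : R :=
  sup [set x | exists A B : set (measurableTypeR R),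
    [/\ measurable A, measurable B, A `<=` unit_itv, B `<=` unit_itv
      & x = `|\int[leb2]_(p in A `*` B) U p|]].

Definition cut_dist (w1 w2 : increasing01_classes) : R :=
  inf [set x | exists phi psi : R -> R,
    [/\ measure_preserving_bijection phi, measure_preserving_bijection psi
      & x = cut_norm (fun p =>
          representative w1 p - representative w2 (phi p.1, psi p.2))]].

Definition closed_set_topologies : set (set (set increasing_closed_sets)) :=
  [set metric_open hausdorff_dist; fell_subbase;
       metric_open (@measure_dist increasing_closed_sets)].

Definition class_topologies : set (set (set increasing01_classes)) :=
  [set metric_open L1_dist; metric_open cut_dist].

End Bijections.

Arguments unit_probabilities R : clear implicits.
Arguments increasing_closed_sets R : clear implicits.
Arguments increasing_open_sets R : clear implicits.
Arguments increasing01_classes R : clear implicits.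

(* Main.v *)
(** All spaces of the theorem are compared with the increasing closed sets [S],
    on which "[S] and [T] are within [e]" means that each of them, translated by
    [e] along the diagonal, lies in the other ([levy]).  Every [t(F, .)] is
    Lipschitz for this notion, because the integral of a monotone function moves
    by at most [e] when its argument is translated by [e].  Conversely, the star
    densities are the moments of the degree distribution, which determine weak
    convergence (Bernstein polynomials), and the set [S_mu] is read off the
    distribution function of [mu]; so convergence of the star densities implies
    convergence for [levy].  In each of the topologies of the theorem the sets
    close to [S] for [levy] form a basis of neighbourhoods, hence bijections that
    respect the associated closed sets are homeomorphisms.

    Rearranging rows and columns does not change the degree distribution, so a
    small cut distance makes the star densities close.  A threshold graph, with
    its vertices sorted by weight, is the indicator of an increasing set, and
    compactness of the family of these sets (along an ultrafilter) shows that the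
    limits of threshold graphs are exactly the [Gamma 1_S]. *)

(* Closed sets serve as the common model because every measure, class and limit determines exactly
   one of them. Increasing functions need not be Borel and an a.e. class has many increasing
   members; [hull] sends all of them to the same closed set, and integrals are compared either by
   monotonicity or off the boundary of the hull, which is null. A relation with a parameter is
   handier than a metric here: its errors add under composition, and it enters an integral directly,
   at the cost of one [e] per variable. The way back from moments to [levy] is qualitative. It is
   stated along an arbitrary filter, later taken to be the balls of the cut distance, the weak
   neighbourhoods of a measure or the neighbourhoods of a limit; applied to a constant sequence, it
   yields injectivity. The cut distance lies below the area of the symmetric difference, so
   inverting the former inverts the latter. One marginal suffices because the vertical sections of
   an increasing set are final segments: the law of their lengths determines the set. *)
From HB Require Import structures.
Require Import Defs.
From mathcomp Require Import all_boot all_order all_algebra finmap.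
From mathcomp Require Import all_classical all_reals all_analysis.
From mathcomp Require Import measurable_realfun ring lra.

Set Implicit Arguments.
Unset Strict Implicit.
Unset Printing Implicit Defensive.

Import Order.TTheory GRing.Theory Num.Theory.
Import numFieldNormedType.Exports.

Local Open Scope classical_set_scope.
Local Open Scope ring_scope.

(** * Translates of monotone functions *)

Section MonotoneIntegrals.
Variable R : realType.
Local Notation leb := (@lebesgue_measure R).
Local Notation I01 := (@unit_itv R).

Lemma unit_itvP (x : R) : I01 x <-> 0 <= x <= 1.
Proof. by rewrite /unit_itv /= in_itv. Qed.

Lemma measurable_unit_itv : measurable (I01 : set (measurableTypeR R)).
Proof. exact: measurable_itv. Qed.

Lemma leb_unit_itv : leb I01 = 1%E.
Proof. by rewrite lebesgue_measure_itv /= lte_fin ltr01 oppr0 adde0. Qed.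

Lemma Rintegral01_cst (c : R) : \int[leb]_(x in I01) c = c.
Proof.
rewrite Rintegral_cst; last exact: measurable_unit_itv.
by rewrite [X in fine X]leb_unit_itv mulr1.
Qed.

Lemma unit_square_pair (x y : R) : I01 x -> I01 y -> unit_square (x, y).
Proof. by []. Qed.

Lemma measurable_translate (e : R) :
  measurable_fun setT ((fun x => x + e) : measurableTypeR R -> measurableTypeR R).
Proof. by apply: nondecreasing_measurable => // x y xy; rewrite lerD2r. Qed.

(** Lebesgue measure is the only measure that gives half-open intervals their length, and its image
    under a translation does so too. *)
Lemma leb_translate (e : R) (A : set (measurableTypeR R)) :
  measurable A ->
  pushforward leb ((fun x => x + e) : measurableTypeR R -> measurableTypeR R) A
  = leb A.
Proof.
move=> mA.
pose mphi := isMeasurableFun.Build _ _ _ _ _ (measurable_translate e).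
pose phi : {mfun measurableTypeR R >-> measurableTypeR R} :=
  HB.pack ((fun x => x + e) : measurableTypeR R -> measurableTypeR R) mphi.
rewrite [RHS](@lebesgue_measure_unique R (pushforward leb phi)) //.
move=> X [[a b] _ <-]; transitivity (leb `]a - e, b - e]%classic).
  rewrite !lebesgue_measure_itv /= !lte_fin ltrBlDr subrK; case: ifP => // _.
  by rewrite -!EFinD; congr EFin; lra.
congr (leb _).
by apply/seteqP; split => x /=; rewrite !in_itv /= ltrBlDr lerBrDr.
Qed.

Lemma Rintegral_translate (e a b : R) (f : R -> R) :
  measurable_fun setT (f : measurableTypeR R -> measurableTypeR R) ->
  (forall x, 0 <= f x) ->
  \int[leb]_(x in `[a, b]) f (x + e) = \int[leb]_(x in `[a + e, b + e]) f x.
Proof.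
move=> mf f0; rewrite /Rintegral; congr fine.
pose mphi := isMeasurableFun.Build _ _ _ _ _ (measurable_translate e).
pose phi : {mfun measurableTypeR R >-> measurableTypeR R} :=
  HB.pack ((fun x => x + e) : measurableTypeR R -> measurableTypeR R) mphi.
transitivity (\int[pushforward leb phi]_(x in [set` `[a + e, b + e]%R]) (f x)%:E)%E.
  rewrite ge0_integral_pushforward //=.
  - congr (integral _ _ _); apply/seteqP; split => x /=;
      by rewrite !in_itv /= !lerD2r.
  - exact: measurable_translate.
  - exact/measurable_EFinP/measurable_funTS.
  - by move=> x _; rewrite lee_fin.
by apply: eq_measure_integral => A mA _; exact: leb_translate.
Qed.

Definition monotone01 (f : R -> R) : Prop :=
  (forall x, I01 x -> 0 <= f x <= 1) /\
  (forall x y, I01 x -> I01 y -> x <= y -> f x <= f y).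

(** Extended by 0 on the left and by 1 on the right, a function in [monotone01] is monotone on the
    whole line, so its translates stay defined and measurable. The values at 0 and 1 are
    overwritten, which integrals do not see. *)
Definition extend01 (f : R -> R) (x : R) : R :=
  if x <= 0 then 0 else if 1 <= x then 1 else f x.

Lemma extend01_ge0le1 f : monotone01 f -> forall x, 0 <= extend01 f x <= 1.
Proof.
move=> [f01 _] x; rewrite /extend01; case: ifPn => [|x0]; first by rewrite lexx ler01.
case: ifPn => [|x1]; first by rewrite lexx ler01.
by apply: f01; apply/unit_itvP; lra.
Qed.

Lemma extend01_nd f : monotone01 f -> nondecreasing_fun (extend01 f).
Proof.
move=> mf x y xy; have [x0|x0] := leP x 0.
  by rewrite {1}/extend01 x0; have /andP[] := extend01_ge0le1 mf y.
have y0 : (y <= 0) = false by lra.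
have [y1|y1] := leP 1 y.
  by rewrite {2}/extend01 y1 y0; have /andP[] := extend01_ge0le1 mf x.
have x0' : (x <= 0) = false by lra.
have x1 : (1 <= x) = false by lra.
have y1' : (1 <= y) = false by lra.
rewrite /extend01 x0' y0 x1 y1'.
by apply: mf.2 => //; apply/unit_itvP; lra.
Qed.

Lemma extend01_measurable f : monotone01 f ->
  measurable_fun setT (extend01 f : measurableTypeR R -> measurableTypeR R).
Proof. by move=> mf; apply: nondecreasing_measurable => //; exact: extend01_nd. Qed.

(** Clamping the argument to the unit interval gives a function that is monotone on the whole line
    and agrees with [f] on the interval. *)
Lemma monotone01_measurable f : monotone01 f ->
  measurable_fun I01 (f : measurableTypeR R -> measurableTypeR R).
Proof.
move=> [f01 fnd].
pose g x := f (Num.max 0 (Num.min x 1)).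
have clI x : I01 (Num.max 0 (Num.min x 1)).
  by apply/unit_itvP; rewrite le_max lexx /= ge_max ler01 /= ge_min lexx orbT.
have : measurable_fun I01 (g : measurableTypeR R -> measurableTypeR R).
  apply: nondecreasing_measurable; first exact: measurable_unit_itv.
  move=> x y xy; rewrite /g fnd // ge_max le_max lexx /= le_max; apply/orP; right.
  by rewrite le_min !ge_min xy lexx !orbT.
apply: eq_measurable_fun => x; rewrite inE => /unit_itvP /andP[x0 x1].
by rewrite /g min_l // max_r.
Qed.

Lemma bounded_integrable01 (f : R -> R) (M : R) :
  measurable_fun I01 (f : measurableTypeR R -> measurableTypeR R) ->
  (forall x, I01 x -> `|f x| <= M) -> leb.-integrable I01 (EFin \o f).
Proof.
move=> mf f01; apply: measurable_bounded_integrable => //.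
- exact: measurable_unit_itv.
- by rewrite [ltLHS]leb_unit_itv ltry.
- exists M; split; first exact: num_real.
  by move=> N MN x Ix; rewrite /=; apply: le_trans (ltW MN); exact: f01.
Qed.

Lemma monotone01_integrable f : monotone01 f -> leb.-integrable I01 (EFin \o f).
Proof.
move=> mf; apply: (@bounded_integrable01 f 1); first exact: monotone01_measurable.
by move=> x Ix; have := mf.1 x Ix => /andP[? ?]; rewrite ger0_norm.
Qed.

Lemma Rintegral_extend01 f : monotone01 f ->
  \int[leb]_(x in I01) extend01 f x = \int[leb]_(x in I01) f x.
Proof.
move=> mf; rewrite /Rintegral; congr fine.
apply: eq_integral_itv_bounded.
- apply: measurable_funTS; exact: extend01_measurable.
- apply: measurable_funS (monotone01_measurable mf) => //.
  exact: measurable_unit_itv.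
  by move=> x; rewrite /= in_itv /= => /andP[x0 x1]; apply/unit_itvP; rewrite (ltW x0) (ltW x1).
- move=> x; rewrite in_itv /= => /andP[x0 x1]; have x0' : (x <= 0) = false by rewrite leNgt x0.
  have x1' : (1 <= x) = false by rewrite leNgt x1.
  by rewrite /extend01 x0' x1'.
Qed.

(** The translated integral runs over [[e, 1 + e]]. Enlarging the domain to [[0, 1 + e]] can only
    add to it, and the part beyond 1 has length [e] and integrand at most 1. *)
Lemma Rintegral_extend01_shift f (e : R) : monotone01 f -> 0 <= e ->
  \int[leb]_(x in I01) extend01 f (x + e) <= \int[leb]_(x in I01) f x + e.
Proof.
move=> mf e0.
have mE := extend01_measurable mf.
have E01 := extend01_ge0le1 mf.
have iE (a b : R) : leb.-integrable `[a, b] (EFin \o extend01 f).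
  apply: measurable_bounded_integrable => //.
  - by rewrite /= lebesgue_measure_itv; case: ifP; rewrite ?ltry // -EFinB ltry.
  - exact: measurable_funTS.
  - exists 1; split; first exact: num_real.
    move=> N MN x _ /=; apply: le_trans (ltW MN).
    by have /andP[? ?] := E01 x; rewrite ger0_norm.
rewrite Rintegral_translate //; last by move=> x; have /andP[] := E01 x.
rewrite add0r -Rintegral_extend01 //.
apply: (@le_trans _ _ (\int[leb]_(x in `[0, 1 + e]) extend01 f x)).
  rewrite /Rintegral fine_le //; try by apply: integrable_fin_num => //; exact: iE.
  apply: ge0_subset_integral => //.
  - exact/measurable_EFinP/measurable_funTS.
  - by move=> x _; rewrite lee_fin; have /andP[] := E01 x.
  - by move=> x /=; rewrite !in_itv /= => /andP[? ->]; rewrite andbT; lra.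
have -> : \int[leb]_(x in `[0, 1 + e]) extend01 f x =
    \int[leb]_(x in I01) extend01 f x + \int[leb]_(x in `]1, 1 + e]) extend01 f x.
  rewrite -(@Rintegral_itvB _ _ (BLeft 0) (BRight (1 + e)) 1) ?bnd_simp //=.
    by rewrite /unit_itv subrKC.
  by lra.
rewrite lerD2l; apply: (@le_trans _ _ (\int[leb]_(x in `]1, 1 + e]) 1)).
  apply: le_Rintegral => //.
  - by apply: integrableS (iE 1 (1 + e)) => // x /=; rewrite !in_itv /= => /andP[/ltW -> ->].
  - apply: (@integrableS _ _ _ leb `[1, 1 + e]%classic) => //.
      by move=> x /=; rewrite !in_itv /= => /andP[/ltW -> ->].
    apply: measurable_bounded_integrable => //.
      by rewrite /= lebesgue_measure_itv; case: ifP; rewrite ?ltry // -EFinB ltry.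
    by exists 1; split=> // N N1 x _ /=; rewrite normr1 ltW.
  - by move=> x _; have /andP[] := E01 x.
rewrite Rintegral_cst //= [X in fine X]lebesgue_measure_itv /=; case: ifP => _ /=; lra.
Qed.

(** Where [x + e] reaches 1 the extension of [g] is already 1, and at [x <= 0] that of [f] is 0, so
    only interior points have to be compared. The constant [c] will carry the cost of the inner
    integrations, and [e] is the cost of this one. *)
Lemma le_Rintegral_shift (f g : R -> R) (c e : R) :
  monotone01 f -> monotone01 g -> 0 <= c -> 0 <= e ->
  (forall x, 0 < x -> x + e < 1 -> f x <= g (x + e) + c) ->
  \int[leb]_(x in I01) f x <= \int[leb]_(x in I01) g x + (c + e).
Proof.
move=> mf mg c0 e0 fg.
rewrite -(Rintegral_extend01 mf).
have mT : measurable_fun setT ((fun x => extend01 g (x + e)) : measurableTypeR R -> measurableTypeR R).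
  apply: nondecreasing_measurable => // x y xy; apply: extend01_nd => //; lra.
have ig : leb.-integrable I01 (EFin \o (fun x => extend01 g (x + e))).
  apply: (@bounded_integrable01 _ 1); first exact: measurable_funTS.
  by move=> x _; have /andP[? ?] := extend01_ge0le1 mg (x + e); rewrite ger0_norm.
have ic : leb.-integrable I01 (EFin \o cst c).
  by apply: (@bounded_integrable01 _ `|c|) => // x.
apply: (@le_trans _ _ (\int[leb]_(x in I01) (extend01 g (x + e) + c))).
  apply: le_Rintegral => //; first exact: measurable_unit_itv.
  - apply: (@bounded_integrable01 _ 1); first by apply: measurable_funTS; exact: extend01_measurable.
    by move=> x _; have /andP[? ?] := extend01_ge0le1 mf x; rewrite ger0_norm.
  - apply: (@bounded_integrable01 _ (1 + c)).
      apply: nondecreasing_measurable; first exact: measurable_unit_itv.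
      move=> x y xy; rewrite lerD2r; apply: extend01_nd => //; lra.
    move=> x _; have /andP[? ?] := extend01_ge0le1 mg (x + e).
    by rewrite ger0_norm; lra.
  - move=> x /unit_itvP /andP[x0 x1].
    have /andP[g0 g1] := extend01_ge0le1 mg (x + e).
    have /andP[f0 f1] := extend01_ge0le1 mf x.
    have [xe|xe] := leP 1 (x + e).
      suff -> : extend01 g (x + e) = 1 by lra.
      have xe0 : (x + e <= 0) = false by lra.
      by rewrite /extend01 xe0 xe.
    have [x0'|x0'] := leP x 0; first by rewrite {1}/extend01 x0'; lra.
    have := fg x x0' xe.
    have -> : extend01 f x = f x.
      by rewrite /extend01 leNgt x0' /= leNgt (_ : x < 1) //; lra.
    suff -> : extend01 g (x + e) = g (x + e) by [].
    by rewrite /extend01 leNgt (_ : 0 < x + e) /= ?leNgt ?xe //; lra.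
rewrite RintegralD //; last exact: measurable_unit_itv.
rewrite Rintegral01_cst [c + e]addrC addrA lerD2r.
exact: Rintegral_extend01_shift.
Qed.

Lemma le_Rintegral01 f g : monotone01 f -> monotone01 g ->
  (forall x, I01 x -> f x <= g x) ->
  \int[leb]_(x in I01) f x <= \int[leb]_(x in I01) g x.
Proof.
by move=> mf mg fg; apply: le_Rintegral => //;
  [exact: measurable_unit_itv|exact: monotone01_integrable..].
Qed.

Lemma Rintegral01_ge0le1 f : monotone01 f -> 0 <= \int[leb]_(x in I01) f x <= 1.
Proof.
move=> mf; rewrite Rintegral_ge0 /=; last by move=> x /mf.1 /andP[].
rewrite -[leRHS](Rintegral01_cst 1); apply: le_Rintegral01 => //.
  by split=> // x _; rewrite ler01 lexx.
by move=> x /mf.1 /andP[].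
Qed.

Definition cube n : set (n.-tuple R) := [set t | forall i, I01 (tnth t i)].

(** Monotonicity passes from a function to its partial integrals, so each stage of an iterated
    integral has a measurable integrand and no measure on the cube is called for. *)
Definition monotone_cube n (f : n.-tuple R -> R) : Prop :=
  (forall t, cube t -> 0 <= f t <= 1) /\
  (forall t t', cube t -> cube t' -> (forall i, tnth t i <= tnth t' i) ->
     f t <= f t').

Lemma cube_cons n x (t : n.-tuple R) : cube [tuple of x :: t] <-> I01 x /\ cube t.
Proof.
split=> [h|[hx ht] i].
  split; first by have := h ord0; rewrite tnth0.
  by move=> i; have := h (lift ord0 i); rewrite tnthS.
case: (unliftP ord0 i) => [j ->|->]; last by rewrite tnth0.
by rewrite tnthS.
Qed.

Lemma monotone_cube_cons n (f : n.+1.-tuple R -> R) x : monotone_cube f ->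
  I01 x -> monotone_cube (fun t => f [tuple of x :: t]).
Proof.
move=> [f01 fnd] Ix; split=> [t ht|t t' ht ht' tt'].
  by apply: f01; exact/cube_cons.
apply: fnd; [exact/cube_cons|exact/cube_cons|move=> i].
case: (unliftP ord0 i) => [j ->|->]; last by rewrite !tnth0.
by rewrite !tnthS.
Qed.

(** Both bounds go through one induction: a partial integral is in [monotone01] only if the inner
    integrals are bounded and monotone, and only then can the outer integrals be bounded and
    compared. *)
Lemma cube_integral_ge0le1_le n : (forall f : n.-tuple R -> R, monotone_cube f ->
    0 <= cube_integral f <= 1) /\
  (forall f g : n.-tuple R -> R, monotone_cube f -> monotone_cube g ->
    (forall t, cube t -> f t <= g t) -> cube_integral f <= cube_integral g).
Proof.
elim: n => [|n [IH1 IH2]].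
  by split=> [f [f01 _]|f g _ _]; [apply: f01|apply] => -[].
have mono f : monotone_cube f ->
    monotone01 (fun x => cube_integral (fun t : n.-tuple R => f [tuple of x :: t])).
  move=> mf; split=> [x Ix|x y Ix Iy xy].
    by apply: IH1; exact: monotone_cube_cons.
  apply: IH2; [exact: monotone_cube_cons|exact: monotone_cube_cons|move=> t ht].
  apply: mf.2; [exact/cube_cons|exact/cube_cons|move=> i].
  by case: (unliftP ord0 i) => [j ->|->]; [rewrite !tnthS|rewrite !tnth0].
split=> [f mf|f g mf mg fg] /=; first exact/Rintegral01_ge0le1/mono.
apply: le_Rintegral01; [exact: mono|exact: mono|move=> x Ix].
apply: IH2; [exact: monotone_cube_cons|exact: monotone_cube_cons|move=> t ht].
by apply: fg; exact/cube_cons.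
Qed.

Lemma cube_integral_ge0le1 n (f : n.-tuple R -> R) : monotone_cube f ->
  0 <= cube_integral f <= 1.
Proof. exact: (cube_integral_ge0le1_le n).1. Qed.

Lemma le_cube_integral n (f g : n.-tuple R -> R) : monotone_cube f ->
  monotone_cube g -> (forall t, cube t -> f t <= g t) ->
  cube_integral f <= cube_integral g.
Proof. exact: (cube_integral_ge0le1_le n).2. Qed.

Lemma monotone01_cube_integral n (f : n.+1.-tuple R -> R) : monotone_cube f ->
  monotone01 (fun x => cube_integral (fun t : n.-tuple R => f [tuple of x :: t])).
Proof.
move=> mf; split=> [x Ix|x y Ix Iy xy].
  by apply: cube_integral_ge0le1; exact: monotone_cube_cons.
apply: le_cube_integral; [exact: monotone_cube_cons|exact: monotone_cube_cons|].
move=> t ht; apply: mf.2; [exact/cube_cons|exact/cube_cons|move=> i].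
by case: (unliftP ord0 i) => [j ->|->]; [rewrite !tnthS|rewrite !tnth0].
Qed.

Lemma le_cube_integral_shift n (f g : n.-tuple R -> R) (c e : R) :
  monotone_cube f -> monotone_cube g -> 0 <= c -> 0 <= e ->
  (forall t t' : n.-tuple R, (forall i, 0 < tnth t i) ->
     (forall i, tnth t i + e = tnth t' i) -> (forall i, tnth t' i < 1) ->
     f t <= g t' + c) ->
  cube_integral f <= cube_integral g + (c + n%:R * e).
Proof.
move=> + + c0 e0; elim: n => [|n IH] in f g *.
  by move=> _ _ fg /=; rewrite mul0r addr0; apply: fg => -[].
move=> mf mg fg /=.
have -> : c + n.+1%:R * e = c + n%:R * e + e by rewrite -natr1; ring.
apply: le_Rintegral_shift => //; [exact: monotone01_cube_integral|
  exact: monotone01_cube_integral|by rewrite addr_ge0 // mulr_ge0|].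
move=> x x0 xe; apply: IH.
- by apply: monotone_cube_cons => //; apply/unit_itvP; lra.
- by apply: monotone_cube_cons => //; apply/unit_itvP; lra.
- move=> t t' t0 tt' t1; apply: fg => i;
  by case: (unliftP ord0 i) => [j ->|->]; rewrite ?tnthS ?tnth0.
Qed.

Lemma increasing01_ge0le1 (W : R * R -> R) : increasing01 W ->
  forall p, unit_square p -> 0 <= W p <= 1.
Proof. by move=> [W01 _] p /W01 [|] ->; rewrite ?lexx ?ler01. Qed.

Lemma monotone_cube_prod (F : bigraph) (W : R * R -> R) (x : (v1 F).-tuple R) :
  increasing01 W -> cube x ->
  monotone_cube (fun y : (v2 F).-tuple R =>
    \prod_(e in edges F) W (tnth x e.1, tnth y e.2)).
Proof.
move=> iW hx; split=> [y hy|y y' hy hy' yy'].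
  rewrite prodr_ge0 /=; last first.
    by move=> e _; have /andP[] := increasing01_ge0le1 iW (unit_square_pair (hx e.1) (hy e.2)).
  apply: prodr_ile1 => e _.
  exact: (increasing01_ge0le1 iW (unit_square_pair (hx e.1) (hy e.2))).
apply: ler_prod => e _; apply/andP; split.
  by have /andP[] := increasing01_ge0le1 iW (unit_square_pair (hx e.1) (hy e.2)).
by apply: iW.2; [exact: (unit_square_pair (hx _) (hy _))|
  exact: (unit_square_pair (hx _) (hy' _))|exact: lexx|exact: yy'].
Qed.

Lemma monotone_cube_graphon (F : bigraph) (W : R * R -> R) : increasing01 W ->
  monotone_cube (fun x : (v1 F).-tuple R =>
    cube_integral (fun y : (v2 F).-tuple R =>
      \prod_(e in edges F) W (tnth x e.1, tnth y e.2))).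
Proof.
move=> iW; split=> [x hx|x x' hx hx' xx'].
  by apply: cube_integral_ge0le1; exact: monotone_cube_prod.
apply: le_cube_integral; [exact: monotone_cube_prod|exact: monotone_cube_prod|].
move=> y hy; apply: ler_prod => e _; apply/andP; split.
  by have /andP[] := increasing01_ge0le1 iW (unit_square_pair (hx e.1) (hy e.2)).
by apply: iW.2; [exact: (unit_square_pair (hx _) (hy _))|
  exact: (unit_square_pair (hx' _) (hy _))|exact: xx'|exact: lexx].
Qed.

(** Every variable is translated by [e], and each translation costs [e]. The translates of an edge's
    two variables are compared only at points of the open square that stay in it. *)
Lemma graphon_density_shift (F : bigraph) (W W' : R * R -> R) (e : R) :
  increasing01 W -> increasing01 W' -> 0 <= e ->
  (forall x y, 0 < x -> x + e < 1 -> 0 < y -> y + e < 1 ->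
     W (x, y) <= W' (x + e, y + e)) ->
  graphon_density F W <= graphon_density F W' + (v1 F + v2 F)%:R * e.
Proof.
move=> iW iW' e0 WW'.
have -> : (v1 F + v2 F)%:R * e = (v2 F)%:R * e + (v1 F)%:R * e.
  by rewrite natrD; ring.
apply: le_cube_integral_shift => //; [exact: monotone_cube_graphon|
  exact: monotone_cube_graphon|by rewrite mulr_ge0|].
move=> x x' x0 xx' x1.
have hx : cube x by move=> i; apply/unit_itvP; have := x0 i; have := x1 i; rewrite -xx'; lra.
have hx' : cube x' by move=> i; apply/unit_itvP; have := x0 i; have := x1 i; rewrite -xx'; lra.
rewrite -[(v2 F)%:R * e]add0r.
apply: le_cube_integral_shift => //; [exact: monotone_cube_prod|exact: monotone_cube_prod|].
move=> y y' y0 yy' y1; rewrite addr0.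
have hy : cube y by move=> i; apply/unit_itvP; have := y0 i; have := y1 i; rewrite -yy'; lra.
apply: ler_prod => i _; apply/andP; split.
  by have /andP[] := increasing01_ge0le1 iW (unit_square_pair (hx i.1) (hy i.2)).
rewrite -xx' -yy'; apply: WW' => //; first by rewrite xx'.
by rewrite yy'.
Qed.

End MonotoneIntegrals.

(** * Diagonal translates of increasing closed sets *)

Section IncreasingClosedSets.
Variable R : realType.
Local Notation C := (increasing_closed_sets R).
Implicit Types (S T : set (R * R)) (p q : R * R) (W : R * R -> R).

(** Truncation at 1 keeps the square stable, and a point pushed onto the upper or right edge lands
    in every member of [C]. *)
Definition shift (e : R) (p : R * R) : R * R :=
  (Num.min (p.1 + e) 1, Num.min (p.2 + e) 1).

Lemma unit_squareP p :
  unit_square p <-> [/\ 0 <= p.1, p.1 <= 1, 0 <= p.2 & p.2 <= 1].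
Proof.
split; first by move=> [/unit_itvP /andP[? ?] /unit_itvP /andP[? ?]].
by move=> [? ? ? ?]; split; apply/unit_itvP; apply/andP.
Qed.

Lemma shiftD a b p : 0 <= a -> 0 <= b -> shift a (shift b p) = shift (b + a) p.
Proof.
move=> a0 b0.
suff h (x : R) : Num.min (Num.min (x + b) 1 + a) 1 = Num.min (x + (b + a)) 1.
  by rewrite /shift /= !h.
have [xb|xb] := leP (x + b) 1; first by rewrite addrA.
by rewrite !min_r //; lra.
Qed.

Lemma unit_square_shift e p : 0 <= e -> unit_square p -> unit_square (shift e p).
Proof.
move=> e0 /unit_squareP[p1 p1' p2 p2']; apply/unit_squareP.
by split=> /=; rewrite ?le_min ?ge_min ?lexx ?orbT ?addr_ge0 ?ler01.
Qed.

Lemma ge_shift e p : 0 <= e -> unit_square p ->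
  p.1 <= (shift e p).1 /\ p.2 <= (shift e p).2.
Proof. by move=> e0 /unit_squareP[*]; rewrite /= !le_min !lerDl; lra. Qed.

Lemma shift_le a b p : a <= b ->
  (shift a p).1 <= (shift b p).1 /\ (shift a p).2 <= (shift b p).2.
Proof. by move=> ab; rewrite /= !le_min !ge_min lexx !orbT !andbT !lerD2l ab. Qed.

Lemma increasing_closed_unit_square S p : C S -> S p -> unit_square p.
Proof. by move=> [h _ _ _]; exact: h. Qed.

Lemma increasing_closed_le S p q : C S -> S p -> unit_square q ->
  p.1 <= q.1 -> p.2 <= q.2 -> S q.
Proof. by move=> [_ _ h _]; exact: h. Qed.

Lemma increasing_closed_edge S p : C S -> unit_square p ->
  p.1 = 1 \/ p.2 = 1 -> S p.
Proof. by case: p => x y [_ _ _ h] [/= hx hy] [] /= E; apply: h; [right|left]; split. Qed.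

Lemma increasing_closed_shift_le S a b p : C S -> 0 <= a -> a <= b ->
  unit_square p -> S (shift a p) -> S (shift b p).
Proof.
move=> hS a0 ab hp h; have [? ?] := shift_le p ab.
by apply: increasing_closed_le h _ _ _ => //; apply: unit_square_shift => //; lra.
Qed.

Lemma increasing_closed_shift S e p : C S -> 0 <= e -> S p -> S (shift e p).
Proof.
move=> hS e0 h; have hp := increasing_closed_unit_square hS h.
have [? ?] := ge_shift e0 hp.
by apply: increasing_closed_le h _ _ _ => //; apply: unit_square_shift.
Qed.

Lemma le_shift_of_ball e p q : 0 < e -> unit_square q -> ball p e q ->
  q.1 <= (shift e p).1 /\ q.2 <= (shift e p).2.
Proof.
move=> e0 /unit_squareP[? ? ? ?] [].
rewrite /ball /= !ltr_norml => /andP[? ?] /andP[? ?].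
by rewrite !le_min; split; apply/andP; split => //; lra.
Qed.

Lemma ball_shift e p : 0 < e -> unit_square p -> ball p e (shift (e / 2) p).
Proof.
move=> e0 /unit_squareP[? ? ? ?].
have h (x : R) : x <= 1 -> `|x - Num.min (x + e / 2) 1| < e.
  by move=> x1; rewrite minEle; case: ifP => ?; rewrite ltr_norml; apply/andP; split; lra.
by split; rewrite /ball /=; exact: h.
Qed.

Lemma closed_unit_square : closed (@unit_square R).
Proof.
by apply: closedI; apply: closed_comp; try exact: itv_closed; move=> x _;
  [exact: cvg_fst|exact: cvg_snd].
Qed.

Lemma increasing_closed_limit S p : C S -> unit_square p ->
  (forall e, 0 < e -> S (shift e p)) -> S p.
Proof.
move=> [_ cS _ _] hp h; apply: cS => B /nbhs_ballP[e /= e0 eB].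
exists (shift (e / 2) p); split; first by apply: h; rewrite divr_gt0.
by apply: eB; exact: ball_shift.
Qed.

(** A point of [S] within [e] of [p] lies below [shift e p]. Hence an increasing set is closed as
    soon as it is closed under limits that descend along the diagonal. *)
Lemma increasing_closed_intro S : S `<=` (@unit_square R) ->
  increasing_set (@unit_square R) S ->
  (forall p, unit_square p -> p.1 = 1 \/ p.2 = 1 -> S p) ->
  (forall p, unit_square p -> (forall e, 0 < e -> S (shift e p)) -> S p) ->
  C S.
Proof.
move=> Ssq Sinc Sedge Slim; split=> //.
- move=> p cp; have hp : unit_square p.
    by apply: closed_unit_square; exact: closure_subset cp.
  apply: Slim => // e e0.
  have [q [Sq pq]] := cp _ (nbhsx_ballx p e e0).
  have [? ?] := le_shift_of_ball e0 (Ssq _ Sq) pq.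
  by apply: Sinc Sq _ _ _ => //; apply: unit_square_shift => //; exact: ltW.
- move=> [x y] [[/= hx ->]|[/= -> hy]]; apply: Sedge; rewrite /=; [|by right| |by left];
   by split=> //=; apply/unit_itvP; rewrite ler01 lexx.
Qed.

(** For the sets [S_ mu] this is the condition that defines the Lévy metric between distribution
    functions, up to the truncation at the edges. *)
Definition levy (e : R) (S T : set (R * R)) : Prop :=
  (forall p, S p -> T (shift e p)) /\ (forall p, T p -> S (shift e p)).

Lemma levy_sym e S T : levy e S T -> levy e T S.
Proof. by move=> [h1 h2]; split. Qed.

Lemma levy_refl e S : C S -> 0 <= e -> levy e S S.
Proof. by move=> hS e0; split=> p; exact: increasing_closed_shift. Qed.

Lemma levy_le a b S T : C S -> C T -> 0 <= a -> a <= b ->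
  levy a S T -> levy b S T.
Proof.
move=> hS hT a0 ab [h1 h2]; split=> p hp.
  by apply: increasing_closed_shift_le (h1 _ hp) => //; exact: increasing_closed_unit_square hp.
by apply: increasing_closed_shift_le (h2 _ hp) => //; exact: increasing_closed_unit_square hp.
Qed.

Lemma levy_trans a b S T U : 0 <= a -> 0 <= b ->
  levy a S T -> levy b T U -> levy (a + b) S U.
Proof.
move=> a0 b0 [h1 h2] [h3 h4]; split=> p hp.
  by rewrite -shiftD //; apply: h3; exact: h1.
by rewrite addrC -shiftD //; apply: h2; exact: h4.
Qed.

Lemma levy_eq S T : C S -> C T -> (forall e, 0 < e -> levy e S T) -> S = T.
Proof.
move=> hS hT h; apply/seteqP; split=> p hp.
  apply: increasing_closed_limit => //; first exact: increasing_closed_unit_square hp.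
  by move=> e /h[+ _]; apply.
apply: increasing_closed_limit => //; first exact: increasing_closed_unit_square hp.
by move=> e /h[_]; apply.
Qed.

Lemma indic_set01 S p : (\1_S p : R) = 0 \/ (\1_S p : R) = 1.
Proof. by rewrite indicE; case: (p \in S); [right|left]. Qed.

Lemma indic_mem S p : S p -> \1_S p = 1 :> R.
Proof. by move=> h; rewrite indicE mem_set. Qed.

Lemma indic_notmem S p : ~ S p -> \1_S p = 0 :> R.
Proof. by move=> h; rewrite indicE memNset. Qed.

Lemma indic1P S p : \1_S p = 1 :> R <-> S p.
Proof.
split; last exact: indic_mem.
rewrite indicE; case: (boolP (p \in S)) => [/set_mem //|_] /= /esym /eqP.
by rewrite oner_eq0.
Qed.

Lemma increasing01_indic S : C S -> increasing01 (\1_S : R * R -> R).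
Proof.
move=> hS; split=> [p _|p q hp hq pq1 pq2]; first exact: indic_set01.
have [Sp|nSp] := pselect (S p).
  by rewrite !indic_mem //; exact: increasing_closed_le Sp _ _ _.
by rewrite indic_notmem // indicE.
Qed.

Lemma shift_lt1 e x y : x + e < 1 -> y + e < 1 -> shift e (x, y) = (x + e, y + e).
Proof. by move=> ? ?; rewrite /shift /= !min_l // ltW. Qed.

Lemma levy_graphon_density (F : bigraph) S T e : C S -> C T -> 0 <= e ->
  levy e S T ->
  `|graphon_density F \1_S - graphon_density F \1_T| <= (v1 F + v2 F)%:R * e.
Proof.
move=> hS hT e0 hST.
suff h S' T' : C S' -> C T' -> levy e S' T' ->
    graphon_density F \1_S' <= graphon_density F \1_T' + (v1 F + v2 F)%:R * e.
  have h1 := h _ _ hS hT hST; have h2 := h _ _ hT hS (levy_sym hST).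
  by rewrite ler_norml; apply/andP; split; lra.
move=> hS' hT' [h1 _]; apply: graphon_density_shift => //; [exact: increasing01_indic..|].
move=> x y x0 x1 y0 y1.
have [Sp|nSp] := pselect (S' (x, y)); last by rewrite indic_notmem // indicE.
by rewrite !indic_mem // -shift_lt1 //; exact: h1.
Qed.

(** The member of [C] that represents the class of [W]; it differs from the set where [W] is 1 only
    on its own boundary. The edges are listed separately because [shift] maps each of them to itself
    and [W] may vanish there. *)
Definition hull W : set (R * R) :=
  [set p | unit_square p /\
    (p.1 = 1 \/ p.2 = 1 \/ forall e, 0 < e -> W (shift e p) = 1)].

Lemma increasing01_eq1 W p q : increasing01 W -> unit_square p -> unit_square q ->
  p.1 <= q.1 -> p.2 <= q.2 -> W p = 1 -> W q = 1.
Proof.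
move=> [W01 Wnd] hp hq h1 h2 Wp; have := Wnd _ _ hp hq h1 h2.
by rewrite Wp; case: (W01 _ hq) => -> //; rewrite ler10.
Qed.

Lemma hull_sub W p : increasing01 W -> unit_square p -> W p = 1 -> hull W p.
Proof.
move=> iW hp Wp; split=> //; right; right => e e0.
have [h1 h2] := ge_shift (ltW e0) hp.
by apply: increasing01_eq1 Wp => //; apply: unit_square_shift => //; exact: ltW.
Qed.

Lemma hull_shift W e p : increasing01 W -> hull W p -> 0 < e ->
  p.1 < 1 -> p.2 < 1 -> W (shift e p) = 1.
Proof. by move=> iW [_ [->|[->|h]]] e0; rewrite ?ltxx // => _ _; exact: h. Qed.

Lemma hull_increasing_closed W : increasing01 W -> C (hull W).
Proof.
move=> iW; apply: increasing_closed_intro.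
- by move=> p [].
- move=> p q [hp hpW] hq pq1 pq2; split=> //.
  have /unit_squareP[_ q1 _ q2] := hq.
  case: hpW => [p1|[p1|hpW]].
  + by left; apply/eqP; rewrite eq_le q1 -p1 pq1.
  + by right; left; apply/eqP; rewrite eq_le q2 -p1 pq2.
  right; right => e e0.
  apply: (increasing01_eq1 iW _ _ _ _ (hpW e e0)).
  + by apply: unit_square_shift => //; exact: ltW.
  + by apply: unit_square_shift => //; exact: ltW.
  + by rewrite /= !le_min !ge_min lexx !orbT andbT lerD2r pq1.
  + by rewrite /= !le_min !ge_min lexx !orbT andbT lerD2r pq2.
- by move=> p hp [h|h]; split=> //; [left|right; left].
- move=> p hp h; split=> //.
  have /unit_squareP[p0 p1 q0 q1] := hp.
  have [pe1|pn1] := eqVneq p.1 1; first by left.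
  have [pe2|pn2] := eqVneq p.2 1; first by right; left.
  right; right => e e0.
  have lt1 : p.1 < 1 by rewrite lt_neqAle pn1.
  have lt2 : p.2 < 1 by rewrite lt_neqAle pn2.
  (* Membership of [shift d p] in the hull says something about [W] only off the edges, whence the
     two distances to them. The half leaves room for a second shift by [d] within [e]. *)
  pose d := Num.min e (Num.min (1 - p.1) (1 - p.2)) / 2.
  have m0 : 0 < Num.min e (Num.min (1 - p.1) (1 - p.2)).
    by rewrite !lt_min e0 !subr_gt0 lt1 lt2.
  have d0 : 0 < d by rewrite /d divr_gt0.
  have m1 : Num.min e (Num.min (1 - p.1) (1 - p.2)) <= e by rewrite ge_min lexx.
  have m2 : Num.min e (Num.min (1 - p.1) (1 - p.2)) <= 1 - p.1 by rewrite !ge_min lexx !orbT.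
  have m3 : Num.min e (Num.min (1 - p.1) (1 - p.2)) <= 1 - p.2 by rewrite !ge_min lexx !orbT.
  have hd : hull W (shift d p) by exact: h.
  have := hull_shift iW hd d0; rewrite shiftD ?(ltW d0) // => hW.
  have de : d + d <= e by rewrite /d; lra.
  have [l1 l2] := shift_le p de.
  apply: (increasing01_eq1 iW _ _ l1 l2).
  + by apply: unit_square_shift => //; lra.
  + by apply: unit_square_shift => //; lra.
  + by apply: hW; rewrite /= gt_min; apply/orP; left; rewrite /d; lra.
Qed.

(** [W] is below the indicator of its hull in the open square, and that indicator is below every
    positive translate of [W]. The cost of the translation tends to 0, so no measurability of [W]
    enters. *)
Lemma graphon_density_hull (F : bigraph) W : increasing01 W ->
  graphon_density F W = graphon_density F \1_(hull W).
Proof.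
move=> iW; have hC := hull_increasing_closed iW.
apply/eqP; rewrite eq_le; apply/andP; split.
  have := @graphon_density_shift _ F W \1_(hull W) 0 iW (increasing01_indic hC) (lexx 0).
  rewrite mulr0 addr0; apply=> x y x0 x1 y0 y1; rewrite !addr0 in x1 y1 *.
  have hp : unit_square (x, y) by apply/unit_squareP; split=> /=; lra.
  have [W0|W1] := iW.1 _ hp; first by rewrite W0 indicE.
  by rewrite W1 indic_mem //; exact: hull_sub.
apply/ler_addgt0Pr => e e0.
have n0 : 0 < (v1 F + v2 F)%:R :> R by rewrite ltr0n addn_gt0 v1_gt0.
have e'0 : 0 < e / (v1 F + v2 F)%:R by rewrite divr_gt0.
have := @graphon_density_shift _ F \1_(hull W) W _ (increasing01_indic hC) iW (ltW e'0).
rewrite mulrCA divff ?gt_eqF // mulr1; apply=> x y x0 x1 y0 y1.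
have hp : unit_square (x, y) by apply/unit_squareP; split=> /=; lra.
have hp' : unit_square (x + e / (v1 F + v2 F)%:R, y + e / (v1 F + v2 F)%:R).
  by apply/unit_squareP; split=> /=; lra.
have [Sp|nSp] := pselect (hull W (x, y)); last first.
  by rewrite indic_notmem //; have /andP[] := increasing01_ge0le1 iW hp'.
have WE := hull_shift iW Sp e'0; rewrite shift_lt1 //= in WE.
by rewrite indic_mem // WE //; lra.
Qed.

Lemma hull_indic S : C S -> hull \1_S = S.
Proof.
move=> hS; apply/seteqP; split=> p.
  move=> [hp [h|[h|h]]]; [by apply: increasing_closed_edge => //; left
    |by apply: increasing_closed_edge => //; right|].
  by apply: increasing_closed_limit => // e e0; apply/indic1P; exact: h.
move=> Sp; split; first exact: increasing_closed_unit_square Sp.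
by right; right => e e0; apply: indic_mem; apply: increasing_closed_shift => //; exact: ltW.
Qed.

Lemma increasing_closedU S T : C S -> C T -> C (S `|` T).
Proof.
move=> [S1 S2 S3 S4] [T1 T2 T3 T4]; split.
- by move=> p [/S1|/T1].
- exact: closedU.
- by move=> p q [h|h] hq pq1 pq2; [left; exact: S3 h _ _ _|right; exact: T3 h _ _ _].
- by move=> p /S4 h; left.
Qed.

Lemma increasing_closedI S T : C S -> C T -> C (S `&` T).
Proof.
move=> [S1 S2 S3 S4] [T1 T2 T3 T4]; split.
- by move=> p [/S1].
- exact: closedI.
- by move=> p q [h h'] hq pq1 pq2; split; [exact: S3 h _ _ _|exact: T3 h' _ _ _].
- by move=> p h; split; [exact: S4|exact: T4].
Qed.

(** This replaces two close sets by two close nested ones, whose symmetric difference has for area a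
    difference of areas. *)
Lemma levyUI e S T : C S -> C T -> 0 <= e -> levy e S T ->
  levy e (S `|` T) (S `&` T).
Proof.
move=> hS hT e0 [h1 h2]; split=> p.
  move=> [h|h]; split; [exact: increasing_closed_shift|exact: h1|exact: h2|
    exact: increasing_closed_shift].
by move=> [h _]; left; exact: increasing_closed_shift.
Qed.

End IncreasingClosedSets.

(** * Degrees and area *)

Section Area.
Variable R : realType.
Local Notation leb := (@lebesgue_measure R).
Local Notation I01 := (@unit_itv R).
Local Notation C := (increasing_closed_sets R).
Local Notation R2 := (measurableTypeR R * measurableTypeR R)%type.
Implicit Types (S T A : set (R * R)) (p q : R * R) (W : R * R -> R).

(** An open set is the countable union of the rational boxes that it contains, and boxes belong to
    the product sigma-algebra. *)
Lemma open_measurable_plane (U : set (R * R)) : open U -> measurable (U : set R2).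
Proof.
move=> oU.
pose B (r : (rat * rat) * (rat * rat)) : set (R * R) :=
  `]ratr r.1.1, ratr r.1.2[%classic `*` `]ratr r.2.1, ratr r.2.2[%classic.
pose G r : set R2 := if `[< B r `<=` U >] then B r else set0.
have -> : U = \bigcup_r G r.
  apply/seteqP; split=> [[x y] Uxy|p [r _]]; last first.
    by rewrite /G; case: asboolP => // h /h.
  have /nbhs_ballP[e /= e0 eU] : nbhs (x, y) U by exact: open_nbhs_nbhs.
  have [a] : exists a : rat, ratr a \in `]x - e, x[%R by apply: rat_in_itvoo; lra.
  rewrite in_itv /= => /andP[a1 a2].
  have [b] : exists a : rat, ratr a \in `]x, x + e[%R by apply: rat_in_itvoo; lra.
  rewrite in_itv /= => /andP[b1 b2].
  have [c] : exists a : rat, ratr a \in `]y - e, y[%R by apply: rat_in_itvoo; lra.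
  rewrite in_itv /= => /andP[c1 c2].
  have [d] : exists a : rat, ratr a \in `]y, y + e[%R by apply: rat_in_itvoo; lra.
  rewrite in_itv /= => /andP[d1 d2].
  exists ((a, b), (c, d)) => //; rewrite /G asboolT; last first.
    move=> [u v] [/=]; rewrite !in_itv /= => /andP[? ?] /andP[? ?]; apply: eU.
    by split; rewrite /ball /= ltr_norml; apply/andP; split; lra.
  by split; rewrite /= in_itv /=; apply/andP.
apply: countable_bigcupT_measurable; first exact: countableP.
move=> r; rewrite /G; case: asboolP => // _.
by apply: measurableX; exact: measurable_itv.
Qed.

Lemma closed_measurable_plane (U : set (R * R)) : closed U -> measurable (U : set R2).
Proof.
move=> cU; rewrite -[U]setCK; apply: measurableC; apply: open_measurable_plane.
exact: closed_openC.
Qed.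

Lemma measurable_unit_square : measurable (@unit_square R : set R2).
Proof. by apply: closed_measurable_plane; exact: closed_unit_square. Qed.

Lemma increasing_closed_measurable S : C S -> measurable (S : set R2).
Proof. by move=> [_ cS _ _]; exact: closed_measurable_plane. Qed.

(** The degree function of the graphon [\1_A]; its law for uniform [x] in the unit interval is the
    degree distribution. *)
Definition degree A (x : R) : R := fine (leb (xsection A x)).

Lemma leb_unit_sub (B : set (measurableTypeR R)) : measurable B -> B `<=` I01 ->
  (leb B <= 1)%E.
Proof.
move=> mB BI; rewrite -leb_unit_itv; apply: le_measure => //; rewrite inE //.
exact: measurable_unit_itv.
Qed.

Lemma xsection_unit A x : A `<=` (@unit_square R) -> xsection A x `<=` I01.
Proof. by move=> h y; rewrite /xsection /= => /set_mem /h []. Qed.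

Lemma leb_xsection A x : measurable (A : set R2) -> A `<=` (@unit_square R) ->
  leb (xsection A x) = (degree A x)%:E.
Proof.
move=> mA hA; rewrite /degree fineK // ge0_fin_numE //.
apply: le_lt_trans (ltry 1).
by apply: leb_unit_sub; [exact: measurable_xsection|exact: xsection_unit].
Qed.

Lemma degree_ge0le1 A x : measurable (A : set R2) -> A `<=` (@unit_square R) ->
  0 <= degree A x <= 1.
Proof.
move=> mA hA; rewrite -!lee_fin -leb_xsection //; apply/andP; split=> //.
by apply: leb_unit_sub; [exact: measurable_xsection|exact: xsection_unit].
Qed.

Lemma measurable_degree A : measurable (A : set R2) ->
  measurable_fun setT (degree A : measurableTypeR R -> measurableTypeR R).
Proof.
move=> mA; apply: (@measurableT_comp _ _ _ _ _ _ (fine : \bar R -> measurableTypeR R)) => //.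
exact: (measurable_fun_xsection leb mA).
Qed.

Lemma area_degree A : measurable (A : set R2) -> A `<=` (@unit_square R) ->
  leb2 A = (\int[leb]_(x in I01) degree A x)%:E.
Proof.
move=> mA hA; rewrite /leb2 /= /product_measure1 /Rintegral fineK; last first.
  apply: integrable_fin_num; first exact: measurable_unit_itv.
  apply: (@bounded_integrable01 _ _ 1).
    by apply: measurable_funTS; exact: measurable_degree.
  by move=> x _; have /andP[? ?] := degree_ge0le1 x mA hA; rewrite ger0_norm.
rewrite [RHS]integral_mkcond; apply: eq_integral => x _ /=.
rewrite patchE; case: ifPn => [_|/negP xI]; first exact: leb_xsection.
rewrite (_ : xsection A x = set0) ?measure0 //; apply/seteqP; split=> // y.
by rewrite /xsection /= => /set_mem /hA [/mem_set].
Qed.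

Lemma indic_xsection A x :
  (fun y => \1_A (x, y)) = \1_(xsection A x) :> (R -> R).
Proof.
apply/funext => y; rewrite !indicE; congr (nat_of_bool _)%:R.
by apply/idP/idP => [h|/set_mem //]; rewrite inE.
Qed.

Lemma Rintegral_section A x : measurable (A : set R2) -> A `<=` (@unit_square R) ->
  \int[leb]_(y in I01) \1_A (x, y) = degree A x.
Proof.
move=> mA hA.
rewrite indic_xsection.
rewrite /Rintegral integral_indic; [|exact: measurable_unit_itv|exact: measurable_xsection].
by congr (fine (leb _)); apply/setIidl; exact: xsection_unit.
Qed.

(** The constant [c] collects the factors of the outer coordinates, which are fixed when the inner
    integrals are computed. *)
Lemma cube_integral_prod n (g : R -> R) c : leb.-integrable I01 (EFin \o g) ->
  cube_integral (fun t : n.-tuple R => c * \prod_(i < n) g (tnth t i)) =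
  c * (\int[leb]_(x in I01) g x) ^+ n.
Proof.
move=> ig; elim: n c => [|n IH] c /=; first by rewrite big_ord0.
transitivity (\int[leb]_(x in I01) (c * (\int[leb]_(x in I01) g x) ^+ n * g x)).
  apply: eq_Rintegral => x _; rewrite [RHS]mulrAC -IH; congr cube_integral.
  apply/funext => t; rewrite big_ord_recl tnth0 mulrA; congr (_ * _).
  by apply: eq_bigr => i _; rewrite tnthS.
rewrite RintegralZl //; last exact: measurable_unit_itv.
by rewrite exprSr mulrA.
Qed.

(** Once the centre [x] is fixed, the leaves contribute independent factors [degree A x], and
    [star k] has [k + 1] leaves. *)
Lemma graphon_density_star k A : measurable (A : set R2) -> A `<=` (@unit_square R) ->
  graphon_density (star k) \1_A = \int[leb]_(x in I01) (degree A x) ^+ k.+1.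
Proof.
move=> mA hA; rewrite /graphon_density /=; apply: eq_Rintegral => x _.
rewrite -(Rintegral_section _ mA hA) -[RHS]mul1r -cube_integral_prod; last first.
  apply: (@bounded_integrable01 _ _ 1).
    rewrite indic_xsection.
    by apply: measurable_indic; exact: measurable_xsection.
  by move=> y _; case: (indic_set01 A (x, y)) => ->; rewrite ?normr0 ?normr1 ?ler01.
rewrite [LHS](_ : _ = cube_integral (fun t : k.+1.-tuple R =>
  \prod_(e in [set: 'I_1 * 'I_k.+1]%SET) \1_A (tnth [tuple x] e.1, tnth t e.2))) //.
congr cube_integral; apply/funext => t; rewrite mul1r.
transitivity (\prod_(e : 'I_1 * 'I_k.+1) \1_A (x, tnth t e.2) : R).
  apply: eq_big => [e|[i j] _]; first by rewrite inE.
  by rewrite /= (ord1 i) tnth0.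
by rewrite -(pair_bigA _ (fun i j => \1_A (x, tnth t j) : R)) /= big_ord1.
Qed.

(** [star 0] is a single edge. Every estimate on densities thus becomes an estimate on areas. *)
Lemma area_star A : measurable (A : set R2) -> A `<=` (@unit_square R) ->
  leb2 A = (graphon_density (star 0) \1_A)%:E.
Proof.
by move=> mA hA; rewrite area_degree // graphon_density_star.
Qed.

Definition upper_edges : set (R * R) :=
  [set p | unit_square p /\ (p.1 = 1 \/ p.2 = 1)].

Lemma upper_edgesE : upper_edges = (I01 `*` [set 1]) `|` ([set 1] `*` I01).
Proof.
apply/seteqP; split=> [[x y] [[h1 h2]] [|] /= E|[x y] [|] [/= h1 h2]].
- by right; split.
- by left; split.
- split=> /=; last by right.
  by split=> //=; rewrite h2; apply/unit_itvP; rewrite ler01 lexx.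
- split=> /=; last by left.
  by split=> //=; rewrite h1; apply/unit_itvP; rewrite ler01 lexx.
Qed.

Lemma measurable_upper_edges : measurable (upper_edges : set R2).
Proof.
rewrite upper_edgesE; apply: measurableU; apply: measurableX => //;
  exact: measurable_unit_itv.
Qed.

Lemma area_upper_edges : leb2 upper_edges = 0%E.
Proof.
apply/eqP; rewrite eq_le measure_ge0 andbT upper_edgesE.
apply: le_trans (measureU2 _ _ _) _.
- by apply: measurableX => //; exact: measurable_unit_itv.
- by apply: measurableX => //; exact: measurable_unit_itv.
rewrite [X in (X + _ <= _)%E]product_measure1E //; last exact: measurable_unit_itv.
rewrite [X in (_ + X <= _)%E]product_measure1E //; last exact: measurable_unit_itv.
by rewrite [X in (_ * X + X * _ <= _)%E]lebesgue_measure_set1 mule0 mul0e adde0.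
Qed.

(** All points of the square above a point of [S] belong to [S]. Those strictly above it and
    strictly below 1 in both coordinates have a neighbourhood of such points. *)
Lemma interior_increasing_closedP S p : C S ->
  S° p <-> [/\ p.1 < 1, p.2 < 1 & exists2 e, 0 < e & S (p.1 - e, p.2 - e)].
Proof.
move=> hS; case: p => x y /=; split.
  move=> /nbhs_ballP[e /= e0 eS].
  have h1 : S (x + e / 2, y + e / 2).
    by apply: eS; split; rewrite /ball /= ltr_norml; apply/andP; split; lra.
  have /unit_squareP[/= _ ? _ ?] := increasing_closed_unit_square hS h1.
  split; [lra|lra|exists (e / 2); first lra].
  by apply: eS; split; rewrite /ball /= ltr_norml; apply/andP; split; lra.
move=> [x1 y1 [e e0 Se]].
have /unit_squareP[/= x0 _ y0 _] := increasing_closed_unit_square hS Se.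
apply/nbhs_ballP; exists (Num.min e (Num.min (1 - x) (1 - y))).
  by rewrite /= !lt_min e0 !subr_gt0 x1.
set r := Num.min e _.
have re : r <= e by rewrite ge_min lexx.
have rx : r <= 1 - x by rewrite /r !ge_min lexx !orbT.
have ry : r <= 1 - y by rewrite /r !ge_min lexx !orbT.
move=> [u v] []; rewrite /ball /= !ltr_norml => /andP[? ?] /andP[? ?].
by apply: increasing_closed_le Se _ _ _ => //=; [apply/unit_squareP; split=> /=|..]; lra.
Qed.

Lemma open_increasing_down (O : set (R * R)) p : open O -> O p ->
  exists2 e, 0 < e & O (p.1 - e, p.2 - e).
Proof.
case: p => x y oO Op.
have /nbhs_ballP[e /= e0 eO] : nbhs (x, y) O by exact: open_nbhs_nbhs.
exists (e / 2); first by rewrite divr_gt0.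
by apply: eO; split; rewrite /ball /= ltr_norml; apply/andP; split; lra.
Qed.

Lemma open_squareP p :
  @open_square R p <-> [/\ 0 < p.1, p.1 < 1, 0 < p.2 & p.2 < 1].
Proof.
split; first by move=> []; rewrite /= !in_itv /= => /andP[? ?] /andP[? ?].
by move=> [? ? ? ?]; split; rewrite /= in_itv /=; apply/andP.
Qed.

Lemma open_square_unit p : @open_square R p -> unit_square p.
Proof. by move=> /open_squareP[? ? ? ?]; apply/unit_squareP; split; lra. Qed.

Lemma interior_increasing_open S : C S -> increasing_open_sets R S°.
Proof.
move=> hS; split.
- move=> p /(interior_increasing_closedP p hS)[p1 p2 [e e0 Se]].
  have /unit_squareP[/= x0 _ y0 _] := increasing_closed_unit_square hS Se.
  by apply/open_squareP; split; lra.
- exact: open_interior.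
- move=> p q /(interior_increasing_closedP p hS)[p1 p2 [e e0 Se]] /open_squareP[? ? ? ?] ? ?.
  apply/(interior_increasing_closedP q hS); split=> //; exists e => //.
  have /unit_squareP[/= x0 _ y0 _] := increasing_closed_unit_square hS Se.
  by apply: increasing_closed_le Se _ _ _ => //=; [apply/unit_squareP; split=> /=|..]; lra.
Qed.

Section Closure.
Variable O : set (R * R).
Hypothesis hO : increasing_open_sets R O.

(** [O] is increasing only within the open square: going up from it one may reach an edge, so the
    edges have to be added. *)
Lemma increasing01_open_edges : increasing01 (\1_(O `|` upper_edges) : R * R -> R).
Proof.
case: hO => Osq oO iO; split=> [p _|p q hp hq pq1 pq2]; first exact: indic_set01.
have [h|h] := pselect ((O `|` upper_edges) p); last by rewrite indic_notmem // indicE.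
rewrite !indic_mem //.
have [h1|h1] := pselect (q.1 = 1); first by right; split=> //; left.
have [h2|h2] := pselect (q.2 = 1); first by right; split=> //; right.
have /unit_squareP[? ? ? ?] := hq.
have q1 : q.1 < 1 by rewrite lt_neqAle; apply/andP; split=> //; exact/eqP.
have q2 : q.2 < 1 by rewrite lt_neqAle; apply/andP; split=> //; exact/eqP.
case: h => [Op|[_ [|]]]; [left|lra|lra].
have /open_squareP[? ? ? ?] := Osq _ Op.
by apply: iO Op _ _ _ => //; apply/open_squareP; split; lra.
Qed.

(** The inverse of the interior map. It is not the closure of [O]: for empty [O] it consists of the
    two edges. *)
Definition closed_hull : set (R * R) := hull (\1_(O `|` upper_edges)).

Lemma closed_hull_increasing_closed : C closed_hull.
Proof. exact/hull_increasing_closed/increasing01_open_edges. Qed.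

Lemma interior_closed_hull : closed_hull° = O.
Proof.
have hC := closed_hull_increasing_closed.
case: (hO) => Osq oO iO; apply/seteqP; split=> p.
  move=> /(interior_increasing_closedP p hC)[p1 p2 [e e0]].
  move=> he; have E : \1_(O `|` upper_edges) (shift e (p.1 - e, p.2 - e)) = 1 :> R.
    by apply: (hull_shift increasing01_open_edges he e0) => /=; lra.
  rewrite shift_lt1 !subrK // -surjective_pairing in E.
  by have [//|[_ [|]]] := (indic1P _ _).1 E; lra.
move=> Op; have /open_squareP[? ? ? ?] := Osq _ Op.
apply/(interior_increasing_closedP p hC); split=> //.
have [e e0 Oe] := open_increasing_down oO Op; exists e => //.
apply: hull_sub; first exact: increasing01_open_edges.
  exact/open_square_unit/Osq.
by apply: indic_mem; left.
Qed.

End Closure.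

Lemma closed_hull_interior S : C S -> closed_hull S° = S.
Proof.
move=> hS; have hO := interior_increasing_open hS.
have iO := increasing01_open_edges hO.
have sub : S° `|` upper_edges `<=` S.
  move=> p [/interior_subset //|[hp h]]; exact: increasing_closed_edge.
apply/seteqP; split=> p.
  move=> [hp [h|[h|h]]]; [by apply: increasing_closed_edge => //; left
    |by apply: increasing_closed_edge => //; right|].
  by apply: increasing_closed_limit => // e e0; apply: sub; apply/indic1P; exact: h.
move=> Sp; have hp := increasing_closed_unit_square hS Sp.
split=> //; right; right => e e0; apply: indic_mem.
have /unit_squareP[? ? ? ?] := hp.
have hs := unit_square_shift (ltW e0) hp.
have [x1|x1] := leP 1 (p.1 + e).
  by right; split=> //; left; rewrite /= min_r.
have [y1|y1] := leP 1 (p.2 + e).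
  by right; split=> //; right; rewrite /= min_r.
left; rewrite /shift !min_l ?ltW //.
by apply/interior_increasing_closedP => //; split=> //=; exists e => //; rewrite !addrK -surjective_pairing.
Qed.

(** The interior together with the edges has [S] as its hull, hence has the same density of a single
    edge, that is, the same area. The edges themselves are null. *)
Lemma area_boundary S : C S -> leb2 (S `\` S°) = 0%E.
Proof.
move=> hS; have hO := interior_increasing_open hS.
have iO := increasing01_open_edges hO.
have mS := increasing_closed_measurable hS.
have mO : measurable (S° : set R2) by apply: open_measurable_plane; exact: open_interior.
have mA : measurable (S° `|` upper_edges : set R2).
  by apply: measurableU => //; exact: measurable_upper_edges.
have sub : S° `|` upper_edges `<=` S.
  move=> p [/interior_subset //|[hp h]]; exact: increasing_closed_edge.
have Ssq : S `<=` (@unit_square R) by move=> p; exact: increasing_closed_unit_square.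
have E : leb2 (S° `|` upper_edges) = leb2 S.
  rewrite (area_star mA (subset_trans sub Ssq)) (area_star mS Ssq).
  rewrite (graphon_density_hull _ iO).
 rewrite -/(closed_hull S°).
 rewrite (closed_hull_interior hS).
  reflexivity.
apply/eqP; rewrite eq_le measure_ge0 andbT.
apply: (@le_trans _ _ (leb2 ((S `\` (S° `|` upper_edges)) `|` upper_edges))).
  apply: le_measure; rewrite ?inE.
  - exact: measurableD.
  - by apply: measurableU; [exact: measurableD|exact: measurable_upper_edges].
  move=> p [Sp nSp]; have [h|h] := pselect (upper_edges p); [by right|left].
  by split=> // -[].
apply: le_trans (measureU2 _ _ _) _; [exact: measurableD|exact: measurable_upper_edges|].
rewrite [X in (_ + X <= _)%E]area_upper_edges adde0 measureD; [|exact: mS|exact: mA|].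
  rewrite setIidr // [X in (_ - X <= _)%E]E.
  by rewrite [X in (X - X <= _)%E](area_star mS Ssq) subee.
by rewrite [ltLHS](area_star mS Ssq) ltry.
Qed.

End Area.

(** * Degree distributions *)

Section NormalizedMeasure.
Variables (R : realType) (m : {measure set (measurableTypeR R) -> \bar R}).
Hypothesis m1 : m setT = 1%E.

(** The value 0 off the sigma-algebra is the normalization required by [unit_probabilities];
    additivity only concerns measurable sets. *)
Definition zero_nonmeasurable (A : set (measurableTypeR R)) : \bar R :=
  if `[< measurable A >] then m A else 0%E.

Lemma zero_nonmeasurableE A : measurable A -> zero_nonmeasurable A = m A.
Proof. by move=> mA; rewrite /zero_nonmeasurable asboolT. Qed.

Let zero_nonmeasurable0 : zero_nonmeasurable set0 = 0%E.
Proof. by rewrite zero_nonmeasurableE // measure0. Qed.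

Let zero_nonmeasurable_ge0 A : (0 <= zero_nonmeasurable A)%E.
Proof. by rewrite /zero_nonmeasurable; case: ifP. Qed.

Let zero_nonmeasurable_sigma_additive : semi_sigma_additive zero_nonmeasurable.
Proof.
move=> F mF tF mUF; rewrite zero_nonmeasurableE //.
under eq_fun do under eq_bigr do rewrite zero_nonmeasurableE //.
exact: measure_semi_sigma_additive.
Qed.

HB.instance Definition _ := isMeasure.Build _ _ _ zero_nonmeasurable
  zero_nonmeasurable0 zero_nonmeasurable_ge0 zero_nonmeasurable_sigma_additive.

Let zero_nonmeasurableT : zero_nonmeasurable setT = 1%E.
Proof. by rewrite zero_nonmeasurableE. Qed.

HB.instance Definition _ := Measure_isProbability.Build _ _ _
  zero_nonmeasurable zero_nonmeasurableT.

Definition normalized_probability : probability (measurableTypeR R) R :=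
  zero_nonmeasurable.

Lemma normalized_probabilityE A :
  measurable A -> normalized_probability A = m A.
Proof. exact: zero_nonmeasurableE. Qed.

Lemma normalized_probability_unit : m (@unit_itv R) = 1%E ->
  unit_probabilities R normalized_probability.
Proof.
move=> mI; split; first by rewrite normalized_probabilityE //; exact: measurable_unit_itv.
by move=> A nA; rewrite /normalized_probability /= /zero_nonmeasurable asboolF.
Qed.

End NormalizedMeasure.

(** Apart from the function, the bundled structure contains only proofs, which proof irrelevance
    identifies. *)
Lemma eq_probability (R : realType) d (T : measurableType d)
  (P Q : probability T R) : (P : set T -> \bar R) = Q -> P = Q.
Proof.
case: P Q => [P [[a b] [c] [d1] [e] [f] [g] [h]]].
move=> [Q [[a' b'] [c'] [d1'] [e'] [f'] [g'] [h']]] /= E; subst Q.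
by rewrite (Prop_irrelevance a a') (Prop_irrelevance b b') (Prop_irrelevance c c')
  (Prop_irrelevance d1 d1') (Prop_irrelevance e e') (Prop_irrelevance f f')
  (Prop_irrelevance g g') (Prop_irrelevance h h').
Qed.

Lemma le_lebesgue (R : realType) (A B : set (measurableTypeR R)) :
  measurable A -> measurable B -> A `<=` B ->
  (@lebesgue_measure R A <= @lebesgue_measure R B)%E.
Proof. by move=> mA mB; apply: le_measure; rewrite inE. Qed.

(** * The correspondence between increasing closed sets and degree distributions *)

Section DegreeLaw.
Variable R : realType.
Local Notation leb := (@lebesgue_measure R).
Local Notation I01 := (@unit_itv R).
Local Notation C := (increasing_closed_sets R).
Implicit Types (S T : C) (mu nu : unit_probabilities R).

Lemma increasing_closed_setP S : increasing_closed_sets R (val S).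
Proof. exact: set_valP. Qed.
Local Hint Resolve increasing_closed_setP : core.

Lemma increasing_closed_set_measurable S :
  measurable (val S : set (measurableTypeR R * measurableTypeR R)%type).
Proof. exact: increasing_closed_measurable. Qed.
Local Hint Resolve increasing_closed_set_measurable : core.

Lemma increasing_closed_set_sub S : val S `<=` @unit_square R.
Proof. by move=> p; exact: increasing_closed_unit_square. Qed.
Local Hint Resolve increasing_closed_set_sub : core.

(** Outside the unit interval the degree is 0, so the image of Lebesgue measure on the line would
    have infinite mass at 0. Adding 2 there moves that mass beyond 1, where the restriction to the
    unit interval discards it. *)
Definition degree_ext S (x : R) : R := degree (val S) x + 2 * \1_(~` I01) x.

Lemma degree_extE S x : I01 x -> degree_ext S x = degree (val S) x.
Proof. by move=> Ix; rewrite /degree_ext indicE memNset ?mulr0 ?addr0 //= => /(_ Ix). Qed.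

Lemma degree_ext_unit S x : I01 (degree_ext S x) <-> I01 x.
Proof.
have /andP[d0 d1] := degree_ge0le1 x (increasing_closed_set_measurable S) (@increasing_closed_set_sub S).
split=> [|Ix]; last by rewrite degree_extE //; apply/unit_itvP/andP.
move=> h; apply: contrapT => nIx; move: h; rewrite /degree_ext indicE mem_set //.
by move=> /unit_itvP /=; lra.
Qed.

Lemma measurable_degree_ext S :
  measurable_fun setT (degree_ext S : measurableTypeR R -> measurableTypeR R).
Proof.
apply: measurable_funD; first exact: measurable_degree.
apply: measurable_funM => //; apply: measurable_indic; apply: measurableC.
exact: measurable_unit_itv.
Qed.

Definition degree_law_raw S : {measure set (measurableTypeR R) -> \bar R}.
Proof.
refine (mrestr
  (pushforward leb (degree_ext S : measurableTypeR R -> measurableTypeR R))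
  (@measurable_unit_itv R)).
exact: measurable_degree_ext.
Defined.

Lemma degree_law_rawE S A : degree_law_raw S A =
  leb (I01 `&` degree (val S) @^-1` (A `&` I01)).
Proof.
rewrite /degree_law_raw /= /mrestr /pushforward; congr (leb _).
apply/seteqP; split=> x /= [].
  by move=> h /degree_ext_unit Ix; rewrite degree_extE // in h; split=> //; split=> //;
    rewrite -degree_extE //; exact/degree_ext_unit.
by move=> Ix [h1 h2]; rewrite degree_extE.
Qed.

Lemma degree_law_raw_unit S : degree_law_raw S I01 = 1%E.
Proof.
rewrite degree_law_rawE setIid -[RHS](@leb_unit_itv R); congr (leb _).
apply/seteqP; split=> x /= [] // Ix; split=> //; apply/unit_itvP.
exact: (degree_ge0le1 x (increasing_closed_set_measurable S) (@increasing_closed_set_sub S)).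
Qed.

Lemma degree_law_raw_setT S : degree_law_raw S setT = 1%E.
Proof.
by rewrite -(degree_law_raw_unit S) !degree_law_rawE setTI setIid.
Qed.

Definition degree_law S : unit_probabilities R :=
  SigSub (mem_set (normalized_probability_unit (degree_law_raw_setT S)
    (degree_law_raw_unit S))).

Lemma degree_lawE S A : measurable (A : set (measurableTypeR R)) ->
  val (degree_law S) A = leb (I01 `&` degree (val S) @^-1` (A `&` I01)).
Proof.
move=> mA; rewrite -degree_law_rawE.
exact: (normalized_probabilityE (degree_law_raw_setT S)).
Qed.

Lemma Rintegral_degree_law S (f : R -> R) (M : R) :
  measurable_fun setT (f : measurableTypeR R -> measurableTypeR R) ->
  (forall s, I01 s -> `|f s| <= M) ->
  \int[val (degree_law S)]_(s in I01) f s =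
  \int[leb]_(x in I01) f (degree (val S) x).
Proof.
move=> mf fM; rewrite /Rintegral; congr fine.
pose phi : measurableTypeR R -> measurableTypeR R := degree_ext S.
transitivity (\int[pushforward leb phi]_(s in I01) (f s)%:E)%E.
  apply: eq_measure_integral; first exact: measurable_degree_ext.
  move=> mphi A mA AI; rewrite [LHS](degree_lawE S mA).
  rewrite /pushforward; congr (leb _); apply/seteqP; split=> x /=.
    by move=> [Ix [h _]]; rewrite /phi degree_extE.
  move=> h; have Ix : I01 x := (degree_ext_unit S x).1 (AI _ h).
  by rewrite /phi degree_extE // in h; do !split=> //; exact: AI.
have phiI : phi @^-1` I01 = I01.
  by apply/seteqP; split=> x /= h; apply/(degree_ext_unit S x).
rewrite integral_pushforward //=.
- rewrite phiI.
  by apply: eq_integral => x /set_mem Ix; rewrite /phi /= degree_extE.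
- exact: measurable_degree_ext.
- exact/measurable_EFinP.
- rewrite phiI.
  apply: (@bounded_integrable01 _ (f \o phi) M).
    apply: measurable_funTS; apply: measurableT_comp => //.
    exact: measurable_degree_ext.
  by move=> x Ix; apply: fM; exact/(degree_ext_unit S x).
- exact: measurable_unit_itv.
Qed.

Lemma probability_fin_num (mu : probability (measurableTypeR R) R) A :
  measurable A -> mu A = (fine (mu A))%:E.
Proof. by move=> mA; rewrite fineK // fin_num_measure. Qed.

Lemma S_increasing_closed mu : increasing_closed_sets R (S_ mu).
Proof.
set P := val mu.
have mI (b : R) : measurable (`[0, b[%classic : set (measurableTypeR R)).
  exact: measurable_itv.
have le_P (a b : R) : a <= b -> (P `[0%R, a[%classic <= P `[0%R, b[%classic)%E.
  move=> ab; apply: le_measure; rewrite ?inE; [exact: mI|exact: mI|].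
  by move=> x /=; rewrite !in_itv /= => /andP[-> /=]; move/lt_le_trans; apply.
apply: increasing_closed_intro.
- by move=> p [].
- move=> p q [hp h] hq pq1 pq2; split=> //.
  apply: (le_trans (le_P _ (1 - p.2) _)); first lra.
  by apply: le_trans h _; rewrite lee_fin.
- move=> p hp [] E; split=> //; rewrite E.
    by apply: probability_le1; exact: mI.
  rewrite subrr set_itvE measure0.
  by have /unit_squareP[? _ _ _] := hp; rewrite lee_fin.
- move=> p hp h; split=> //.
  have /unit_squareP[p10 p11 p20 p21] := hp.
  (* Closedness of [S_ mu] is the left continuity of the mass of [[0, s[] in [s], obtained by
     exhausting the interval from inside. *)
  pose F (n : nat) : set (measurableTypeR R) := `[0, 1 - p.2 - n.+1%:R^-1[%classic.
  have UF : `[0, 1 - p.2[%classic = \bigcup_n F n.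
    apply/seteqP; split=> x; rewrite /F /=; last first.
      move=> [n _ /=]; rewrite !in_itv /= => /andP[-> /=] /lt_trans; apply.
      by rewrite ltrBlDr ltrDl invr_gt0.
    rewrite in_itv /= => /andP[x0 x1].
    have d0 : 0 < 1 - p.2 - x by lra.
    have [n nd] := ltr_add_invr (y := 0) d0.
    by exists n => //=; rewrite in_itv /= x0 /= ltrBrDr -ltrBrDl -[ltLHS]add0r.
  have FE n : (P (F n) <= (p.1)%:E)%E.
    apply/lee_addgt0Pr => e e0.
    (* The bound by the inverse of [n + 1] makes the interval attached to [shift d p] contain [F n];
       the bound by [e] controls the first coordinate. *)
    pose d := Num.min e n.+1%:R^-1.
    have d0 : 0 < d by rewrite lt_min e0 invr_gt0 /=.
    have [_ hd] := h d d0.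
    have de : d <= e by rewrite ge_min lexx.
    have dn : d <= n.+1%:R^-1 by rewrite ge_min lexx orbT.
    apply: le_trans (le_trans hd _); last by rewrite -EFinD lee_fin /= ge_min lerD2l de.
    apply: le_P => /=.
    rewrite -addrA -opprD lerB //.
    by rewrite ge_min lerD2l dn.
  rewrite UF.
  have ndF : nondecreasing_seq F.
    move=> n k nk; apply/subsetPset => x; rewrite /F /= !in_itv /= => /andP[-> /=].
    move=> /lt_le_trans; apply; rewrite lerB // lef_pV2 ?posrE // ler_nat.
    by rewrite ltnS.
  have mF n : measurable (F n) by exact: mI.
  have cvgF := @nondecreasing_cvg_mu _ _ _ P F mF (bigcupT_measurable F mF) ndF.
  rewrite -(cvg_lim _ cvgF) //; apply: lime_le; first exact: cvgP cvgF.
  by apply: nearW => n; exact: FE.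
Qed.

Definition degree_set mu : C := SigSub (mem_set (S_increasing_closed mu)).

(** The section of [S] over [x] is a final segment of the unit interval, so containing [y] makes its
    length at least [1 - y]. If [y] is missed, closedness of [S] makes it miss a whole
    [shift e (x, y)], and the section then starts at [y + e] or later, whence the strict
    inequality. *)
Lemma degree_lt S x y : I01 x -> I01 y ->
  degree (val S) x < 1 - y <-> ~ val S (x, y).
Proof.
move=> Ix Iy; have hS := increasing_closed_setP S.
have /unit_itvP /andP[x0 x1] := Ix; have /unit_itvP /andP[y0 y1] := Iy.
have mx : measurable (xsection (val S) x : set (measurableTypeR R)).
  exact: (measurable_xsection x (increasing_closed_set_measurable S)).
split=> [|nS].
  move=> + Sxy; apply/negP; rewrite -leNgt -lee_fin -leb_xsection //.
  have <- : leb (`[y, 1]%classic : set R) = (1 - y)%:E.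
    rewrite lebesgue_measure_itv /= lte_fin; case: ltP => // ?.
    by rewrite (_ : y = 1) ?subrr //; lra.
  apply: le_lebesgue => //.
  move=> z; rewrite /= in_itv /= => /andP[yz z1]; rewrite /xsection /=; apply/mem_set.
  apply: (increasing_closed_le hS Sxy) => //=.
  by apply/unit_squareP; split=> //=; lra.
have nSS : ~ (forall e, 0 < e -> val S (shift e (x, y))).
  by move=> h; apply: nS; exact: increasing_closed_limit.
have [e e0 ne] : exists2 e, 0 < e & ~ val S (shift e (x, y)).
  by apply: contrapT => h; apply: nSS => e e0; apply: contrapT => ?; apply: h; exists e.
have ye1 : y + e < 1.
  rewrite ltNge; apply/negP => h; apply: ne; apply: increasing_closed_edge => //.
    by apply: unit_square_shift; [exact: ltW|].
  by right; rewrite /= min_r.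
rewrite -lte_fin -leb_xsection //.
apply: (@le_lt_trans _ _ (leb (`[y + e, 1]%classic : set R))).
  apply: le_lebesgue => //.
  move=> z; rewrite /xsection /= => /set_mem Sz; rewrite in_itv /=.
  have /unit_squareP[/= _ _ _ ?] := increasing_closed_set_sub Sz.
  apply/andP; split=> //; rewrite leNgt; apply/negP => zy; apply: ne.
  apply: (increasing_closed_le hS Sz) => /=.
  - by apply: unit_square_shift; [exact: ltW|].
  - by rewrite le_min x1 lerDl ltW.
  - by rewrite le_min ltW //; lra.
by rewrite lebesgue_measure_itv /= lte_fin ye1 -EFinB lte_fin; lra.
Qed.

(** At height [y] the points outside [S] form an initial segment of the unit interval. By
    [degree_lt] its length is the mass of [[0, 1 - y[], with which [S_] compares [x]; the end point
    falls on the right side because [S] is closed. *)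
Lemma degree_lawK : cancel degree_law degree_set.
Proof.
move=> S; apply/val_inj => /=; have hS := increasing_closed_setP S.
have law_lt (y : R) : I01 y -> val (degree_law S) `[0%R, (1 - y)%R[%classic =
    leb (I01 `&` [set x | ~ val S (x, y)]).
  move=> Iy; rewrite degree_lawE; last exact: measurable_itv.
  congr (leb _); apply/seteqP; split=> x /= [Ix].
    by rewrite in_itv /= => -[/andP[_ h] _]; split=> //; exact/degree_lt.
  move=> /degree_lt -/(_ Ix Iy) h; split=> //.
  have /andP[d0 d1] := degree_ge0le1 x (increasing_closed_set_measurable S) (@increasing_closed_set_sub S).
  by rewrite in_itv /= d0 h; split=> //; apply/unit_itvP/andP.
have mc y : measurable (I01 `&` [set x | ~ val S (x, y)] : set (measurableTypeR R)).
  apply: measurableI; first exact: measurable_unit_itv.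
  rewrite (_ : [set x | _] = ~` ysection (val S) y).
    by apply: measurableC; exact: (measurable_ysection y (increasing_closed_set_measurable S)).
  apply/seteqP; split=> x /=; rewrite /ysection /=; first by move=> h /set_mem.
  by move=> h ?; apply: h; exact/mem_set.
apply/seteqP; split=> [[x y] [hp]|[x y] Sxy].
  have [/= Ix Iy] := hp; have /unit_itvP /andP[x0 x1] := Ix.
  rewrite law_lt //= => h; apply: contrapT => nS.
  have nSS : ~ (forall e, 0 < e -> val S (shift e (x, y))).
    by move=> h'; apply: nS; exact: increasing_closed_limit.
  have [e e0 ne] : exists2 e, 0 < e & ~ val S (shift e (x, y)).
    by apply: contrapT => h'; apply: nSS => e e0; apply: contrapT => ?; apply: h'; exists e.
  have xe1 : x + e < 1.
    rewrite ltNge; apply/negP => h'; apply: ne; apply: increasing_closed_edge => //.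
      by apply: unit_square_shift; [exact: ltW|].
    by left; rewrite /= min_r.
  move: h; apply/negP; rewrite -ltNge.
  apply: (@lt_le_trans _ _ (leb (`[0, x + e]%classic : set R))).
    rewrite lebesgue_measure_itv /= lte_fin (_ : 0 < x + e); last lra.
    by rewrite -EFinB lte_fin; lra.
  apply: le_lebesgue => //; first exact: mc.
  move=> z; rewrite /= in_itv /= => /andP[z0 z1].
  have Iz : I01 z by apply/unit_itvP; lra.
  split=> // Sz; apply: ne; apply: (increasing_closed_le hS Sz) => /=.
  - by apply: unit_square_shift; [exact: ltW|].
  - by rewrite le_min z1; lra.
  - by have /unit_itvP /andP[_ ?] := Iy; rewrite le_min lerDl (ltW e0).
have hp := increasing_closed_set_sub Sxy; have [/= Ix Iy] := hp; have /unit_itvP /andP[x0 x1] := Ix.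
split=> //=; rewrite law_lt //.
have <- : leb (`[0, x]%classic : set R) = x%:E.
  rewrite lebesgue_measure_itv /= lte_fin; case: ltP => [_|?].
    by rewrite -EFinB subr0.
  by rewrite (_ : x = 0) //; lra.
apply: le_lebesgue => //.
move=> z [/unit_itvP /andP[z0 z1] nS]; rewrite /= in_itv /= z0 /= leNgt.
apply/negP => xz; apply: nS; apply: (increasing_closed_le hS Sxy) => //=; last exact: ltW.
by apply: unit_square_pair => //; apply/unit_itvP; rewrite z0.
Qed.

Lemma unit_probability_setI mu (A : set (measurableTypeR R)) : measurable A ->
  val mu A = val mu (A `&` I01).
Proof.
move=> mA; have [muI _] := set_valP mu.
have mI := @measurable_unit_itv R.
have muC : val mu (~` I01) = 0%E.
  by rewrite probability_setC // muI subee.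
rewrite -[in LHS](setUIDK A I01) measureU.
- rewrite [X in (_ + X)%E](_ : _ = 0%E) ?adde0 //.
  apply/eqP; rewrite eq_le measure_ge0 andbT -muC.
  by apply: le_measure; rewrite ?inE; [exact: measurableD|exact: measurableC|move=> x []].
- exact: measurableI.
- exact: measurableD.
- by apply/seteqP; split=> x // [[_ ?] [_ ?]].
Qed.

(** The mass of [[0, s[] is the least [x] for which [(x, 1 - s)] lies in [S_ mu]. These masses give
    those of all half-lines []-oo, s[], a generating family closed under intersection. *)
Lemma degree_set_inj : injective degree_set.
Proof.
move=> mu nu E; apply/val_inj.
have [mu1 muN] := set_valP mu; have [nu1 nuN] := set_valP nu.
have eqS s : I01 s -> val mu `[0%R, s[%classic = val nu `[0%R, s[%classic.
  move=> Is; have /unit_itvP /andP[s0 s1] := Is.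
  have mI : measurable (`[0, s[%classic : set (measurableTypeR R)).
    exact: measurable_itv.
  suff le m n : degree_set m = degree_set n ->
      (val m `[0%R, s[%classic <= val n `[0%R, s[%classic)%E.
    by apply/eqP; rewrite eq_le !le.
  move=> Emn; pose x := fine (val n `[0%R, s[%classic).
  have xE : val n `[0%R, s[%classic = x%:E by rewrite probability_fin_num.
  have Ix : I01 x.
    by apply/unit_itvP; rewrite -!lee_fin -xE measure_ge0 probability_le1.
  have : val (degree_set n) (x, 1 - s).
    split; first by split=> //=; apply/unit_itvP; lra.
    by rewrite /= subKr xE.
  by rewrite -Emn => -[_] /=; rewrite subKr xE.
suff eqM A : measurable A -> val mu A = val nu A.
  have EE : (val mu : set _ -> \bar R) = val nu.
    apply/funext => A; have [mA|nA] := pselect (measurable A); first exact: eqM.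
    by rewrite muN // nuN.
  exact: eq_probability.
have mR (x : R) : measurable (`]-oo, x[%classic : set (measurableTypeR R)).
  exact: measurable_itv.
move=> mA.
refine (@measure_unique _ R (measurableTypeR R) (@RGenInftyO.G R)
  (fun n : nat => `]-oo, n%:R[%classic) _ _ _ _ (val mu) (val nu) _ _ A mA).
- exact: RGenInftyO.measurableE.
- move=> _ _ [x ->] [y ->]; exists (Num.min x y); apply/seteqP.
  by split=> z /=; rewrite !in_itv /= lt_min; [move=> [-> ->]|move=> /andP[-> ->]].
- by move=> n; exists n%:R.
- apply/seteqP; split=> // x _.
  by exists (Num.truncn `|x|).+1 => //=; rewrite in_itv /= (le_lt_trans (ler_norm x)) // truncnS_gt.
- move=> _ [x ->]; rewrite [LHS](unit_probability_setI mu (mR x)) [RHS](unit_probability_setI nu (mR x)).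
  have [x1|x1] := leP x 1; last first.
    rewrite (_ : _ `&` I01 = I01) ?mu1 ?nu1 //; apply/setIidr => z /unit_itvP /andP[_ z1].
    by rewrite /= in_itv /= (le_lt_trans z1).
  have [x0|x0] := leP x 0.
    rewrite (_ : _ `&` I01 = set0) ?measure0 //; apply/seteqP; split=> // z [].
    by rewrite /= in_itv /= => zx /unit_itvP /andP[z0 _];
      have := le_lt_trans z0 (lt_le_trans zx x0); rewrite ltxx.
  rewrite (_ : _ `&` I01 = `[0, x[%classic); first by apply: eqS; apply/unit_itvP; rewrite (ltW x0).
  apply/seteqP; split=> z.
    by move=> []; rewrite /= !in_itv /= => -> /unit_itvP /andP[-> _].
  rewrite /= !in_itv /= => /andP[z0 zx]; split=> //.
  by apply/unit_itvP; rewrite z0 /= (le_trans (ltW zx)).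
- by move=> n; rewrite (le_lt_trans (probability_le1 _ _)) ?ltry //; exact: mR.
Qed.

Lemma degree_setK : cancel degree_set degree_law.
Proof. by move=> mu; apply: degree_set_inj; rewrite degree_lawK. Qed.

End DegreeLaw.

(** * Moments and weak convergence *)

Section Bernstein.
Variable R : realType.
Local Notation I01 := (@unit_itv R).

(* $\sum_k \binom nk x^k (1-x)^{n-k} g(k)$, by conditioning on the first of $n$
   Bernoulli trials of parameter $x$. *)
Fixpoint bernstein (n : nat) (g : nat -> R) : {poly R} :=
  match n with
  | 0 => (g 0)%:P
  | n'.+1 => 'X * bernstein n' (fun k => g k.+1) + (1 - 'X) * bernstein n' g
  end.

Lemma bernsteinS n g x : (bernstein n.+1 g).[x] =
  x * (bernstein n (fun k => g k.+1)).[x] + (1 - x) * (bernstein n g).[x].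
Proof. by rewrite /= !hornerE. Qed.

Lemma le_bernstein n g h x : I01 x -> (forall k, (k <= n)%N -> g k <= h k) ->
  (bernstein n g).[x] <= (bernstein n h).[x].
Proof.
move=> /unit_itvP /andP[x0 x1]; elim: n g h => [|n IH] g h gh.
  by rewrite /= !hornerC; exact: gh.
rewrite !bernsteinS; apply: lerD; apply: ler_wpM2l; try lra.
  by apply: IH => k kn; exact: gh.
by apply: IH => k kn; apply: gh; exact: leqW.
Qed.

Lemma bernstein_affine n g a b x :
  (bernstein n (fun k => a + b * g k)).[x] = a + b * (bernstein n g).[x].
Proof.
elim: n g => [|n IH] g; first by rewrite /= !hornerC.
by rewrite !bernsteinS !IH; ring.
Qed.

(** Square of the mean plus variance of a binomial variable translated by [a]. The translation is
    there for the induction, in which conditioning on a success replaces [a] by [1 + a]. *)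
Lemma bernstein_square n a x :
  (bernstein n (fun k => (k%:R + a) ^+ 2)).[x] =
  (n%:R * x + a) ^+ 2 + n%:R * x * (1 - x).
Proof.
elim: n a => [|n IH] a; first by rewrite /= !hornerC; ring.
rewrite !bernsteinS IH.
rewrite (_ : (fun k => (k.+1%:R + a) ^+ 2) = (fun k => (k%:R + (1 + a)) ^+ 2)); last first.
  by apply/funext => k; rewrite -natr1 addrA.
by rewrite IH -[n.+1%:R]natr1; ring.
Qed.

Lemma unit_itv_continuous_near (f : R -> R) : {within I01, continuous f} ->
  forall x e, I01 x -> 0 < e ->
  exists2 d, 0 < d & forall y, I01 y -> `|x - y| < d -> `|f x - f y| < e.
Proof.
move=> /subspace_continuousP fc x e Ix e0.
have /cvgrPdist_lt /(_ _ e0) := fc x Ix.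
rewrite near_withinE => /nbhs_ballP[d /= d0 dP].
by exists d => // y Iy xy; apply: dP.
Qed.

Lemma unit_itv_unif_continuous (f : R -> R) : {within I01, continuous f} ->
  forall e, 0 < e -> exists2 d, 0 < d &
    forall x y, I01 x -> I01 y -> `|x - y| < d -> `|f x - f y| < e.
Proof.
move=> fc e e0.
have /compact_near_coveringP cI : compact I01 by exact: segment_compact.
pose P (d x : R) := I01 x -> forall y, I01 y -> `|x - y| < d -> `|f x - f y| < e.
have : \forall d \near 0^'+, I01 `<=` P d.
  apply: cI => x Ix.
  have [d d0 dP] := unit_itv_continuous_near fc Ix (divr_gt0 e0 (ltr0n R 2)).
  have d20 : 0 < d / 2 by rewrite divr_gt0.
  exists (ball x (d / 2), [set t | t < d / 2]) => /=.
    by split; [exact: nbhsx_ballx|exact: nbhs_right_lt].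
  move=> [x' t] [/= xx' td] Ix' y Iy x'y; rewrite /ball /= in xx'.
  have h1 : `|f x - f x'| < e / 2 by apply: dP => //; lra.
  have h2 : `|f x - f y| < e / 2.
    apply: dP => //; rewrite (_ : x - y = (x - x') + (x' - y)); last by ring.
    by rewrite (le_lt_trans (ler_normD _ _)) //; lra.
  rewrite (_ : f x' - f y = (f x - f y) - (f x - f x')); last by ring.
  by rewrite (le_lt_trans (ler_normB _ _)) //; lra.
move=> h; have [d [dP d0]] : exists d, (I01 `<=` P d) /\ 0 < d.
  apply: (@filter_ex _ (0^'+)); apply: filterI => //; exact: nbhs_right_gt.
by exists d => // x y Ix Iy; exact: dP.
Qed.

Lemma unit_itv_continuous_bounded (f : R -> R) : {within I01, continuous f} ->
  exists2 M, 0 < M & forall x, I01 x -> `|f x| <= M.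
Proof.
move=> fc.
have cI : compact I01 by exact: segment_compact.
have [M [Mr hM]] := compact_bounded (continuous_compact fc cI).
exists (`|M| + 1) => [|x Ix]; first by rewrite ltr_wpDl.
by apply: hM; [rewrite (le_lt_trans (ler_norm M)) // ltrDl|exists x].
Qed.

(** Bernstein's proof: the deviation of [f (k / n)] from [f x] is bounded by a quadratic function
    [q] of [k], whose binomial mean is [e / 2] plus a multiple of the variance. *)
Lemma weierstrass (f : R -> R) e : {within I01, continuous f} -> 0 < e ->
  exists p : {poly R}, forall x, I01 x -> `|f x - p.[x]| <= e.
Proof.
move=> fc e0.
have [M M0 fM] := unit_itv_continuous_bounded fc.
have [d d0 fd] := unit_itv_unif_continuous fc (divr_gt0 e0 (ltr0n R 2)).
(* With this [c] the quadratic term alone reaches [2 * M] once [k / n] is at distance [d] from [x];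
   closer points are covered by the [e / 2] of uniform continuity. The choice of [n] below gives
   [c / n <= e / 2]. *)
pose c := 2 * M / d ^+ 2.
have c0 : 0 < c by rewrite /c divr_gt0 ?mulr_gt0 ?exprn_gt0.
pose n := (Num.truncn (2 * c / e)).+1.
have nE : 2 * c / e < n%:R by rewrite truncnS_gt.
have n0 : 0 < n%:R :> R by rewrite ltr0n.
exists (bernstein n (fun k => f (k%:R / n%:R))) => x Ix.
have /unit_itvP /andP[x0 x1] := Ix.
pose q k := e / 2 + c / n%:R ^+ 2 * (k%:R + - (n%:R * x)) ^+ 2.
have Iq k : (k <= n)%N -> I01 (k%:R / n%:R).
  move=> kn; apply/unit_itvP; rewrite divr_ge0 ?ler0n //=.
  by rewrite ler_pdivrMr // mul1r ler_nat.
have fq k : (k <= n)%N -> `|f x - f (k%:R / n%:R)| <= q k.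
  move=> kn; have qsq : c / n%:R ^+ 2 * (k%:R + - (n%:R * x)) ^+ 2 =
      c * (x - k%:R / n%:R) ^+ 2.
    by field; rewrite gt_eqF.
  rewrite /q qsq; have [xk|xk] := ltP `|x - k%:R / n%:R| d.
    have := fd _ _ Ix (Iq _ kn) xk.
    have : 0 <= c * (x - k%:R / n%:R) ^+ 2 by rewrite mulr_ge0 ?sqr_ge0 ?ltW.
    by lra.
  apply: (@le_trans _ _ (2 * M)).
    have h1 := fM _ Ix; have h2 := fM _ (Iq _ kn).
    by rewrite (le_trans (ler_normB _ _)) //; lra.
  have : d ^+ 2 <= (x - k%:R / n%:R) ^+ 2.
    by rewrite -[leRHS]real_normK ?num_real // lerXn2r ?nnegrE // ltW.
  move=> dx; have : 2 * M <= c * (x - k%:R / n%:R) ^+ 2.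
    by rewrite /c mulrAC ler_pdivlMr ?exprn_gt0 // ler_pM2l ?mulr_gt0.
  by lra.
have qE : (bernstein n q).[x] <= e.
  rewrite bernstein_affine bernstein_square addrN expr0n add0r.
  have -> : c / n%:R ^+ 2 * (n%:R * x * (1 - x)) = (x * (1 - x)) * (c / n%:R).
    by field; rewrite gt_eqF.
  have h1 : x * (1 - x) <= 1 by nra.
  have h2 : 0 <= c / n%:R by rewrite divr_ge0 // ltW.
  have h3 : c / n%:R <= e / 2.
    rewrite ler_pdivrMr //; move: nE; rewrite ltr_pdivrMr // => nE; lra.
  have h4 : (x * (1 - x)) * (c / n%:R) <= 1 * (c / n%:R) by exact: ler_wpM2r.
  by lra.
have E : f x - (bernstein n (fun k => f (k%:R / n%:R))).[x] =
    (bernstein n (fun k => f x + (- 1) * f (k%:R / n%:R))).[x].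
  by rewrite bernstein_affine; ring.
rewrite E ler_norml; apply/andP; split.
  rewrite lerNl; apply: le_trans qE.
  have -> : - (bernstein n (fun k => f x + (- 1) * f (k%:R / n%:R))).[x] =
      (bernstein n (fun k => 0 + (- 1) * (f x + (- 1) * f (k%:R / n%:R)))).[x].
    by rewrite [RHS]bernstein_affine; ring.
  apply: le_bernstein => // k kn; apply: le_trans (fq k kn).
  by rewrite (_ : 0 + _ = - (f x - f (k%:R / n%:R))); [rewrite -normrN ler_norm|ring].
apply: le_trans qE; apply: le_bernstein => // k kn; apply: le_trans (fq k kn).
by rewrite mulN1r ler_norm.
Qed.

End Bernstein.

(** * From moments to integrals of continuous functions *)

Section Moments.
Variable R : realType.
Local Notation I01 := (@unit_itv R).
Implicit Types (mu nu : unit_probabilities R) (f : R -> R).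

Lemma unit_itv_continuous_measurable f : {within I01, continuous f} ->
  measurable_fun I01 (f : measurableTypeR R -> measurableTypeR R).
Proof.
by move=> fc; apply: subspace_continuous_measurable_fun => //; exact: measurable_unit_itv.
Qed.

Lemma unit_probability_integrable mu f M :
  measurable_fun I01 (f : measurableTypeR R -> measurableTypeR R) ->
  (forall s, I01 s -> `|f s| <= M) -> (val mu).-integrable I01 (EFin \o f).
Proof.
move=> mf fM; apply: measurable_bounded_integrable => //.
- exact: measurable_unit_itv.
- by rewrite (le_lt_trans (probability_le1 _ _)) ?ltry //; exact: measurable_unit_itv.
- exists M; split; first exact: num_real.
  by move=> N MN x Ix /=; apply: le_trans (ltW MN); exact: fM.
Qed.

Lemma unit_probability_integrable_continuous mu f : {within I01, continuous f} ->
  (val mu).-integrable I01 (EFin \o f).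
Proof.
move=> fc; have [M _ fM] := unit_itv_continuous_bounded fc.
exact: unit_probability_integrable (unit_itv_continuous_measurable fc) fM.
Qed.

Lemma horner_within (p : {poly R}) : {within I01, continuous (fun s => p.[s])}.
Proof. by apply: continuous_subspaceT; exact: continuous_horner. Qed.

Lemma exprn_within k : {within I01, continuous (fun s : R => s ^+ k)}.
Proof. by apply: continuous_subspaceT; exact: exprn_continuous. Qed.

Lemma Rintegral_unit_cst mu c : \int[val mu]_(s in I01) c = c.
Proof.
rewrite Rintegral_cst; last exact: measurable_unit_itv.
by have [h _] := set_valP mu; rewrite [X in fine X]h mulr1.
Qed.

Lemma Rintegral_horner mu (p : {poly R}) :
  \int[val mu]_(s in I01) p.[s] =
  \sum_(i < size p) p`_i * \int[val mu]_(s in I01) (s ^+ i).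
Proof.
have ie i : (val mu).-integrable I01 (EFin \o (fun s : R => s ^+ i)).
  exact/unit_probability_integrable_continuous/exprn_within.
suff h n : (val mu).-integrable I01 (EFin \o (fun s : R => \sum_(i < n) p`_i * s ^+ i)) /\
   \int[val mu]_(s in I01) (\sum_(i < n) p`_i * s ^+ i) =
  \sum_(i < n) p`_i * \int[val mu]_(s in I01) (s ^+ i).
  by rewrite -(h (size p)).2; apply: eq_Rintegral => s _; rewrite horner_coef.
have ic k : {within I01, continuous (fun s : R => \sum_(i < k) p`_i * s ^+ i)}.
  rewrite (_ : (fun s : R => _) = (fun s => (\poly_(i < k) p`_i).[s])); last first.
    by apply/funext => s; rewrite horner_poly.
  exact: horner_within.
have ic' k : {within I01, continuous (fun s : R => p`_k * s ^+ k)}.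
  rewrite (_ : (fun s : R => _) = (fun s => (p`_k *: 'X^k).[s])); last first.
    by apply/funext => s; rewrite hornerZ hornerXn.
  exact: horner_within.
split; first exact: unit_probability_integrable_continuous.
elim: n => [|n IH].
  under eq_Rintegral do rewrite big_ord0.
  by rewrite Rintegral_unit_cst big_ord0.
under eq_Rintegral do rewrite big_ord_recr /=.
rewrite (RintegralD (@measurable_unit_itv R) (unit_probability_integrable_continuous mu (@ic n))
  (unit_probability_integrable_continuous mu (@ic' n))).
by rewrite RintegralZl ?IH ?big_ord_recr //; exact: measurable_unit_itv.
Qed.

Lemma le_Rintegral_unit mu f g M N :
  measurable_fun I01 (f : measurableTypeR R -> measurableTypeR R) ->
  measurable_fun I01 (g : measurableTypeR R -> measurableTypeR R) ->
  (forall s, I01 s -> `|f s| <= M) -> (forall s, I01 s -> `|g s| <= N) ->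
  (forall s, I01 s -> f s <= g s) ->
  \int[val mu]_(s in I01) f s <= \int[val mu]_(s in I01) g s.
Proof.
move=> mf mg fM gN fg; apply: le_Rintegral => //; first exact: measurable_unit_itv.
  exact: unit_probability_integrable mf fM.
exact: unit_probability_integrable mg gN.
Qed.

Lemma Rintegral_unit_dist mu f g e : {within I01, continuous f} ->
  {within I01, continuous g} -> (forall s, I01 s -> `|f s - g s| <= e) ->
  `|\int[val mu]_(s in I01) f s - \int[val mu]_(s in I01) g s| <= e.
Proof.
move=> fc gc fge.
have mI := @measurable_unit_itv R.
have fi := unit_probability_integrable_continuous mu fc.
have gi := unit_probability_integrable_continuous mu gc.
rewrite -RintegralB //; apply: le_trans (le_normr_Rintegral _ _) _ => //.
  exact: (integrableB mI fi gi).
have mfg : measurable_fun I01 ((fun s => f s - g s) : measurableTypeR R -> measurableTypeR R).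
  by apply: measurable_funB; exact: unit_itv_continuous_measurable.
rewrite -[leRHS](Rintegral_unit_cst mu e).
apply: (@le_Rintegral_unit mu (fun s => `|f s - g s|) (fun=> e) e `|e|) => //.
- exact: measurableT_comp.
- by move=> s Is; rewrite normr_id fge.
Qed.

(** For positive [N], the continuous function equal to 1 up to [j / N], to 0 from [(j + 1) / N] on,
    and linear in between. It is a substitute for the indicator of an initial interval, which weak
    convergence does not control. *)
Definition ramp (N j : nat) (s : R) : R := Num.max 0 (Num.min 1 (j.+1%:R - N%:R * s)).

Lemma ramp_continuous N j : {within I01, continuous (ramp N j)}.
Proof.
apply: continuous_subspaceT.
apply: (@max_fun_continuous _ _ R (fun=> 0)); first exact: cst_continuous.
apply: (@min_fun_continuous _ _ R (fun=> 1)); first exact: cst_continuous.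
by move=> s; apply: cvgB; [exact: cvg_cst|apply: cvgM; [exact: cvg_cst|exact: cvg_id]].
Qed.

Lemma ramp_ge0le1 N j s : 0 <= ramp N j s <= 1.
Proof. by rewrite /ramp le_max lexx /= ge_max ler01 ge_min lexx. Qed.

Lemma Rintegral_unit_indic nu (A : set (measurableTypeR R)) : measurable A ->
  A `<=` I01 -> \int[val nu]_(s in I01) \1_A s = fine (val nu A).
Proof.
move=> mA AI; rewrite /Rintegral integral_indic //; last exact: measurable_unit_itv.
by rewrite setIidl.
Qed.

(** A ramp fits between the indicators of [[0, 1 - y - e[] and [[0, 1 - y[]. So the [nu']-mass of
    the former exceeds the [nu]-mass of the latter by at most [e], which is the inclusion. *)
Lemma ramp_shift (nu nu' : unit_probabilities R) (N : nat) (e : R) :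
  0 < e -> 2 <= e * N%:R ->
  (forall j : 'I_N, \int[val nu']_(s in I01) ramp N j s <=
     \int[val nu]_(s in I01) ramp N j s + e) ->
  forall p, S_ nu p -> S_ nu' (shift e p).
Proof.
move=> e0 eN hj p [hp hS].
split; first by apply: unit_square_shift => //; exact: ltW.
have /unit_squareP[p10 p11 p20 p21] := hp.
have mI (b : R) : measurable (`[0, b[%classic : set (measurableTypeR R)).
  exact: measurable_itv.
have [y1|y1] := leP 1 (p.2 + e).
  rewrite /= [Num.min (p.2 + e) 1]min_r // subrr set_itvE measure0 lee_fin.
  by rewrite le_min ler01 addr_ge0 // ltW.
rewrite /= [Num.min (p.2 + e) 1]min_l ?(ltW y1) //.
have N0 : 0 < N%:R :> R.
  rewrite ltr0n lt0n; apply/eqP => N0; move: eN; rewrite N0 mulr0; lra.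
pose a := 1 - (p.2 + e).
have a0 : 0 <= a * N%:R by rewrite mulr_ge0 ?ltW // /a; lra.
(* The ramp of index [j + 1] is still 1 at [a], since [a < (j + 1) / N], and is 0 from [(j + 2) / N]
   on, which is at most [a + 2 / N <= a + e]. This is where [2 <= e * N%:R] comes from; it also
   gives [j + 1 < N]. *)
pose j := Num.truncn (a * N%:R).
have /andP[ja aj] := truncn_itv a0.
have jN : (j.+1 < N)%N.
  rewrite -(ltr_nat R) -natr1.
  have : j%:R <= N%:R - e * N%:R.
    apply: le_trans ja _; rewrite -[X in X - _]mul1r -mulrBl.
    by rewrite (ler_wpM2r (ltW N0)) // /a; lra.
  by move: eN; move: (e * N%:R) (N%:R : R) (j%:R : R) => u v w; lra.
have := hj (Ordinal jN) => /= hjj.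
have sub b : b <= 1 -> `[0, b[%classic `<=` I01.
  move=> b1 x; rewrite /= in_itv /= => /andP[x0 xb]; apply/unit_itvP.
  by rewrite x0 (le_trans (ltW xb)).
have h1 : fine (val nu' `[0, a[%classic) <= \int[val nu']_(s in I01) ramp N j.+1 s.
  rewrite -Rintegral_unit_indic //; last by apply: sub; rewrite /a; lra.
  apply: (@le_Rintegral_unit nu' _ _ 1 1) => //.
  - apply: unit_itv_continuous_measurable; exact: ramp_continuous.
  - by move=> s _; rewrite indicE; case: (_ \in _); rewrite ?normr1 ?normr0 ?ler01.
  - by move=> s _; have /andP[? ?] := ramp_ge0le1 N j.+1 s; rewrite ger0_norm.
  - move=> s Is; rewrite indicE; case: (boolP (s \in _)) => [/set_mem|_]; last first.
      by have /andP[] := ramp_ge0le1 N j.+1 s.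
    rewrite /= in_itv /= => /andP[s0 sa]; rewrite /ramp.
    have h : 1 <= j.+2%:R - N%:R * s.
      have : N%:R * s <= a * N%:R by rewrite mulrC (ler_wpM2r (ltW N0)) // ltW.
      rewrite -[j.+2%:R]natr1; rewrite -/j in aj; lra.
    by rewrite min_l // max_r ?ler01.
have h2 : \int[val nu]_(s in I01) ramp N j.+1 s <= fine (val nu `[0, 1 - p.2[%classic).
  rewrite -Rintegral_unit_indic //; last by apply: sub; lra.
  apply: (@le_Rintegral_unit nu _ _ 1 1) => //.
  - apply: unit_itv_continuous_measurable; exact: ramp_continuous.
  - by move=> s _; have /andP[? ?] := ramp_ge0le1 N j.+1 s; rewrite ger0_norm.
  - by move=> s _; rewrite indicE; case: (_ \in _); rewrite ?normr1 ?normr0 ?ler01.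
  - move=> s Is; rewrite indicE; case: (boolP (s \in _)) => [_|/negP].
      by have /andP[] := ramp_ge0le1 N j.+1 s.
    move=> ns; have /unit_itvP /andP[s0 s1] := Is.
    have sp : 1 - p.2 <= s.
      rewrite leNgt; apply/negP => h; apply: ns; apply/mem_set.
      by rewrite /= in_itv /= s0 h.
    rewrite /ramp max_l // ge_min; apply/orP; right.
    have : (a + e) * N%:R <= N%:R * s.
      by rewrite mulrC (ler_wpM2l (ltW N0)) // /a; lra.
    rewrite -[j.+2%:R]natr1 -[j.+1%:R]natr1; rewrite -/j in ja; rewrite mulrDl; lra.
rewrite -/a probability_fin_num // lee_fin le_min.
have h3 : fine (val nu `[0, 1 - p.2[%classic) <= p.1.
  by rewrite -lee_fin -probability_fin_num.
apply/andP; split; first by lra.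
by rewrite -lee_fin -probability_fin_num // probability_le1.
Qed.

Lemma dist_lt3 (a b c d e : R) : `|a - b| <= e / 3 -> `|c - d| <= e / 3 ->
  `|b - d| < e / 3 -> `|a - c| < e.
Proof.
rewrite !ler_norml !ltr_norml => /andP[? ?] /andP[? ?] /andP[? ?].
by apply/andP; split; lra.
Qed.

Section Convergence.
Variables (T : Type) (F : set_system T) (FF : Filter F).
Variables (m : T -> unit_probabilities R) (mu : unit_probabilities R).
Hypothesis moments : forall k,
  \int[val (m t)]_(s in I01) (s ^+ k.+1) @[t --> F] -->
  \int[val mu]_(s in I01) (s ^+ k.+1).

Lemma cvg_sum_ord n (f : nat -> T -> R) (l : nat -> R) :
  (forall i, f i t @[t --> F] --> l i) ->
  \sum_(i < n) f i t @[t --> F] --> \sum_(i < n) l i.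
Proof.
move=> fl; elim: n => [|n IH].
  by rewrite big_ord0; under eq_fun do rewrite big_ord0; exact: cvg_cst.
rewrite big_ord_recr; under eq_fun do rewrite big_ord_recr.
by apply: cvgD => //=.
Qed.

(** Integrals of polynomials converge by linearity, and a uniformly close polynomial costs [e / 3]
    under each of the two measures, both having mass 1. *)
Lemma cvg_Rintegral_continuous f : {within I01, continuous f} ->
  \int[val (m t)]_(s in I01) f s @[t --> F] --> \int[val mu]_(s in I01) f s.
Proof.
move=> fc; apply/cvgrPdist_lt => e e0.
have e30 : 0 < e / 3 by rewrite divr_gt0.
have [p fp] := weierstrass fc e30.
have pc := @horner_within p.
have cp : \int[val (m t)]_(s in I01) p.[s] @[t --> F] --> \int[val mu]_(s in I01) p.[s].
  rewrite Rintegral_horner; under eq_fun do rewrite Rintegral_horner.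
  apply: (@cvg_sum_ord _ (fun i t => p`_i * \int[val (m t)]_(s in I01) (s ^+ i))
    (fun i => p`_i * \int[val mu]_(s in I01) (s ^+ i))) => -[|i] /=;
    apply: cvgM; try exact: cvg_cst; last exact: moments.
  (* [moments] starts at exponent 1; the constant term is the total mass. *)
  have m0 nu : \int[val nu]_(s in I01) (s ^+ 0) = 1.
    by under eq_Rintegral do rewrite expr0; rewrite Rintegral_unit_cst.
  have E : (fun t => \int[val (m t)]_(s in I01) (s ^+ 0)) = cst 1.
    by apply/funext => t; exact: m0.
  by rewrite m0 E; exact: cvg_cst.
have /cvgrPdist_lt /(_ _ e30) := cp; apply: filterS => t pt.
have h1 := Rintegral_unit_dist mu fc pc fp.
have h2 := Rintegral_unit_dist (m t) fc pc fp.
exact: dist_lt3 h1 h2 pt.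
Qed.

(** For a given [e] the finitely many ramps of one mesh [N] suffice, so their convergence can be
    used simultaneously along the filter. *)
Lemma cvg_moments_levy e : 0 < e -> \forall t \near F, levy e (S_ mu) (S_ (m t)).
Proof.
move=> e0; pose N := (Num.truncn (2 / e)).+1.
have eN : 2 <= e * N%:R.
  by rewrite mulrC -ler_pdivrMr // ltW // truncnS_gt.
have : \forall t \near F, forall j : 'I_N,
    `|\int[val mu]_(s in I01) ramp N j s - \int[val (m t)]_(s in I01) ramp N j s| < e.
  apply: filter_forall => j.
  by have /cvgrPdist_lt /(_ _ e0) := cvg_Rintegral_continuous (@ramp_continuous N j).
apply: filterS => t ht; split; apply: (ramp_shift e0 eN) => j;
  by have := ht j; rewrite ltr_norml => /andP[? ?]; lra.
Qed.

End Convergence.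

End Moments.

(** * Classes modulo a.e. equality *)

Section NonmeasurableIntegral.
Context d (T : measurableType d) (R : realType).
Variable mu : {measure set T -> \bar R}.
Local Open Scope ereal_scope.
Import HBNNSimple.

(* No measurability of [f] and [g]: a simple function below [f] stays below
   [g], with the same integral, once it is cut off on [N]. *)
Lemma integral_eq_off_null (D N : set T) (f g : T -> \bar R) :
  measurable N -> mu N = 0 -> (forall x, D x -> ~ N x -> f x = g x) ->
  \int[mu]_(x in D) f x = \int[mu]_(x in D) g x.
Proof.
move=> mN N0 fg.
have mNC : measurable (~` N) by exact: measurableC.
have sint (h : {nnsfun T >-> R}) : sintegral mu (proj_nnsfun h mNC) = sintegral mu h.
  rewrite -mrestrict -integral_nnsfun // -[in RHS](patch_setT (fun=> 0%R) h) -integral_nnsfun //.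
  rewrite [RHS](@ge0_negligible_integral _ _ _ mu setT N) //.
  - by rewrite setTD.
  - exact/measurable_EFinP/measurable_funP.
  - by move=> x _; rewrite lee_fin.
have le (F G : T -> \bar R) : (forall x, 0 <= G x) -> (forall x, ~ N x -> F x = G x) ->
    ereal_sup [set sintegral mu h | h in [set h : {nnsfun T >-> R} | forall x, (h x)%:E <= F x]]
    <= ereal_sup [set sintegral mu h | h in [set h : {nnsfun T >-> R} | forall x, (h x)%:E <= G x]].
  move=> G0 FG; apply: ge_ereal_sup => _ [h /= hF <-]; apply: ereal_sup_ubound => /=.
  exists (proj_nnsfun h mNC); last exact: sint.
  move=> x; rewrite -mrestrict patchE; case: ifPn => [/set_mem /FG <-|_]; first exact: hF.
  exact: G0.
have pat x : ~ N x -> (f \_ D) x = (g \_ D) x.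
  by move=> nNx; rewrite !patchE; case: ifPn => // /set_mem Dx; exact: fg.
rewrite /integral; congr (_ - _); apply/eqP; rewrite eq_le; apply/andP; split;
  by apply: le => x; rewrite ?funepos_ge0 ?funeneg_ge0 // => nNx;
    rewrite ?funepos.unlock ?funeneg.unlock pat.
Qed.

End NonmeasurableIntegral.

(** * Closed representatives of a.e. classes *)

Section Classes.
Variable R : realType.
Local Notation leb := (@lebesgue_measure R).
Local Notation C := (increasing_closed_sets R).
Local Notation R2 := (measurableTypeR R * measurableTypeR R)%type.
Implicit Types (S T : set (R * R)) (p q : R * R) (W : R * R -> R).

(** Below an interior point of the hull there is another point of the hull on the same diagonal, and
    shifting it back to [p] shows that [W p] is 1. *)
Lemma increasing01_hull_off W p : increasing01 W -> unit_square p ->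
  ~ (hull W `\` (hull W)°) p -> W p = \1_(hull W) p.
Proof.
move=> iW hp hn; have hC := hull_increasing_closed iW.
have [h|h] := pselect (hull W p); last first.
  rewrite indic_notmem //; case: (iW.1 _ hp) => // W1.
  by case: h; exact: hull_sub.
rewrite indic_mem //.
have /interior_increasing_closedP : (hull W)° p.
  by apply: contrapT => h'; apply: hn.
move=> /(_ hC)[p1 p2 [e e0 he]].
have := hull_shift iW he e0; rewrite /= shift_lt1 !subrK //.
by rewrite -surjective_pairing; apply; lra.
Qed.

Lemma measurable_boundary S : C S -> measurable (S `\` S° : set R2).
Proof.
move=> hS; apply: measurableD; first exact: increasing_closed_measurable.
by apply: open_measurable_plane; exact: open_interior.
Qed.

Lemma ae_leb2_filter : Filter (nbhs (almost_everywhere (@leb2 R))).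
Proof. exact: (ae_filter_ringOfSetsType (leb \x leb)%E). Qed.

Lemma ae_classP W W' : ae_class W = ae_class W' <->
  W = W' %[ae (@leb2 R) in (@unit_square R)].
Proof.
have FF := ae_leb2_filter; split=> [E|h].
  have : ae_class W W.
    by rewrite /ae_class /=; apply: aeW.
  by rewrite E.
apply/seteqP; split=> V /=; rewrite /ae_class /= => hV.
  by move: hV h; apply: filterS2 => p h1 h2 hp; rewrite h1 // h2.
by move: hV h; apply: filterS2 => p h1 h2 hp; rewrite h1 // h2.
Qed.

Lemma ae_class_hull W : increasing01 W -> ae_class W = ae_class \1_(hull W).
Proof.
move=> iW; have hC := hull_increasing_closed iW.
apply/ae_classP; exists (hull W `\` (hull W)°); split.
- exact: measurable_boundary.
- exact: area_boundary.
- move=> p /= h; apply: contrapT => hn; apply: h => hp.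
  exact: increasing01_hull_off.
Qed.

Lemma area_box (a b c d : R) : a < b -> c < d ->
  @leb2 R (`]a, b[%classic `*` `]c, d[%classic) = ((b - a) * (d - c))%:E.
Proof.
move=> ab cd; rewrite [LHS]product_measure1E; [|exact: measurable_itv..].
by rewrite [X in (X * _)%E]lebesgue_measure_itv [X in (_ * X)%E]lebesgue_measure_itv /= !lte_fin ab cd.
Qed.

(** The open box between [p] and [shift e p] has positive area, so it contains a point off the null
    set. [W] is 1 at that point, hence so is [W'], and monotonicity carries this up to
    [shift e p]. *)
Lemma hull_ae_sub W W' : increasing01 W -> increasing01 W' ->
  W = W' %[ae (@leb2 R) in (@unit_square R)] -> hull W `<=` hull W'.
Proof.
move=> iW iW' [N [mN N0 WN]] p hp.
have hC := hull_increasing_closed iW.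
have [hsq [h|[h|_]]] := hp; [by split=> //; left|by split=> //; right; left|].
have /unit_squareP[p10 p11 p20 p21] := hsq.
have [pe1|pn1] := eqVneq p.1 1; first by split=> //; left.
have [pe2|pn2] := eqVneq p.2 1; first by split=> //; right; left.
have lt1 : p.1 < 1 by rewrite lt_neqAle pn1.
have lt2 : p.2 < 1 by rewrite lt_neqAle pn2.
split=> //; right; right => e e0.
pose x := p.1 + Num.min e (1 - p.1); pose y := p.2 + Num.min e (1 - p.2).
have m1 : 0 < Num.min e (1 - p.1) by rewrite lt_min e0 subr_gt0.
have m2 : 0 < Num.min e (1 - p.2) by rewrite lt_min e0 subr_gt0.
have m1e : Num.min e (1 - p.1) <= e by rewrite ge_min lexx.
have m2e : Num.min e (1 - p.2) <= e by rewrite ge_min lexx.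
have m11 : Num.min e (1 - p.1) <= 1 - p.1 by rewrite ge_min lexx orbT.
have m21 : Num.min e (1 - p.2) <= 1 - p.2 by rewrite ge_min lexx orbT.
have xE : (shift e p).1 >= x by rewrite /x /= le_min lerD2l m1e; lra.
have yE : (shift e p).2 >= y by rewrite /y /= le_min lerD2l m2e; lra.
have [q [Bq nNq]] : exists q, (`]p.1, x[%classic `*` `]p.2, y[%classic) q /\ ~ N q.
  apply: contrapT => h.
  have sub : `]p.1, x[%classic `*` `]p.2, y[%classic `<=` N.
    by move=> q Bq; apply: contrapT => nNq; apply: h; exists q.
  have : (@leb2 R (`]p.1, x[%classic `*` `]p.2, y[%classic) <= 0)%E.
    rewrite -N0; apply: le_measure; rewrite ?inE //.
    by apply: measurableX; exact: measurable_itv.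
  rewrite area_box ?ltrDl // lee_fin leNgt => /negP; apply.
  by rewrite mulr_gt0 // subr_gt0 ltrDl.
case: q Bq nNq => u v [/=]; rewrite !in_itv /= => /andP[u1 u2] /andP[w1 w2] nNq.
have hq : unit_square (u, v) by apply/unit_squareP; split=> /=; rewrite /x /y in u2 w2; lra.
have hs := unit_square_shift (ltW e0) hsq.
have Wq : W (u, v) = 1.
  (* The largest diagonal step from [p] that stays below [(u, v)]. *)
  pose d := Num.min (u - p.1) (v - p.2).
  have d0 : 0 < d by rewrite lt_min !subr_gt0 u1.
  have d1 : d <= u - p.1 by rewrite ge_min lexx.
  have d2 : d <= v - p.2 by rewrite ge_min lexx orbT.
  have := hull_shift iW hp d0 lt1 lt2.
  apply: increasing01_eq1 => //; first exact: unit_square_shift (ltW d0) hsq.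
    by rewrite /= ge_min; apply/orP; left; lra.
  by rewrite /= ge_min; apply/orP; left; lra.
have W'q : W' (u, v) = 1.
  rewrite -Wq; symmetry; apply: contrapT => hne; apply: nNq; apply: WN => /= h.
  by apply: hne; exact: h.
apply: increasing01_eq1 W'q => //=.
  by apply: (le_trans _ xE); exact: ltW.
by apply: (le_trans _ yE); exact: ltW.
Qed.

Lemma hull_ae W W' : increasing01 W -> increasing01 W' ->
  ae_class W = ae_class W' -> hull W = hull W'.
Proof.
move=> iW iW' /ae_classP h; apply/seteqP; split; apply: hull_ae_sub => //.
by have FF := ae_leb2_filter; apply: filterS h => p h hp; rewrite h.
Qed.

Lemma representativeP (w : increasing01_classes R) :
  increasing01 (representative w) /\ val w = ae_class (representative w).
Proof.
have [W iW E] := set_valP w.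
rewrite /representative; case: xgetP => [V _ []//|/(_ W) h].
by case: h; split.
Qed.

Lemma indic_in_classes (S : C) : increasing01_classes R (ae_class \1_(val S)).
Proof. by exists (\1_(val S)) => //; apply: increasing01_indic; exact: set_valP. Qed.

Definition indic_class (S : C) : increasing01_classes R :=
  SigSub (mem_set (indic_in_classes S)).

Lemma representative_hullP w : C (hull (representative w)).
Proof. by apply: hull_increasing_closed; have [] := representativeP w. Qed.

Definition class_hull (w : increasing01_classes R) : C :=
  SigSub (mem_set (representative_hullP w)).

Lemma class_hullE w W : increasing01 W -> val w = ae_class W ->
  val (class_hull w) = hull W.
Proof.
move=> iW E; have [iV EV] := representativeP w.
by apply: hull_ae => //; rewrite -E.
Qed.

Lemma indic_classK : cancel indic_class class_hull.
Proof.
move=> S; apply/val_inj; have hS := set_valP S.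
by rewrite (@class_hullE _ \1_(val S)) ?hull_indic //; exact: increasing01_indic.
Qed.

Lemma class_hullK : cancel class_hull indic_class.
Proof.
move=> w; apply/val_inj => /=; have [iV ->] := representativeP w.
by rewrite [RHS]ae_class_hull.
Qed.

End Classes.

(** * The cut distance *)

Section MeasurePreserving.
Variable R : realType.
Local Notation leb := (@lebesgue_measure R).
Local Notation I01 := (@unit_itv R).
Local Notation R1 := (measurableTypeR R).

Section Extension.
Variable phi : R -> R.
Hypothesis hphi : measure_preserving_bijection phi.

(** The value 2 keeps the preimage of any subset of the unit interval inside the unit interval, so
    the extended map can push Lebesgue measure on the whole line forward. *)
Definition extend_outside (x : R) : R := if `[< I01 x >] then phi x else 2.

Lemma extend_outsideE x : I01 x -> extend_outside x = phi x.
Proof. by move=> Ix; rewrite /extend_outside asboolT. Qed.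

Lemma extend_outside_unit x : I01 (extend_outside x) <-> I01 x.
Proof.
have [[fphi _ _] _ _] := hphi; rewrite /extend_outside; case: asboolP => Ix.
  by split=> // _; exact: fphi.
by split=> // /unit_itvP /andP[_ ?]; lra.
Qed.

Lemma measurable_extend_outside :
  measurable_fun setT (extend_outside : R1 -> R1).
Proof.
have [_ mphi _] := hphi; move=> _ B mB; rewrite setTI.
rewrite (_ : _ @^-1` B = (I01 `&` phi @^-1` B) `|` (~` I01 `&` [set x | B 2])).
  apply: measurableU; first by apply: mphi => //; exact: measurable_unit_itv.
  apply: measurableI; first by apply: measurableC; exact: measurable_unit_itv.
  have [B2|nB2] := pselect (B 2).
    by rewrite (_ : [set x | _] = setT) //; apply/seteqP; split.
  by rewrite (_ : [set x | _] = set0) //; apply/seteqP; split.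
apply/seteqP; split=> x /=; rewrite /extend_outside; case: asboolP => Ix.
- by left.
- by right.
- by move=> [[]|[]].
- by move=> [[]|[]].
Qed.

Lemma leb_extend_outside (A : set R1) : measurable A -> A `<=` I01 ->
  leb (extend_outside @^-1` A) = leb A.
Proof.
have [_ _ lphi] := hphi; move=> mA AI; rewrite -[RHS]lphi //; congr (leb _).
apply/seteqP; split=> x /=.
  move=> h; have Ix : I01 x by apply/extend_outside_unit; exact: AI.
  by rewrite extend_outsideE // in h.
by move=> [Ix h]; rewrite extend_outsideE.
Qed.

Lemma Rintegral_extend_outside (f : R -> R) (M : R) :
  measurable_fun setT (f : R1 -> R1) ->
  (forall s, I01 s -> `|f s| <= M) ->
  \int[leb]_(x in I01) f (extend_outside x) = \int[leb]_(x in I01) f x.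
Proof.
move=> mf fM; rewrite /Rintegral; congr fine; symmetry.
pose g : R1 -> R1 := extend_outside.
have gI : g @^-1` I01 = I01.
  by apply/seteqP; split=> x /= h; apply/extend_outside_unit.
transitivity (\int[pushforward leb g]_(s in I01) (f s)%:E)%E.
  apply: eq_measure_integral; first exact: measurable_extend_outside.
  by move=> mg A mA AI; rewrite -[LHS]leb_extend_outside.
rewrite integral_pushforward //=.
- by rewrite gI.
- exact: measurable_extend_outside.
- exact/measurable_EFinP.
- rewrite gI; apply: (@bounded_integrable01 _ (f \o g) M).
    apply: measurable_funTS; apply: measurableT_comp => //.
    exact: measurable_extend_outside.
  by move=> x Ix; apply: fM; apply/extend_outside_unit.
- exact: measurable_unit_itv.
Qed.

End Extension.

Section Rearrangement.
Variables phi psi : R -> R.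
Hypotheses (hphi : measure_preserving_bijection phi)
  (hpsi : measure_preserving_bijection psi).
Local Notation R2 := (measurableTypeR R * measurableTypeR R)%type.
Implicit Types B : set (R * R).

Definition rearrange (p : R * R) : R * R :=
  (extend_outside phi p.1, extend_outside psi p.2).

Lemma measurable_rearrange B : measurable (B : set R2) ->
  measurable (rearrange @^-1` B : set R2).
Proof.
move=> mB.
have m : measurable_fun setT (rearrange : R2 -> R2).
  apply: measurable_fun_pair.
    by apply: measurableT_comp => //; exact: measurable_extend_outside.
  by apply: measurableT_comp => //; exact: measurable_extend_outside.
by rewrite -[X in measurable X]setTI; exact: m.
Qed.

Lemma rearrange_sub B : B `<=` @unit_square R -> rearrange @^-1` B `<=` @unit_square R.
Proof.
move=> hB p /= /hB [/= h1 h2].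
by split; [apply/(extend_outside_unit hphi)|apply/(extend_outside_unit hpsi)].
Qed.

(** [psi] preserves the length of each vertical section and [phi] only relabels the sections. The
    moments of the degree are therefore invariant under rearrangement. *)
Lemma degree_rearrange B x : measurable (B : set R2) -> B `<=` @unit_square R ->
  degree (rearrange @^-1` B) x = degree B (extend_outside phi x).
Proof.
move=> mB hB; rewrite /degree; congr fine.
rewrite -(leb_extend_outside hpsi (measurable_xsection _ mB) (xsection_unit hB)).
by congr (leb _).
Qed.

Lemma area_rearrange B : measurable (B : set R2) -> B `<=` @unit_square R ->
  leb2 (rearrange @^-1` B) = leb2 B.
Proof.
move=> mB hB; rewrite (area_degree (measurable_rearrange mB) (rearrange_sub hB)).
rewrite (area_degree mB hB); congr EFin.
under eq_Rintegral do rewrite degree_rearrange //.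
apply: (@Rintegral_extend_outside _ hphi _ 1); first exact: measurable_degree.
by move=> s _; have /andP[? ?] := degree_ge0le1 s mB hB; rewrite ger0_norm.
Qed.

End Rearrangement.
End MeasurePreserving.

(** * Cut norm and degree functions *)

Section CutNorm.
Variable R : realType.
Local Notation leb := (@lebesgue_measure R).
Local Notation I01 := (@unit_itv R).
Local Notation C := (increasing_closed_sets R).
Local Notation R1 := (measurableTypeR R).
Local Notation R2 := (measurableTypeR R * measurableTypeR R)%type.
Implicit Types (S T X Y : set (R * R)) (p q : R * R) (W : R * R -> R).

Lemma setU_setD (T : Type) (A B : set T) : A `<=` B -> B = A `|` (B `\` A).
Proof.
move=> AB; apply/seteqP; split=> x; last by move=> [/AB|[]].
by move=> Bx; have [h|h] := pselect (A x); [left|right].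
Qed.

Lemma normr_exprn_le1 (x : R) k : 0 <= x <= 1 -> `|x ^+ k| <= 1.
Proof. by move=> /andP[x0 x1]; rewrite ger0_norm ?exprn_ge0 // exprn_ile1. Qed.

Lemma ler_dist01 (a b : R) : 0 <= a <= 1 -> 0 <= b <= 1 -> `|a - b| <= 1.
Proof. by move=> /andP[? ?] /andP[? ?]; rewrite ler_norml; apply/andP; split; lra. Qed.

Lemma area_le1 X : measurable (X : set R2) -> X `<=` @unit_square R ->
  (leb2 X <= 1)%E.
Proof.
move=> mX hX; rewrite area_degree // lee_fin -[leRHS](Rintegral01_cst 1).
apply: le_Rintegral; first exact: measurable_unit_itv.
- apply: (@bounded_integrable01 _ _ 1).
    by apply: measurable_funTS; exact: measurable_degree.
  by move=> x _; have /andP[? ?] := degree_ge0le1 x mX hX; rewrite ger0_norm.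
- by apply: (@bounded_integrable01 _ _ 1) => // x _; rewrite normr1.
- by move=> x _; have /andP[] := degree_ge0le1 x mX hX.
Qed.

Lemma area_fin X : measurable (X : set R2) -> X `<=` @unit_square R ->
  leb2 X = (fine (leb2 X))%:E.
Proof.
move=> mX hX; rewrite fineK // ge0_fin_numE; last exact: measure_ge0.
by apply: le_lt_trans (area_le1 mX hX) _; rewrite ltry.
Qed.

Lemma integrable_indic_plane X (D : set R2) : measurable (X : set R2) ->
  measurable D -> D `<=` @unit_square R ->
  (leb \x leb)%E.-integrable D (EFin \o (\1_X : R2 -> R)).
Proof.
move=> mX mD hD; apply: measurable_bounded_integrable => //.
- by rewrite (le_lt_trans (area_le1 mD hD)) // ltry.
- exists 1; split; first exact: num_real.
  move=> N N1 x _ /=; apply: le_trans (ltW N1).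
  by case: (indic_set01 X x) => ->; rewrite ?normr0 ?normr1 ?ler01.
Qed.

Lemma Rintegral_indicB X Y (D : set R2) : measurable (X : set R2) ->
  measurable (Y : set R2) -> measurable D -> D `<=` @unit_square R ->
  \int[@leb2 R]_(p in D) (\1_X p - \1_Y p) =
  fine (leb2 (X `&` D)) - fine (leb2 (Y `&` D)).
Proof.
move=> mX mY mD hD.
rewrite [LHS](RintegralB mD (integrable_indic_plane mX mD hD) (integrable_indic_plane mY mD hD)).
by congr (_ - _); rewrite /Rintegral integral_indic.
Qed.

Lemma measurable_rect (A B : set R1) : measurable A -> measurable B ->
  measurable (A `*` B : set R2).
Proof. exact: measurableX. Qed.

Lemma rect_sub (A B : set R1) : A `<=` I01 -> B `<=` I01 ->
  A `*` B `<=` @unit_square R.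
Proof. by move=> AI BI p [/AI h1 /BI h2]; split. Qed.

Lemma area_strip X (A : set R1) : measurable (X : set R2) -> X `<=` @unit_square R ->
  measurable A -> A `<=` I01 ->
  fine (leb2 (X `&` (A `*` I01))) = \int[leb]_(x in A) degree X x.
Proof.
move=> mX hX mA AI.
have mR : measurable (A `*` I01 : set R2).
  by apply: measurable_rect => //; exact: measurable_unit_itv.
rewrite area_degree /=; [|exact: measurableI|by move=> p [/hX]].
rewrite -[in RHS](setIidr AI) Rintegral_mkcondr; apply: eq_Rintegral => x _.
rewrite patchE; case: ifPn => [/set_mem xA|/negP xA]; rewrite /degree.
  congr (fine (leb _)); apply/seteqP; split=> y; rewrite /xsection /= => /set_mem.
    by move=> [h _]; apply/mem_set.
  by move=> h; apply/mem_set; split=> //; split=> //=; have [] := hX _ h.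
rewrite (_ : xsection _ x = set0) ?measure0 //; apply/seteqP; split=> // y.
by rewrite /xsection /= => /set_mem [_ [/= /mem_set]].
Qed.

Lemma area_setU0 (X Y : set R2) : measurable X -> measurable Y ->
  @leb2 R X = 0%E -> @leb2 R Y = 0%E -> @leb2 R (X `|` Y) = 0%E.
Proof.
move=> mX mY X0 Y0; apply/eqP; rewrite eq_le measure_ge0 andbT.
by apply: le_trans (measureU2 _ mX mY) _; rewrite [X in (X + _)%E]X0 [X in (_ + X)%E]Y0 adde0.
Qed.

Lemma representative_off (w : increasing01_classes R) p : unit_square p ->
  ~ (val (class_hull w) `\` (val (class_hull w))°) p ->
  representative w p = \1_(val (class_hull w)) p.
Proof.
by move=> hp hn; apply: increasing01_hull_off => //; have [] := representativeP w.
Qed.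

Section Rearranged.
Variables (w1 w2 : increasing01_classes R) (phi psi : R -> R).
Hypotheses (hphi : measure_preserving_bijection phi)
  (hpsi : measure_preserving_bijection psi).
Local Notation S1 := (val (class_hull w1)).
Local Notation S2 := (val (class_hull w2)).
Local Notation B2 := (rearrange phi psi @^-1` S2).
Local Notation U := (fun p => representative w1 p - representative w2 (phi p.1, psi p.2)).

Let hS1 : C S1. Proof. exact: set_valP. Qed.
Let hS2 : C S2. Proof. exact: set_valP. Qed.
Let mS1 : measurable (S1 : set R2). Proof. exact: increasing_closed_measurable. Qed.
Let mS2 : measurable (S2 : set R2). Proof. exact: increasing_closed_measurable. Qed.
Let sS1 : S1 `<=` @unit_square R. Proof. by move=> p; exact: increasing_closed_unit_square. Qed.
Let sS2 : S2 `<=` @unit_square R. Proof. by move=> p; exact: increasing_closed_unit_square. Qed.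
Let mB2 : measurable (B2 : set R2). Proof. exact: measurable_rearrange. Qed.
Let sB2 : B2 `<=` @unit_square R. Proof. exact: rearrange_sub. Qed.

(** The representatives may fail to be measurable, so they are replaced by indicators of hulls. They
    differ from these at most on the boundary of [S1] and on the rearranged boundary of [S2], both
    null. *)
Lemma Rintegral_cut (A B : set R1) : measurable A -> measurable B ->
  A `<=` I01 -> B `<=` I01 ->
  \int[@leb2 R]_(p in A `*` B) U p =
  fine (leb2 (S1 `&` (A `*` B))) - fine (leb2 (B2 `&` (A `*` B))).
Proof.
move=> mA mB AI BI.
have mAB := measurable_rect mA mB; have sAB := rect_sub AI BI.
rewrite -Rintegral_indicB //.
have [m1 a1] : measurable (S1 `\` S1° : set R2) /\ @leb2 R (S1 `\` S1°) = 0%E.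
  by split; [exact: measurable_boundary|exact: area_boundary].
have [m2 a2] : measurable (S2 `\` S2° : set R2) /\ @leb2 R (S2 `\` S2°) = 0%E.
  by split; [exact: measurable_boundary|exact: area_boundary].
have m2' := measurable_rearrange hphi hpsi m2.
have s2 : S2 `\` S2° `<=` @unit_square R by move=> p [/sS2].
have a2' : @leb2 R (rearrange phi psi @^-1` (S2 `\` S2°)) = 0%E.
  by rewrite area_rearrange.
rewrite /Rintegral; congr fine.
apply: (@integral_eq_off_null _ _ _ (leb \x leb)%E _
  ((S1 `\` S1°) `|` (rearrange phi psi @^-1` (S2 `\` S2°)))).
- exact: measurableU.
- exact: (area_setU0 m1 m2' a1 a2').
move=> p pAB hn; have hp := sAB _ pAB; congr EFin; congr (_ - _).
  by apply: representative_off => // h; apply: hn; left.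
have [Ip1 Ip2] := hp.
have [[fphi _ _] _ _] := hphi; have [[fpsi _ _] _ _] := hpsi.
have E : rearrange phi psi p = (phi p.1, psi p.2).
  by rewrite /rearrange !extend_outsideE.
rewrite representative_off; first by rewrite -E !indicE.
- by split; [exact: fphi|exact: fpsi].
- by move=> h; apply: hn; right; rewrite /preimage /= E.
Qed.

(** [sup] has a default value on unbounded sets, so this bound is what lets a single rectangle bound
    [cut_norm] from below. *)
Lemma cut_norm_ubound : ubound [set x | exists A B : set R1,
    [/\ measurable A, measurable B, A `<=` I01, B `<=` I01
      & x = `|\int[@leb2 R]_(p in A `*` B) U p|]] 1.
Proof.
move=> _ [A [B [mA mB AI BI ->]]]; rewrite Rintegral_cut //.
have mAB := measurable_rect mA mB; have sAB := rect_sub AI BI.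
have h X : measurable (X : set R2) -> X `<=` @unit_square R ->
    0 <= fine (leb2 (X `&` (A `*` B))) <= 1.
  move=> mX sX; have mI : measurable (X `&` (A `*` B) : set R2) by exact: measurableI.
  have sI : X `&` (A `*` B) `<=` @unit_square R by move=> p [/sX].
  by rewrite -!lee_fin -(area_fin mI sI) area_le1 // measure_ge0.
exact: ler_dist01 (h _ mS1 sS1) (h _ mB2 sB2).
Qed.

Lemma cut_norm_degree (A : set R1) : measurable A -> A `<=` I01 ->
  `|\int[leb]_(x in A) degree S1 x - \int[leb]_(x in A) degree B2 x| <= cut_norm U.
Proof.
move=> mA AI; apply: ub_le_sup; first by exists 1; exact: cut_norm_ubound.
have mI := @measurable_unit_itv R.
by exists A, I01; split => //; rewrite Rintegral_cut // !area_strip.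
Qed.

Let d1 := degree S1.
Let d2 := degree B2.

Let d01 x : 0 <= d1 x <= 1. Proof. exact: degree_ge0le1. Qed.
Let d02 x : 0 <= d2 x <= 1. Proof. exact: degree_ge0le1. Qed.
Let md1 : measurable_fun setT (d1 : R1 -> R1). Proof. exact: measurable_degree. Qed.
Let md2 : measurable_fun setT (d2 : R1 -> R1). Proof. exact: measurable_degree. Qed.

Let id1 (A : set R1) : measurable A -> A `<=` I01 -> leb.-integrable A (EFin \o d1).
Proof.
move=> mA AI; apply: (integrableS _ mA AI); first exact: measurable_unit_itv.
apply: (@bounded_integrable01 _ _ 1); first exact: measurable_funTS.
by move=> x _; have /andP[? ?] := d01 x; rewrite ger0_norm.
Qed.

Let id2 (A : set R1) : measurable A -> A `<=` I01 -> leb.-integrable A (EFin \o d2).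
Proof.
move=> mA AI; apply: (integrableS _ mA AI); first exact: measurable_unit_itv.
apply: (@bounded_integrable01 _ _ 1); first exact: measurable_funTS.
by move=> x _; have /andP[? ?] := d02 x; rewrite ger0_norm.
Qed.

(** The interval is split by the sign of the difference of the degrees. On each piece [A] the
    integral is that of the kernel over the strip [A * [0, 1]], up to sign, hence at most the cut
    norm. *)
Lemma Rintegral_degree_dist :
  \int[leb]_(x in I01) `|degree S1 x - degree B2 x| <= cut_norm U + cut_norm U.
Proof.
have mI := @measurable_unit_itv R.
pose A : set R1 := I01 `&` [set x | d2 x <= d1 x].
have mA : measurable A.
  rewrite /A (_ : [set x | _] = (fun x => d1 x - d2 x) @^-1` `[0, +oo[%classic).
    by apply: (measurable_funB (measurable_funTS md1) (measurable_funTS md2)) => //;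
      exact: measurable_itv.
  by apply/seteqP; split=> x /=; rewrite in_itv /= andbT subr_ge0.
have AI : A `<=` I01 by move=> x [].
have mA' : measurable (I01 `\` A) by exact: measurableD.
have AI' : I01 `\` A `<=` I01 by move=> x [].
have E : I01 = A `|` (I01 `\` A) by exact: setU_setD.
rewrite [in leLHS]E Rintegral_setU //; last 2 first.
- rewrite -E; apply: (@bounded_integrable01 _ _ 1).
    apply: measurableT_comp => //.
    by apply: measurable_funB; exact: measurable_funTS.
  by move=> x _; rewrite normr_id; exact: ler_dist01.
- by rewrite disj_set2E setDIK.
apply: lerD.
  have -> : \int[leb]_(x in A) `|d1 x - d2 x| = \int[leb]_(x in A) (d1 x - d2 x).
    by apply: eq_Rintegral => x /set_mem [_ /= h]; rewrite ger0_norm ?subr_ge0.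
  rewrite RintegralB //; [|exact: id1|exact: id2].
  by apply: le_trans (ler_norm _) _; exact: cut_norm_degree.
have -> : \int[leb]_(x in I01 `\` A) `|d1 x - d2 x| =
    \int[leb]_(x in I01 `\` A) (d2 x - d1 x).
  apply: eq_Rintegral => x /set_mem [Ix nA]; rewrite distrC ger0_norm // subr_ge0 leNgt.
  by apply/negP => /ltW h; apply: nA.
rewrite RintegralB //; [|exact: id2|exact: id1].
by apply: le_trans (ler_norm _) _; rewrite distrC; exact: cut_norm_degree.
Qed.

Lemma normr_exprB (x y : R) n : 0 <= x <= 1 -> 0 <= y <= 1 ->
  `|x ^+ n - y ^+ n| <= n%:R * `|x - y|.
Proof.
move=> /andP[x0 x1] /andP[y0 y1]; elim: n => [|n IH].
  by rewrite !expr0 subrr normr0 mul0r.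
rewrite !exprS (_ : x * x ^+ n - y * y ^+ n = x * (x ^+ n - y ^+ n) + (x - y) * y ^+ n); last by ring.
rewrite (le_trans (ler_normD _ _)) // !normrM -natr1 mulrDl mul1r; apply: lerD.
  apply: le_trans IH; rewrite ler_piMl // ger0_norm //.
by rewrite ler_piMr // ger0_norm ?exprn_ge0 // exprn_ile1.
Qed.

(** Rearranging [S2] into [B2] leaves its moments unchanged, and the [k]-th power is [k]-Lipschitz
    on the unit interval. *)
Lemma cut_norm_moment k :
  `|\int[leb]_(x in I01) (degree S1 x ^+ k) - \int[leb]_(x in I01) (degree S2 x ^+ k)|
  <= k%:R * (cut_norm U + cut_norm U).
Proof.
have mI := @measurable_unit_itv R.
have E : \int[leb]_(x in I01) (degree S2 x ^+ k) = \int[leb]_(x in I01) (degree B2 x ^+ k).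
  under [RHS]eq_Rintegral do rewrite degree_rearrange //.
  symmetry; apply: (@Rintegral_extend_outside _ _ hphi (fun x => degree S2 x ^+ k) 1).
    by apply: measurable_funX; exact: measurable_degree.
  by move=> s _; apply: normr_exprn_le1; exact: degree_ge0le1.
have ie (f : R -> R) : measurable_fun setT (f : R1 -> R1) -> (forall x, 0 <= f x <= 1) ->
    leb.-integrable I01 (EFin \o (fun x => f x ^+ k)).
  move=> mf f01; apply: (@bounded_integrable01 _ _ 1).
    by apply: measurable_funTS; exact: measurable_funX.
  by move=> x _; exact: normr_exprn_le1.
have i1 := ie _ md1 d01; have i2 := ie _ md2 d02.
have iB : leb.-integrable I01 (EFin \o (fun x => d1 x - d2 x)).
  by have := integrableB mI (id1 mI (@subset_refl _ _)) (id2 mI (@subset_refl _ _)).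
rewrite E -(RintegralB mI i1 i2).
apply: le_trans (le_normr_Rintegral mI (integrableB mI i1 i2)) _.
apply: (@le_trans _ _ (\int[leb]_(x in I01) (k%:R * `|d1 x - d2 x|))); last first.
  rewrite (RintegralZl _ mI); last exact: (integrable_norm iB).
  exact: (ler_wpM2l (ler0n _ k) Rintegral_degree_dist).
apply: (le_Rintegral mI).
- exact: (integrable_norm (integrableB mI i1 i2)).
- exact: (integrableZl mI k%:R (integrable_norm iB)).
- by move=> x _; exact: normr_exprB.
Qed.

End Rearranged.
End CutNorm.

(** * Comparison of [levy] with area, integral and cut distances *)

Section LevyAndMetrics.
Variable R : realType.
Local Notation leb := (@lebesgue_measure R).
Local Notation I01 := (@unit_itv R).
Local Notation C := (increasing_closed_sets R).
Local Notation R2 := (measurableTypeR R * measurableTypeR R)%type.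
Implicit Types (S T : C) (w : increasing01_classes R) (p q : R * R).

Let increasing_closed_setP S : C (val S). Proof. exact: set_valP. Qed.
Let mC S : measurable (val S : set R2). Proof. exact: increasing_closed_set_measurable. Qed.
Let sC S : val S `<=` @unit_square R. Proof. exact: increasing_closed_set_sub. Qed.

Lemma area_symdiff (X Y : set (R * R)) : C X -> C Y ->
  fine (@leb2 R (X `+` Y)) =
  graphon_density (star 0) \1_(X `|` Y) - graphon_density (star 0) \1_(X `&` Y).
Proof.
move=> hX hY.
have hU := increasing_closedU hX hY; have hI := increasing_closedI hX hY.
have mU := increasing_closed_measurable hU; have mI := increasing_closed_measurable hI.
have sU : X `|` Y `<=` @unit_square R by move=> p; exact: increasing_closed_unit_square.
have sI : X `&` Y `<=` @unit_square R by move=> p; exact: increasing_closed_unit_square.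
have -> : X `+` Y = (X `|` Y) `\` (X `&` Y).
  apply/seteqP; split=> p; rewrite /setY /=.
    by move=> [[h1 h2]|[h1 h2]]; split; [left|move=> []|right|move=> []].
  by move=> [[h|h] n]; [left|right]; split=> // h'; apply: n.
have IU : X `&` Y `<=` X `|` Y by move=> p [h _]; left.
rewrite [X in fine X]measureD //; last by rewrite [ltLHS](area_star mU sU) ltry.
by rewrite setIidr // [X in fine (X - _)](area_star mU sU) [X in fine (_ - X)](area_star mI sI).
Qed.

(** The 2 counts the vertices of the single edge [star 0], whose densities in union and intersection
    are compared. *)
Lemma measure_dist_levy S T e : 0 <= e -> levy e (val S) (val T) ->
  fine (@leb2 R (val S `+` val T)) <= 2 * e.
Proof.
move=> e0 h; rewrite area_symdiff //.
apply: le_trans (ler_norm _) _.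
have hS := increasing_closed_setP S; have hT := increasing_closed_setP T.
exact: (levy_graphon_density (star 0) (increasing_closedU hS hT)
  (increasing_closedI hS hT) e0 (levyUI hS hT e0 h)).
Qed.

Lemma measurable_symdiff (X Y : set R2) : measurable X -> measurable Y ->
  measurable (X `+` Y).
Proof. by move=> mX mY; apply: measurableU; exact: measurableD. Qed.

Lemma symdiff_sub (X Y : set (R * R)) : X `<=` @unit_square R ->
  Y `<=` @unit_square R -> X `+` Y `<=` @unit_square R.
Proof. by move=> sX sY p [[/sX]|[/sY]]. Qed.

Lemma L1_distE w1 w2 : L1_dist w1 w2 =
  fine (@leb2 R (val (class_hull w1) `+` val (class_hull w2))).
Proof.
set S1 := val (class_hull w1); set S2 := val (class_hull w2).
have mS1 : measurable (S1 : set R2) := mC _; have mS2 : measurable (S2 : set R2) := mC _.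
have m1 := measurable_boundary (increasing_closed_setP (class_hull w1)).
have m2 := measurable_boundary (increasing_closed_setP (class_hull w2)).
have a1 := area_boundary (increasing_closed_setP (class_hull w1)).
have a2 := area_boundary (increasing_closed_setP (class_hull w2)).
have mY := measurable_symdiff mS1 mS2.
have sY := symdiff_sub (@sC (class_hull w1)) (@sC (class_hull w2)).
rewrite /L1_dist /Rintegral; congr fine.
transitivity (\int[(leb \x leb)%E]_(p in @unit_square R) (\1_(S1 `+` S2) p)%:E)%E.
  apply: (@integral_eq_off_null _ _ _ (leb \x leb)%E _ ((S1 `\` S1°) `|` (S2 `\` S2°))).
  - exact: measurableU.
  - exact: (area_setU0 m1 m2 a1 a2).
  move=> p hp hn; congr EFin.
  rewrite !representative_off //; last 2 first.
  - by move=> h; apply: hn; right.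
  - by move=> h; apply: hn; left.
  rewrite -/S1 -/S2 !indicE.
  have -> : (p \in S1 `+` S2) = (p \in S1) (+) (p \in S2).
    apply/idP/idP => [/set_mem [[h1 h2]|[h1 h2]]|].
    + by rewrite (mem_set h1) (memNset h2).
    + by rewrite (mem_set h1) (memNset h2).
    + case: (boolP (p \in S1)) => [/set_mem h1|/negP h1] /=;
      case: (boolP (p \in S2)) => [/set_mem h2|/negP h2] //= _; apply/mem_set.
        by left; split=> // h; apply: h2; exact/mem_set.
      by right; split=> // h; apply: h1; exact/mem_set.
  by case: (p \in S1); case: (p \in S2); rewrite /= ?subrr ?subr0 ?sub0r ?normr0 ?normrN ?normr1.
rewrite integral_indic //; last exact: measurable_unit_square.
by rewrite setIidl.
Qed.

Lemma measure_preserving_bijection_id : measure_preserving_bijection (@id R).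
Proof.
split; first by split=> //; move=> x Ix; exists x.
  exact: measurable_id.
by move=> A mA AI; rewrite preimage_id setIidr.
Qed.

Lemma rearrange_id (X : set (R * R)) : X `<=` @unit_square R ->
  rearrange id id @^-1` X = X.
Proof.
have idP := measure_preserving_bijection_id.
move=> sX; apply/seteqP; split=> p /= hp.
  have [/= /(extend_outside_unit idP) h1 /(extend_outside_unit idP) h2] := sX _ hp.
  by move: hp; rewrite /rearrange !extend_outsideE // -surjective_pairing.
have [h1 h2] := sX _ hp.
by rewrite /preimage /= /rearrange !extend_outsideE // -surjective_pairing.
Qed.

Lemma cut_norm_ge0 w1 w2 phi psi : measure_preserving_bijection phi ->
  measure_preserving_bijection psi ->
  0 <= cut_norm (fun p => representative w1 p - representative w2 (phi p.1, psi p.2)).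
Proof.
move=> hphi hpsi; apply: le_trans (cut_norm_degree w1 w2 hphi hpsi measurable0 (@sub0set _ _)).
exact: normr_ge0.
Qed.

Lemma ler_dist_of (a b c : R) : a <= b + c -> b <= a + c -> `|a - b| <= c.
Proof. by move=> ? ?; rewrite ler_norml; apply/andP; split; lra. Qed.

(** Without rearrangement, the two sets meet any rectangle in areas that differ by at most the area
    of the symmetric difference. *)
Lemma cut_dist_le w1 w2 : cut_dist w1 w2 <=
  fine (@leb2 R (val (class_hull w1) `+` val (class_hull w2))).
Proof.
have idP := measure_preserving_bijection_id.
set S1 := val (class_hull w1); set S2 := val (class_hull w2).
have mS1 : measurable (S1 : set R2) := mC _; have mS2 : measurable (S2 : set R2) := mC _.
have sS1 := @sC (class_hull w1); have sS2 := @sC (class_hull w2).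
have mY := measurable_symdiff mS1 mS2.
have sY := symdiff_sub sS1 sS2.
apply: (@le_trans _ _ (cut_norm (fun p => representative w1 p - representative w2 (p.1, p.2)))).
  apply: ge_inf; last by exists id, id.
  by exists 0 => _ [phi [psi [hphi hpsi ->]]]; exact: cut_norm_ge0.
apply: ge_sup.
  by exists `|\int[@leb2 R]_(p in set0 `*` set0) (representative w1 p - representative w2 (p.1, p.2))|;
    exists set0, set0; split.
move=> _ [A [B [mA mB AI BI ->]]].
rewrite (Rintegral_cut w1 w2 idP idP mA mB AI BI) rearrange_id //.
have mAB := measurable_rect mA mB; have sAB := rect_sub AI BI.
have le (X Z : set (R * R)) : measurable (X : set R2) -> measurable (Z : set R2) ->
    X `<=` @unit_square R -> Z `<=` @unit_square R ->
    fine (@leb2 R (X `&` (A `*` B))) <=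
    fine (@leb2 R (Z `&` (A `*` B))) + fine (@leb2 R (X `+` Z)).
  move=> mX mZ sX sZ.
  have mXZ := measurable_symdiff mX mZ; have sXZ := symdiff_sub sX sZ.
  have mX' : measurable (X `&` (A `*` B) : set R2) by exact: measurableI.
  have mZ' : measurable (Z `&` (A `*` B) : set R2) by exact: measurableI.
  rewrite -lee_fin EFinD -(area_fin mX') -?(area_fin mZ') -?(area_fin mXZ sXZ); last 2 first.
  - by move=> p [/sZ].
  - by move=> p [/sX].
  apply: le_trans (measureU2 (leb \x leb)%E mZ' mXZ).
  apply: le_measure; rewrite ?inE //; first exact: measurableU.
  move=> p [Xp Dp]; have [Zp|nZp] := pselect (Z p); first by left.
  by right; left.
have h1 := le _ _ mS1 mS2 sS1 sS2; have h2 := le _ _ mS2 mS1 sS2 sS1.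
rewrite [S2 `+` S1]setYC in h2.
exact: ler_dist_of h1 h2.
Qed.

Lemma moment_degree_law S k : \int[val (degree_law S)]_(s in I01) (s ^+ k) =
  \int[leb]_(x in I01) (degree (val S) x ^+ k).
Proof.
apply: (@Rintegral_degree_law _ S (fun s => s ^+ k) 1).
  exact: exprn_measurable.
by move=> s /unit_itvP; exact: normr_exprn_le1.
Qed.

(** Through [degree_lawK], convergence of degree moments of sets becomes convergence of moments of
    their laws, and the conclusion for the laws is one for the sets. *)
Lemma levy_of_moments (X : Type) (F : set_system X) (FF : Filter F) (c : X -> C) S :
  (forall k, \int[leb]_(x in I01) (degree (val (c t)) x ^+ k.+1) @[t --> F] -->
     \int[leb]_(x in I01) (degree (val S) x ^+ k.+1)) ->
  forall e, 0 < e -> \forall t \near F, levy e (val S) (val (c t)).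
Proof.
move=> h e e0.
have h' k : \int[val (degree_law (c t))]_(s in I01) (s ^+ k.+1) @[t --> F] -->
    \int[val (degree_law S)]_(s in I01) (s ^+ k.+1).
  by rewrite moment_degree_law; under eq_fun do rewrite moment_degree_law; exact: h.
have := cvg_moments_levy FF h' e0; apply: filterS => t.
have E T : S_ (degree_law T) = val T by rewrite -[in RHS](degree_lawK T).
by rewrite !E.
Qed.

(** The balls of [cut_dist] around [w] generate a filter, whether or not a triangle inequality is at
    hand. The degree moments converge along it, and the radius [k] is extracted from the resulting
    member of the filter. *)
Lemma cut_dist_levy w e : 0 < e -> exists2 k, 0 < k &
  forall w', cut_dist w w' < k -> levy e (val (class_hull w)) (val (class_hull w')).
Proof.
move=> e0.
pose F : set_system (increasing01_classes R) :=
  filter_from [set k : R | 0 < k] (fun k => [set w' | cut_dist w w' < k]).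
have FF : Filter F.
  apply: filter_from_filter; first by exists 1 => /=.
  move=> i j /= i0 j0; exists (Num.min i j); first by rewrite /= lt_min i0.
  by move=> w'; rewrite /= lt_min => /andP[].
suff [k k0 hk] : F [set w' | levy e (val (class_hull w)) (val (class_hull w'))].
  by exists k.
apply: (levy_of_moments FF) e0 => k; apply/cvgrPdist_lt => d d0.
(* [cut_norm_moment] at exponent [k + 1] loses the factor [2 (k + 1)]. *)
exists (d / (k.+1%:R * 2)); first by rewrite /= divr_gt0 // mulr_gt0.
move=> w' /= hw'.
have [x [phi [psi [hphi hpsi ->]]] hx] : exists2 y, [set x | exists phi psi : R -> R,
    [/\ measure_preserving_bijection phi, measure_preserving_bijection psi
      & x = cut_norm (fun p =>
          representative w p - representative w' (phi p.1, psi p.2))]] y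
    & y < d / (k.+1%:R * 2).
  apply: inf_lt => //.
  exists (cut_norm (fun p => representative w p - representative w' (id p.1, id p.2))).
  by exists id, id; split=> //; exact: measure_preserving_bijection_id.
apply: le_lt_trans (cut_norm_moment w w' hphi hpsi k.+1) _.
move: hx; set u := cut_norm _ => hx.
have -> : k.+1%:R * (u + u) = u * (k.+1%:R * 2) by ring.
by rewrite -ltr_pdivlMr // mulr_gt0.
Qed.

Lemma measure_dist_levy_inv S e : 0 < e -> exists2 k, 0 < k &
  forall T, fine (@leb2 R (val S `+` val T)) < k -> levy e (val S) (val T).
Proof.
move=> e0; have [k k0 hk] := cut_dist_levy (indic_class S) e0.
exists k => // T hT; have := hk (indic_class T); rewrite !indic_classK; apply.
by apply: le_lt_trans hT; have := cut_dist_le (indic_class S) (indic_class T); rewrite !indic_classK.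
Qed.

End LevyAndMetrics.

(** * Threshold graphs as step functions *)

Section StepFunctions.
Variable R : realType.
Local Notation leb := (@lebesgue_measure R).
Local Notation I01 := (@unit_itv R).
Local Notation R1 := (measurableTypeR R).

Lemma Rintegral01_sum n (f : 'I_n -> R -> R) :
  (forall i, leb.-integrable I01 (EFin \o f i)) ->
  \int[leb]_(x in I01) (\sum_(i < n) f i x) = \sum_(i < n) \int[leb]_(x in I01) f i x.
Proof.
have mI := @measurable_unit_itv R; move=> fi.
suff : leb.-integrable I01 (EFin \o (fun x => \sum_(i < n) f i x)) /\
  \int[leb]_(x in I01) (\sum_(i < n) f i x) = \sum_(i < n) \int[leb]_(x in I01) f i x.
  by case.
elim: n f fi => [|n IH] f fi.
  split; last by under eq_Rintegral do rewrite big_ord0; rewrite Rintegral01_cst big_ord0.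
  rewrite (_ : (fun x => _) = cst 0); last by apply/funext => x; rewrite big_ord0.
  by apply: (@bounded_integrable01 _ _ 0) => // x _; rewrite normr0.
have [h1 h2] := IH (fun i => f (widen_ord (leqnSn n) i)) (fun i => fi _).
split.
  have := integrableD mI h1 (fi ord_max); apply: eq_integrable => // x _ /=.
  by rewrite big_ord_recr /= EFinD.
under eq_Rintegral do rewrite big_ord_recr /=.
by rewrite (RintegralD mI h1 (fi ord_max)) h2 [RHS]big_ord_recr.
Qed.

(** The index of the cell of length [1 / v] that contains [x]; on the unit interval the cap at
    [v - 1] acts only at 1. *)
Definition step_index v (v0 : (0 < v)%N) (x : R) : 'I_v :=
  Ordinal (eq_ind _ (fun k => (minn (Num.truncn (x * v%:R)) v.-1 < k)%N)
    (geq_minr _ _ : (_ < v.-1.+1)%N) v (prednK v0)).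

Lemma step_indexE v (v0 : (0 < v)%N) (x : R) (i : 'I_v) : 0 < x < 1 ->
  (step_index v0 x == i) = (i%:R / v%:R <= x < i.+1%:R / v%:R).
Proof.
move=> /andP[x0 x1]; have vR : 0 < v%:R :> R by rewrite ltr0n.
have xv0 : 0 <= x * v%:R by rewrite mulr_ge0 // ltW.
rewrite ler_pdivrMr // ltr_pdivlMr // -val_eqE /=.
have tv : (Num.truncn (x * v%:R) <= v.-1)%N.
  rewrite -ltnS prednK // -(ltr_nat R); have /andP[h _] := truncn_itv xv0.
  by apply: le_lt_trans h _; rewrite gtr_pMl.
rewrite (minn_idPl tv); apply/eqP/idP => [<-|]; first exact: truncn_itv.
by move=> h; apply: truncn_def.
Qed.

(** The index of a uniform point is uniformly distributed. In this form the property survives a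
    permutation of the vertices and can be used one variable at a time. *)
Definition uniform_index v (st : R -> 'I_v) : Prop := forall g : 'I_v -> R,
  \int[leb]_(x in I01) g (st x) = v%:R^-1 * \sum_i g i.

Lemma uniform_step_index v (v0 : (0 < v)%N) : uniform_index (step_index v0).
Proof.
move=> g; have vR : 0 < v%:R :> R by rewrite ltr0n.
pose A (i : 'I_v) : set R1 := `[i%:R / v%:R, i.+1%:R / v%:R[%classic.
have mA i : measurable (A i) by exact: measurable_itv.
have AP i y : A i y = (i%:R / v%:R <= y < i.+1%:R / v%:R :> Prop).
  by rewrite /A /= in_itv.
have fi i : leb.-integrable I01 (EFin \o (fun x => g i * \1_(A i) x)).
  apply: (@bounded_integrable01 _ _ `|g i|).
    by apply: measurable_funM; [exact: measurable_cst|apply: measurable_indic; exact: mA].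
  move=> x _; rewrite normrM indicE; case: (_ \in _); rewrite ?normr1 ?normr0 ?mulr1 ?mulr0 //.
have E x : 0 < x < 1 -> g (step_index v0 x) = \sum_(i < v) g i * \1_(A i) x.
  move=> hx; rewrite (bigD1 (step_index v0 x)) //= big1 ?addr0 => [|i].
    have Ax : A (step_index v0 x) x by rewrite AP -(step_indexE v0 _ hx).
    by rewrite indicE (mem_set Ax) mulr1.
  move=> ni; have nA : ~ A i x.
    by rewrite AP -(step_indexE v0 _ hx) => /eqP E; rewrite E eqxx in ni.
  by rewrite indicE (memNset nA) mulr0.
transitivity (\int[leb]_(x in I01) (\sum_(i < v) g i * \1_(A i) x)).
  rewrite /Rintegral; congr fine.
  (* The half-open cells [A i] miss 1, which [step_index] puts into the last cell; [step_indexE] is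
     stated for interior points only. *)
  apply: (@integral_eq_off_null _ _ _ leb _ ([set 0] `|` [set 1])).
  - exact: measurableU.
  - apply/eqP; rewrite eq_le measure_ge0 andbT.
    apply: le_trans (measureU2 _ _ _) _ => //.
    by rewrite [X in (X + _)%E]lebesgue_measure_set1 [X in (_ + X)%E]lebesgue_measure_set1 adde0.
  - move=> x /unit_itvP /andP[x0 x1] hx; congr EFin; apply: E.
    rewrite !lt_neqAle x0 x1 !andbT; apply/andP; split; apply/eqP => h; apply: hx;
      by [left|right].
rewrite Rintegral01_sum // mulr_sumr; apply: eq_bigr => i _.
rewrite RintegralZl; first last.
- apply: (@bounded_integrable01 _ _ 1); first by apply: measurable_indic; exact: mA.
  by move=> x _; rewrite indicE; case: (_ \in _); rewrite ?normr1 ?normr0.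
- exact: measurable_unit_itv.
rewrite /Rintegral integral_indic //; last exact: measurable_unit_itv.
rewrite setIidl; last first.
  move=> x; rewrite /A /= in_itv /= => /andP[h1 h2]; apply/unit_itvP.
  rewrite (le_trans _ h1) ?divr_ge0 ?ler0n //= (le_trans (ltW h2)) //.
  by rewrite ler_pdivrMr // mul1r ler_nat.
rewrite [X in fine X]lebesgue_measure_itv /= lte_fin ltr_pM2r ?invr_gt0 // ltr_nat ltnSn.
by rewrite -EFinB /= -mulrBl -natrB // subSnn mul1r mulrC.
Qed.

Lemma uniform_index_bij v (st : R -> 'I_v) (s : 'I_v -> 'I_v) : uniform_index st ->
  bijective s -> uniform_index (s \o st).
Proof.
by move=> ust [s' sK s'K] g; rewrite [LHS](ust (g \o s)) [in RHS](reindex s) //; exists s' => i _.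
Qed.

Lemma cube_integral_step v (st : R -> 'I_v) n (h : n.-tuple 'I_v -> R) :
  uniform_index st ->
  cube_integral (fun t : n.-tuple R => h [tuple of map st t]) =
  (v%:R ^+ n)^-1 * \sum_u h u.
Proof.
move=> ust; elim: n h => [|n IH] h.
  rewrite expr0 invr1 mul1r /= (bigD1 [tuple]) //= big1 ?addr0 => [|u].
    by congr h; apply: val_inj.
  by case/eqP; exact: tuple0.
transitivity (\int[leb]_(x in I01)
    ((v%:R ^+ n)^-1 * \sum_(u : n.-tuple 'I_v) h [tuple of st x :: u])).
  apply: eq_Rintegral => x _.
  rewrite -(IH (fun u : n.-tuple 'I_v => h [tuple of st x :: u])).
  by congr cube_integral; apply/funext => t; congr h; apply: val_inj.
rewrite (ust (fun i => (v%:R ^+ n)^-1 * \sum_(u : n.-tuple 'I_v) h [tuple of i :: u])).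
rewrite -mulr_sumr mulrA -invfM -exprS; congr (_ * _).
rewrite pair_bigA /= (reindex (fun p : 'I_v * n.-tuple 'I_v => [tuple of p.1 :: p.2])) //.
exists (fun t : n.+1.-tuple 'I_v => (thead t, [tuple of behead t])).
  by move=> [i u] _ /=; rewrite theadE; congr pair; apply: val_inj.
by move=> t _; rewrite -tuple_eta.
Qed.

Definition edge_indicator (G : bigraph) (p : 'I_(v1 G) * 'I_(v2 G)) : R :=
  (p \in edges G)%:R.

Lemma prod_nat_of_bool (I : finType) (A : {set I}) (b : I -> bool) :
  \prod_(e in A) (b e)%:R = [forall e in A, b e]%:R :> R.
Proof.
case: (boolP [forall e in A, b e]) => [/forall_inP h|].
  by rewrite big1 // => e /h ->.
rewrite negb_forall_in => /exists_inP[e eA /negbTE be].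
by rewrite (bigD1 e) //= be mul0r.
Qed.

Lemma sum_tuple_ffun a v (h : {ffun 'I_a -> 'I_v} -> R) :
  \sum_(f : {ffun 'I_a -> 'I_v}) h f =
  \sum_(u : a.-tuple 'I_v) h [ffun i => tnth u i].
Proof.
rewrite (reindex (fun u : a.-tuple 'I_v => [ffun i => tnth u i])) //.
exists (fun f : {ffun 'I_a -> 'I_v} => [tuple f i | i < a]).
  by move=> u _; apply: eq_from_tnth => i; rewrite tnth_mktuple ffunE.
by move=> f _; apply/ffunP => i; rewrite ffunE tnth_mktuple.
Qed.

(** Independent uniform points yield independent uniform vertices, so both sides average the same
    product of edge indicators. The freedom in [st1] and [st2] allows the vertices of [G] to be
    listed in any order. *)
Lemma hom_density_step (F G : bigraph) (st1 : R -> 'I_(v1 G)) (st2 : R -> 'I_(v2 G)) :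
  uniform_index st1 -> uniform_index st2 ->
  hom_density R F G =
  graphon_density F (fun p => edge_indicator (st1 p.1, st2 p.2)).
Proof.
move=> u1 u2; symmetry.
pose h (u : (v1 F).-tuple 'I_(v1 G)) (u' : (v2 F).-tuple 'I_(v2 G)) : R :=
  \prod_(e in edges F) edge_indicator (tnth u e.1, tnth u' e.2).
transitivity (cube_integral (fun x : (v1 F).-tuple R =>
    ((v2 G)%:R ^+ v2 F)^-1 * \sum_u' h [tuple of map st1 x] u')).
  congr cube_integral; apply/funext => x; rewrite -(cube_integral_step _ u2).
  congr cube_integral; apply/funext => y; apply: eq_bigr => e _.
  by rewrite !tnth_map.
rewrite (cube_integral_step (fun u => ((v2 G)%:R ^+ v2 F)^-1 * \sum_u' h u u') u1).
rewrite -mulr_sumr mulrA -invfM /hom_density mulrC; congr (_ / _); last first.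
  by rewrite card_prod !card_ffun !card_ord natrM !natrX mulrC.
symmetry; transitivity (\sum_(f1 : {ffun 'I_(v1 F) -> 'I_(v1 G)})
    \sum_(f2 : {ffun 'I_(v2 F) -> 'I_(v2 G)})
      ([forall e in edges F, (f1 e.1, f2 e.2) \in edges G]%:R : R)).
  rewrite pair_bigA /= -sum1_card natr_sum big_mkcond; apply: eq_bigr => f _.
  case: ifPn => [/set_mem /= -> //|/negP h']; case: (boolP [forall e in edges F, _]) => // h''.
  by case: h'; exact/mem_set.
rewrite sum_tuple_ffun; apply: eq_bigr => u _.
rewrite sum_tuple_ffun; apply: eq_bigr => u' _.
rewrite /h prod_nat_of_bool; congr (nat_of_bool _)%:R.
by apply: eq_forallb => e; rewrite !ffunE.
Qed.

Lemma sorting_bij v (w : 'I_v -> R) : exists2 s : 'I_v -> 'I_v, bijective s &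
  forall i j : 'I_v, (i <= j)%N -> w (s i) <= w (s j).
Proof.
pose r := relpre w (fun x y : R => x <= y).
pose l := sort r (enum 'I_v).
have sl : size l = v by rewrite size_sort size_enum_ord.
have ul : uniq l by rewrite sort_uniq enum_uniq.
pose s (i : 'I_v) := nth i l i.
have sE (i0 i : 'I_v) : s i = nth i0 l i by apply: set_nth_default; rewrite sl.
exists s.
  apply: injF_bij => i j; rewrite (sE i j) /s => /eqP.
  by rewrite nth_uniq ?sl // => /eqP /val_inj.
move=> i j ij; rewrite (sE i j) /s.
have rtr : transitive r by move=> y x z; exact: le_trans.
have rrefl : reflexive r by move=> x; rewrite /r /= lexx.
have rtot : total r by move=> x y; exact: le_total.
by apply: (sorted_leq_nth rtr rrefl i (sort_sorted rtot _)); rewrite ?inE ?sl.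
Qed.

Lemma step_index_le v (v0 : (0 < v)%N) x y : 0 <= x -> x <= y ->
  (step_index v0 x <= step_index v0 y)%N.
Proof.
move=> x0 xy /=; rewrite leq_min geq_minr andbT geq_min; apply/orP; left.
by apply: le_truncn; rewrite ler_wpM2r.
Qed.

(** With both parts sorted by weight, moving up or right can only increase the sum of weights, so
    the step function of [G] is increasing and may be replaced by its hull. *)
Lemma threshold_graph_set (G : bigraph) : threshold_graph R G ->
  exists S : increasing_closed_sets R, forall F,
    hom_density R F G = graphon_density F \1_(val S).
Proof.
move=> [a1 [a2 [t hE]]].
have [s1 bs1 ms1] := sorting_bij a1; have [s2 bs2 ms2] := sorting_bij a2.
pose st1 := s1 \o step_index (v1_gt0 G); pose st2 := s2 \o step_index (v2_gt0 G).
pose W (p : R * R) : R := edge_indicator (st1 p.1, st2 p.2).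
have iW : increasing01 W.
  split=> [p _|p q hp hq pq1 pq2]; rewrite /W /edge_indicator.
    by case: (_ \in _); [right|left].
  rewrite ler_nat; case: (boolP ((st1 p.1, st2 p.2) \in edges G)) => // Ep.
  rewrite lt0b hE; rewrite hE in Ep; apply: lt_le_trans Ep _.
  have /unit_squareP[? ? ? ?] := hp.
  by apply: lerD; [apply: ms1|apply: ms2]; exact: step_index_le.
exists (SigSub (mem_set (hull_increasing_closed iW))) => F /=.
rewrite -graphon_density_hull //; apply: hom_density_step.
  exact: uniform_index_bij (uniform_step_index _) bs1.
exact: uniform_index_bij (uniform_step_index _) bs2.
Qed.

(** Rounding up to the grid. An increasing set is thereby known, up to a shift by [1 / N], from its
    trace on finitely many points; both compactness and the Fell topology rest on this. *)
Lemma grid_point (N : nat) (p : R * R) : (0 < N)%N -> unit_square p ->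
  exists i j : 'I_N.+1, let q : R * R := (i%:R / N%:R, j%:R / N%:R) in
  [/\ unit_square q, p.1 <= q.1, p.2 <= q.2, q.1 <= (shift N%:R^-1 p).1
    & q.2 <= (shift N%:R^-1 p).2].
Proof.
move=> N0; have NR : 0 < N%:R :> R by rewrite ltr0n.
have h (x : R) : 0 <= x <= 1 -> exists i : 'I_N.+1,
    [/\ 0 <= i%:R / N%:R :> R, (i%:R / N%:R : R) <= 1, x <= i%:R / N%:R
      & i%:R / N%:R <= Num.min (x + N%:R^-1) 1].
  move=> /andP[x0 x1].
  have xN0 : 0 <= x * N%:R by rewrite mulr_ge0 // ltW.
  have /andP[t1 t2] := truncn_itv xN0.
  (* Integer part plus one, capped at [N] so that [x = 1] is sent to the last grid point. *)
  exists (Ordinal (geq_minr (Num.truncn (x * N%:R)).+1 N : (_ < N.+1)%N)) => /=.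
  have iN : (minn (Num.truncn (x * N%:R)).+1 N)%:R / N%:R <= 1 :> R.
    by rewrite ler_pdivrMr // mul1r ler_nat geq_minr.
  split=> //.
    rewrite ler_pdivlMr //; have [_|_] := leqP (Num.truncn (x * N%:R)).+1 N; first exact: ltW.
    by rewrite ler_piMl // ltW.
  rewrite le_min iN andbT ler_pdivrMr // mulrDl mulVf ?gt_eqF //.
  apply: (@le_trans _ _ (Num.truncn (x * N%:R)).+1%:R); first by rewrite ler_nat geq_minl.
  by rewrite -natr1 lerD2r.
move=> /unit_squareP[p10 p11 p20 p21].
have [|i [i1 i2 i3 i4]] := h p.1; first by rewrite p10.
have [|j [j1 j2 j3 j4]] := h p.2; first by rewrite p20.
by exists i, j => /=; split=> //; apply/unit_squareP.
Qed.

Lemma inv_natr_small (e : R) : 0 < e ->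
  exists2 N, (0 < N)%N & N%:R^-1 + N%:R^-1 <= e.
Proof.
move=> e0; exists (Num.truncn (2 / e)).+1 => //; set N := _.+1.
have NR : 0 < N%:R :> R by rewrite ltr0n.
have -> : N%:R^-1 + N%:R^-1 = 2 / N%:R :> R by rewrite mulrDl mul1r.
rewrite ler_pdivrMr // mulrC -ler_pdivrMr //; apply: ltW; exact: truncnS_gt.
Qed.

(** Compactness of the family. The limit consists of the points whose every positive shift lies in
    almost all [S n]; asking for all shifts makes it closed. *)
Lemma levy_ultra (F : set_system nat) (S : nat -> increasing_closed_sets R) :
  UltraFilter F -> exists T : increasing_closed_sets R,
    forall e, 0 < e -> \forall n \near F, levy e (val T) (val (S n)).
Proof.
move=> UF; have PF := @ultra_proper _ _ UF.
have hS n : increasing_closed_sets R (val (S n)) by exact: set_valP.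
pose T : set (R * R) := [set p | unit_square p /\
  forall e, 0 < e -> F [set n | val (S n) (shift e p)]].
have hT : increasing_closed_sets R T.
  apply: increasing_closed_intro.
  - by move=> p [].
  - move=> p q [hp h] hq pq1 pq2; split=> // e e0; apply: filterS (h e e0) => n /= Sn.
    apply: (increasing_closed_le (hS n) Sn); first exact: unit_square_shift (ltW e0) hq.
      by rewrite /= le_min !ge_min lexx orbT andbT lerD2r pq1.
    by rewrite /= le_min !ge_min lexx orbT andbT lerD2r pq2.
  - move=> p hp h; split=> // e e0; apply: filterE => n /=.
    apply: (increasing_closed_edge (hS n)); first exact: unit_square_shift (ltW e0) hp.
    by case: h => h; [left|right]; rewrite /= h min_r // lerDl ltW.
  - move=> p hp h; split=> // e e0; have e20 : 0 < e / 2 by rewrite divr_gt0.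
    have [_ /(_ _ e20)] := h _ e20; rewrite shiftD; [|exact: ltW..].
    by rewrite -splitr.
exists (SigSub (mem_set hT)) => e e0 /=.
have [N N0 dE] := inv_natr_small e0.
have NR : 0 < N%:R :> R by rewrite ltr0n.
have d0 : 0 < N%:R^-1 :> R by rewrite invr_gt0.
pose g (ij : 'I_N.+1 * 'I_N.+1) : R * R := (ij.1%:R / N%:R, ij.2%:R / N%:R).
(* The ultrafilter decides every grid point, and there are finitely many of them, so almost every
   [S n] has exactly the limiting trace on the grid. *)
have : F [set n | forall ij, val (S n) (g ij) <-> F [set m | val (S m) (g ij)]].
  apply: filter_forall => ij.
  have [h|h] := in_ultra_setVsetC [set m | val (S m) (g ij)] UF.
    by apply: filterS (h) => n hn; split.
  apply: filterS (h) => n hn; split=> // h'.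
  have h2 := @filterI _ F _ _ _ h h'.
  by have [m [? ?]] := @filter_ex _ F PF _ (h2 _).
apply: filterS => n hn; split=> p hp.
  have hsq : unit_square p by case: hp.
  have hsq' := unit_square_shift (ltW d0) hsq.
  have [i [j [hq q1 q2 q3 q4]]] := grid_point N0 hsq'.
  have Fg : F [set m | val (S m) (g (i, j))].
    apply: filterS (hp.2 _ d0) => m hm.
    exact: (increasing_closed_le (hS m) hm).
  have /hn Sg := Fg.
  rewrite (shiftD _ (ltW d0) (ltW d0)) in q3 q4.
  have [l1 l2] := shift_le p dE.
  apply: (increasing_closed_le (hS n) Sg).
  - exact: unit_square_shift (ltW e0) hsq.
  - exact: le_trans q3 l1.
  - exact: le_trans q4 l2.
have hsq := increasing_closed_unit_square (hS n) hp.
have [i [j [hq q1 q2 q3 q4]]] := grid_point N0 hsq.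
have Sg : val (S n) (g (i, j)) by exact: (increasing_closed_le (hS n) hp).
have /hn Fg := Sg.
have Tg : T (g (i, j)).
  split=> // d d00; apply: filterS Fg => m hm.
  exact: increasing_closed_shift (hS m) (ltW d00) hm.
have de : N%:R^-1 <= e by lra.
have [l1 l2] := shift_le p de.
apply: (increasing_closed_le hT Tg).
- exact: unit_square_shift (ltW e0) hsq.
- exact: le_trans q3 l1.
- exact: le_trans q4 l2.
Qed.

(** Sampling at the upper right corner of a cell makes every cell that meets [S] an edge. *)
Definition corner n (i j : 'I_n.+1) : R * R :=
  (i.+1%:R / n.+1%:R, j.+1%:R / n.+1%:R).

Definition corner_graph (S : increasing_closed_sets R) n : bigraph :=
  @Bigraph n.+1 n.+1 isT isT [set ij | `[< val S (corner ij.1 ij.2) >]].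

Lemma corner_unit n (i j : 'I_n.+1) : unit_square (corner i j).
Proof.
have h (k : 'I_n.+1) : 0 <= k.+1%:R / n.+1%:R :> R /\ k.+1%:R / n.+1%:R <= 1 :> R.
  by split; [rewrite divr_ge0|rewrite ler_pdivrMr // mul1r ler_nat].
by have [? ?] := h i; have [? ?] := h j; apply/unit_squareP.
Qed.

(* The neighbourhoods of a vertex in the first part are final segments, so the
   first neighbour provides its weight. *)
Lemma corner_graph_threshold S n : threshold_graph R (corner_graph S n).
Proof.
have hS : increasing_closed_sets R (val S) by exact: set_valP.
pose b (i : 'I_n.+1) := find (fun j => `[< val S (corner i (inord j)) >]) (iota 0 n.+1).
(* The successor turns [b i <= j] into the strict inequality of the definition. For a vertex without
   neighbours [find] returns [n + 1], which exceeds every [j]. *)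
exists (fun i => - (b i)%:R), (fun j => j.+1%:R), 0 => i j; rewrite inE /=.
rewrite addrC subr_gt0 ltr_nat ltnS; apply/asboolP/idP => [Sij|bij].
  rewrite leqNgt; apply/negP => jb.
  have := before_find 0%N jb; rewrite nth_iota; last exact: ltn_ord.
  by rewrite add0n inord_val; move/asboolP; apply.
have hb : has (fun j => `[< val S (corner i (inord j)) >]) (iota 0 n.+1).
  by rewrite has_find size_iota; apply: leq_ltn_trans bij _; exact: ltn_ord.
have bn : (b i < n.+1)%N by apply: leq_ltn_trans bij _; exact: ltn_ord.
have := nth_find 0%N hb; rewrite -/(b i) nth_iota // add0n => /asboolP h.
apply: (increasing_closed_le hS h); first exact: corner_unit.
  exact: lexx.
by rewrite /= inordK // ler_pM2r ?invr_gt0 // ler_nat ltnS.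
Qed.

Lemma corner_step n (x y : R) : 0 <= x <= 1 -> 0 <= y <= 1 ->
  let q := corner (step_index (isT : (0 < n.+1)%N) x) (step_index (isT : (0 < n.+1)%N) y) in
  [/\ x <= q.1, y <= q.2, q.1 <= Num.min (x + n.+1%:R^-1) 1
    & q.2 <= Num.min (y + n.+1%:R^-1) 1].
Proof.
have n0 : 0 < n.+1%:R :> R by rewrite ltr0n.
suff h (z : R) : 0 <= z <= 1 ->
    let s := (step_index (isT : (0 < n.+1)%N) z).+1%:R / n.+1%:R in
    z <= s /\ s <= Num.min (z + n.+1%:R^-1) 1.
  by move=> /h[? ?] /h[? ?].
move=> /andP[z0 z1] /=.
have zn0 : 0 <= z * n.+1%:R by rewrite mulr_ge0 // ltW.
have /andP[t1 t2] := truncn_itv zn0.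
rewrite -minnSS; split.
  rewrite ler_pdivlMr //; have [_|_] := leqP (Num.truncn (z * n.+1%:R)).+1 n.+1; first exact: ltW.
  by rewrite ler_piMl // ltW.
rewrite le_min !ler_pdivrMr // mul1r ler_nat geq_minr andbT mulrDl mulVf ?gt_eqF //.
apply: (@le_trans _ _ (Num.truncn (z * n.+1%:R)).+1%:R); first by rewrite ler_nat geq_minl.
by rewrite -natr1 lerD2r.
Qed.

(** One mesh length accounts for the distance from a point to the corner of its cell, the other for
    the shift hidden in the hull of the step function. *)
Lemma corner_graph_levy S n : exists2 T : increasing_closed_sets R,
  levy (n.+1%:R^-1 + n.+1%:R^-1) (val S) (val T) &
  forall F, hom_density R F (corner_graph S n) = graphon_density F \1_(val T).
Proof.
have hS : increasing_closed_sets R (val S) by exact: set_valP.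
have d0 : 0 < n.+1%:R^-1 :> R by rewrite invr_gt0.
pose st := step_index (isT : (0 < n.+1)%N) : R -> 'I_n.+1.
pose W (p : R * R) : R := edge_indicator (G := corner_graph S n) (st p.1, st p.2).
have WE p : W p = 1 <-> val S (corner (st p.1) (st p.2)).
  rewrite /W /edge_indicator inE /=; case: asboolP => h; split=> //.
  by move/esym/eqP; rewrite oner_eq0.
have step p : unit_square p -> let q := corner (st p.1) (st p.2) in
    [/\ p.1 <= q.1, p.2 <= q.2, q.1 <= (shift n.+1%:R^-1 p).1 & q.2 <= (shift n.+1%:R^-1 p).2].
  by move=> /unit_squareP[? ? ? ?]; apply: corner_step; apply/andP.
have iW : increasing01 W.
  split=> [p _|p q hp hq pq1 pq2].
    by rewrite /W /edge_indicator; case: (_ \in _); [right|left].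
  have [Wp|Wp] : W p = 0 \/ W p = 1.
    by rewrite /W /edge_indicator; case: (_ \in _); [right|left].
    by rewrite Wp /W /edge_indicator.
  rewrite Wp; have /WE h := Wp; suff -> : W q = 1 by [].
  apply/WE; apply: (increasing_closed_le hS h); first exact: corner_unit.
    have /unit_squareP[? ? ? ?] := hp.
    by rewrite /= ler_pM2r // ler_nat ltnS; exact: step_index_le.
  have /unit_squareP[? ? ? ?] := hp.
  by rewrite /= ler_pM2r // ler_nat ltnS; exact: step_index_le.
have hH := hull_increasing_closed iW.
exists (SigSub (mem_set hH)) => [|F] /=; last first.
  rewrite -graphon_density_hull //; apply: hom_density_step; exact: uniform_step_index.
split=> p hp.
  have hsq := increasing_closed_unit_square hS hp.
  have [? ? _ _] := step p hsq.
  apply: (increasing_closed_shift hH); first by rewrite addr_ge0 // ltW.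
  apply: hull_sub => //; apply/WE; apply: (increasing_closed_le hS hp) => //.
  exact: corner_unit.
have hsq : unit_square p by case: hp.
have d00 := ltW d0.
have hsq2 : unit_square (shift (n.+1%:R^-1 + n.+1%:R^-1) p).
  by apply: unit_square_shift => //; exact: addr_ge0.
case: (hp) => _ [h|[h|h]].
- by apply: increasing_closed_edge => //; left; rewrite /= h min_r // lerDl addr_ge0.
- by apply: increasing_closed_edge => //; right; rewrite /= h min_r // lerDl addr_ge0.
have /WE hc := h _ d0.
have [_ _] := step _ (unit_square_shift d00 hsq); rewrite shiftD // => l1 l2.
exact: (increasing_closed_le hS hc).
Qed.

End StepFunctions.

(** * Neighbourhoods *)

Section LevyTopology.
Variable R : realType.
Local Notation C := (increasing_closed_sets R).

Lemma open_subbase (T : choiceType) (B : set (set T)) (b : set T) :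
  B b -> open (b : set (generated_topology B)).
Proof.
move=> Bb; exists [set b]; last first.
  by rewrite predeqE => ?; split=> [[_ ->]|] //; exists b.
move=> _ ->; exists [fset b]%fset.
  by move=> ?; rewrite inE inE => /eqP->.
by rewrite predeqE=> ?; split=> [|??]; [apply|]; rewrite /= inE // =>/eqP->.
Qed.

Lemma nbhs_subbase (T : choiceType) (B : set (set T)) (x : T) (F : set_system T) :
  Filter F -> (forall b, B b -> b x -> F b) ->
  forall U, nbhs (x : generated_topology B) U -> F U.
Proof.
move=> FF h U; rewrite nbhsE => -[_ [[A sA <-] [D AD Dx]] sU].
apply: filterS sU _; apply: (@filterS _ _ _ D); first by move=> ? ?; exists D.
have /sA [K sK IK] := AD; rewrite -IK; apply: filter_bigI => E EK.
by have /sK := EK; rewrite inE => BE; apply: h => //; move: Dx; rewrite -IK => /(_ _ EK).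
Qed.

Definition levy_nbhs (X : Type) (c : X -> C) (x : X) : set_system X :=
  filter_from [set e : R | 0 < e] (fun e => [set y | levy e (val (c x)) (val (c y))]).

Lemma levy_nbhs_filter (X : Type) (c : X -> C) x : Filter (levy_nbhs c x).
Proof.
apply: filter_from_filter; first by exists 1 => /=.
move=> e d /= e0 d0; exists (Num.min e d) => [|y /= h]; first by rewrite /= lt_min e0.
have m0 : 0 <= Num.min e d by rewrite le_min !ltW.
by split; apply: levy_le h; rewrite ?ge_min ?lexx ?orbT //; exact: increasing_closed_setP.
Qed.

Definition levy_topology (X : topologicalType) (c : X -> C) : Prop :=
  forall x, nbhs x = levy_nbhs c x.

Lemma levy_topology_homeomorphism (X Y : topologicalType) (cX : X -> C) (cY : Y -> C)
  (f : X -> Y) (g : Y -> X) : levy_topology cX -> levy_topology cY ->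
  cancel f g -> cancel g f -> (forall x, cY (f x) = cX x) -> homeomorphism f.
Proof.
move=> hX hY fK gK E; exists g; split=> // [x|y] U /=.
  by rewrite hY nbhs_simpl /= hX => -[e e0 h]; exists e => // z hz; apply: h; rewrite /= !E.
by rewrite hX nbhs_simpl /= hY => -[e e0 h]; exists e => // z hz; apply: h; rewrite /= -!E !gK.
Qed.

(** Only the comparison with [levy] around each point is asked of [d]; [levy_trans] does the work of
    the triangle inequality. *)
Lemma metric_levy_topology (X : choiceType) (d : X -> X -> R) (c : X -> C) :
  (forall x e, 0 < e -> exists2 k, 0 < k &
     forall y, d x y < k -> levy e (val (c x)) (val (c y))) ->
  (forall x k, 0 < k -> exists2 e, 0 < e &
     forall y, levy e (val (c x)) (val (c y)) -> d x y < k) ->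
  levy_topology (c : generated_topology (metric_open d) -> C).
Proof.
move=> M1 M2 x; apply/seteqP; split=> U.
  apply: nbhs_subbase; first exact: levy_nbhs_filter.
  move=> b Bb bx; have [k k0 kb] := Bb _ bx; have [e e0 h] := M2 x k k0.
  by exists e => // y /h; exact: kb.
move=> [e /= e0 eU]; rewrite nbhsE.
(* Being within exactly [e] need not be an open condition; being within some [a < e] is, because
   half of the slack [e - a] can be spent around [y]. *)
exists [set y | exists2 a, 0 <= a < e & levy a (val (c x)) (val (c y))].
  split; last by exists 0; [rewrite lexx|apply: levy_refl => //; exact: increasing_closed_setP].
  apply: open_subbase => y [a /andP[a0 ae] hy].
  have ea : 0 < (e - a) / 2 by rewrite divr_gt0 ?subr_gt0.
  have [k k0 hk] := M1 y _ ea; exists k => // z /hk hz.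
  exists (a + (e - a) / 2); first by apply/andP; split; lra.
  by apply: levy_trans hz => //; exact: ltW.
move=> y [a /andP[a0 /ltW ae] h]; apply: eU.
by apply: levy_le h => //; exact: increasing_closed_setP.
Qed.

Lemma measure_dist_levy_topology : levy_topology
  (id : generated_topology (metric_open (@measure_dist R C)) -> C).
Proof.
apply: metric_levy_topology => [S e e0|S k k0]; first exact: measure_dist_levy_inv.
(* The area is at most twice the shift, and [2 * (k / 3) < k] is strict. *)
exists (k / 3); first by rewrite divr_gt0.
move=> T h; have k30 : 0 <= k / 3 by rewrite divr_ge0 // ltW.
by apply: le_lt_trans (measure_dist_levy k30 h) _; lra.
Qed.

Lemma open_hull_increasing_closed (O : increasing_open_sets R) : C (closed_hull (val O)).
Proof. by apply: closed_hull_increasing_closed; exact: set_valP. Qed.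

Definition open_hull (O : increasing_open_sets R) : C :=
  SigSub (mem_set (open_hull_increasing_closed O)).

Lemma interior_increasing_open_set (S : C) : increasing_open_sets R (val S)°.
Proof. by apply: interior_increasing_open; exact: increasing_closed_setP. Qed.

Definition interior_set (S : C) : increasing_open_sets R :=
  SigSub (mem_set (interior_increasing_open_set S)).

Lemma open_hullK : cancel open_hull interior_set.
Proof. by move=> O; apply/val_inj; apply: interior_closed_hull; exact: set_valP. Qed.

Lemma interior_setK : cancel interior_set open_hull.
Proof. by move=> S; apply/val_inj; apply: closed_hull_interior; exact: increasing_closed_setP. Qed.

Lemma ae_class_open_hull O : ae_class \1_(val (open_hull O)) = ae_class (\1_(val O) : R * R -> R).
Proof.
apply/ae_classP; have hC := increasing_closed_setP (open_hull O).
exists (val (open_hull O) `\` (val (open_hull O))°); split.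
- exact: measurable_boundary.
- exact: area_boundary.
rewrite /= interior_closed_hull; last exact: set_valP.
move=> p /= h; apply: contrapT => hn; apply: h => _.
have sub : val O p -> val (open_hull O) p.
  move=> hp; apply: interior_subset; rewrite /= interior_closed_hull //; exact: set_valP.
have [hO|hO] := pselect (val O p); first by rewrite !indic_mem //; exact: sub.
by rewrite !indic_notmem // => hp; apply: hn.
Qed.

Local Notation R2 := (measurableTypeR R * measurableTypeR R)%type.

Lemma le_area_null (X Y N : set R2) : measurable X -> measurable Y -> measurable N ->
  @leb2 R N = 0%E -> X `<=` Y `|` N -> (@leb2 R X <= @leb2 R Y)%E.
Proof.
move=> mX mY mN N0 XYN; apply: (@le_trans _ _ (@leb2 R (Y `|` N))).
  by apply: le_measure => //; rewrite inE //; exact: measurableU.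
by apply: le_trans (measureU2 _ mY mN) _; rewrite [X in (_ + X)%E]N0 adde0.
Qed.

(** An open set and its closed hull differ by the null boundary of the hull, so the estimates for
    closed sets carry over. *)
Lemma measure_dist_open_hull O1 O2 : @measure_dist R (increasing_open_sets R) O1 O2 =
  fine (@leb2 R (val (open_hull O1) `+` val (open_hull O2))).
Proof.
have h (O : increasing_open_sets R) : exists N : set R2, [/\ measurable N, @leb2 R N = 0%E,
    measurable (val O : set R2), measurable (val (open_hull O) : set R2)
    & forall p, ~ N p -> val O p <-> val (open_hull O) p].
  have hC := increasing_closed_setP (open_hull O).
  have E : (val (open_hull O))° = val O by apply: interior_closed_hull; exact: set_valP.
  exists (val (open_hull O) `\` (val (open_hull O))°); split.
  - exact: measurable_boundary.
  - exact: area_boundary.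
  - by apply: open_measurable_plane; rewrite -E; exact: open_interior.
  - exact: increasing_closed_measurable.
  move=> p hp; rewrite -[X in X <-> _]/((val O) p) -E; split; first exact: interior_subset.
  by move=> Sp; apply: contrapT => nO; apply: hp.
have [N1 [mN1 N10 mO1 mS1 h1]] := h O1; have [N2 [mN2 N20 mO2 mS2 h2]] := h O2.
have mN := measurableU _ _ mN1 mN2; have N0 := area_setU0 mN1 mN2 N10 N20.
have mO := measurable_symdiff mO1 mO2; have mS := measurable_symdiff mS1 mS2.
rewrite /measure_dist; congr fine; apply/eqP; rewrite eq_le; apply/andP; split.
  apply: (le_area_null mO mS mN N0) => p hp; have [hN|hN] := pselect ((N1 `|` N2) p).
    by right.
  left; have n1 : ~ N1 p by move=> ?; apply: hN; left.
  have n2 : ~ N2 p by move=> ?; apply: hN; right.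
  have [i1 j1] := h1 p n1; have [i2 j2] := h2 p n2.
  by have [[a b]|[a b]] := hp; [left|right]; split; auto.
apply: (le_area_null mS mO mN N0) => p hp; have [hN|hN] := pselect ((N1 `|` N2) p).
  by right.
left; have n1 : ~ N1 p by move=> ?; apply: hN; left.
have n2 : ~ N2 p by move=> ?; apply: hN; right.
have [i1 j1] := h1 p n1; have [i2 j2] := h2 p n2.
by have [[a b]|[a b]] := hp; [left|right]; split; auto.
Qed.

Lemma measure_dist_open_levy_topology : levy_topology (open_hull :
  generated_topology (metric_open (@measure_dist R (increasing_open_sets R))) -> C).
Proof.
apply: metric_levy_topology => [P e e0|P k k0].
  have [d d0 hd] := measure_dist_levy_inv (open_hull P) e0; exists d => // P'.
  by rewrite measure_dist_open_hull; exact: hd.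
exists (k / 3); first by rewrite divr_gt0.
move=> P'; rewrite measure_dist_open_hull => h; have k30 : 0 <= k / 3 by rewrite divr_ge0 // ltW.
by apply: le_lt_trans (measure_dist_levy k30 h) _; lra.
Qed.

Lemma class_levy_topology tW : class_topologies tW ->
  levy_topology (@class_hull R : generated_topology tW -> C).
Proof.
have lt k : 0 < k -> 2 * (k / 3) < k :> R by lra.
move=> [->|->]; apply: metric_levy_topology => [w e e0|w k k0].
- have [d d0 hd] := measure_dist_levy_inv (class_hull w) e0; exists d => // w'.
  by rewrite L1_distE; exact: hd.
- exists (k / 3); first by rewrite divr_gt0.
  have k30 : 0 <= k / 3 by rewrite divr_ge0 // ltW.
  move=> w' h; rewrite L1_distE; exact: le_lt_trans (measure_dist_levy k30 h) (lt _ k0).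
- exact: cut_dist_levy.
exists (k / 3); first by rewrite divr_gt0.
have k30 : 0 <= k / 3 by rewrite divr_ge0 // ltW.
move=> w' h; apply: le_lt_trans (cut_dist_le w w') _.
exact: le_lt_trans (measure_dist_levy k30 h) (lt _ k0).
Qed.

Implicit Types (S T : C) (p q : R * R).

Lemma euclidean_dist_coord p q :
  `|p.1 - q.1| <= euclidean_dist p q /\ `|p.2 - q.2| <= euclidean_dist p q.
Proof.
rewrite /euclidean_dist -!sqrtr_sqr !ler_sqrt ?addr_ge0 ?sqr_ge0 //.
by rewrite lerDl lerDr !sqr_ge0.
Qed.

Lemma euclidean_dist_ge0 p q : 0 <= euclidean_dist p q.
Proof. exact: sqrtr_ge0. Qed.

(** The factor 2 is a convenient upper bound for the square root of 2. *)
Lemma euclidean_dist_le p q (e : R) : 0 <= e -> `|p.1 - q.1| <= e -> `|p.2 - q.2| <= e ->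
  euclidean_dist p q <= 2 * e.
Proof.
move=> e0 h1 h2; rewrite -(@ger0_norm _ (2 * e)) ?mulr_ge0 // -sqrtr_sqr ler_sqrt ?sqr_ge0 //.
have sq (x : R) : `|x| <= e -> x ^+ 2 <= e ^+ 2.
  by move=> ?; rewrite -[x ^+ 2]real_normK ?num_real // ler_pXn2r ?nnegrE.
apply: (le_trans (lerD (sq _ h1) (sq _ h2))).
by rewrite exprMn; have := sqr_ge0 e; lra.
Qed.

Lemma dist_to_set_levy p S (e : R) : unit_square p -> dist_to_set p (val S) < e ->
  val S (shift e p).
Proof.
move=> hp h; have hS := increasing_closed_setP S.
have ne : [set euclidean_dist p q | q in val S] !=set0.
  exists (euclidean_dist p (1, 1)), (1, 1) => //; apply: increasing_closed_edge => //; last by left.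
  by apply/unit_squareP; rewrite /= ler01 lexx.
have [_ [q Sq <-] pq] := inf_lt ne h.
have [d1 d2] := euclidean_dist_coord p q.
have e0 : 0 <= e by apply: ltW; apply: le_lt_trans pq; exact: euclidean_dist_ge0.
have /unit_squareP[_ q1 _ q2] := increasing_closed_unit_square hS Sq.
have d1' := le_lt_trans d1 pq; have d2' := le_lt_trans d2 pq.
apply: (increasing_closed_le hS Sq); first exact: unit_square_shift.
  by rewrite /= le_min q1 andbT; move: d1'; rewrite ltr_norml => /andP[? ?]; lra.
by rewrite /= le_min q2 andbT; move: d2'; rewrite ltr_norml => /andP[? ?]; lra.
Qed.

Lemma dist_to_set_le p q S : val S q -> dist_to_set p (val S) <= euclidean_dist p q.
Proof.
move=> Sq; apply: ge_inf; last by exists q.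
by exists 0 => _ [q' _ <-]; exact: euclidean_dist_ge0.
Qed.

Lemma dist_to_set_shift p S (e : R) : unit_square p -> 0 <= e ->
  val S (shift e p) -> dist_to_set p (val S) <= 2 * e.
Proof.
move=> hp e0 h; apply: le_trans (dist_to_set_le p h) _.
have /unit_squareP[p0 p1 q0 q1] := hp.
have d (x : R) : x <= 1 -> `|x - Num.min (x + e) 1| <= e.
  by move=> x1; rewrite minEle; case: ifP => ?; rewrite ler_norml; apply/andP; split; lra.
by apply: euclidean_dist_le => //=; exact: d.
Qed.

(** All members of [C] contain [(1, 1)], which gives nonemptiness and a uniform bound, so the
    suprema in [hausdorff_dist] are genuine. *)
Lemma dist_to_set_has_sup S T :
  has_sup [set dist_to_set p (val S) | p in val T].
Proof.
have h11 : unit_square (1 : R, 1 : R) by apply/unit_squareP; rewrite /= ler01 lexx.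
have S11 (U : C) : val U (1, 1).
  by apply: increasing_closed_edge => //; [exact: increasing_closed_setP|left].
split; first by exists (dist_to_set (1, 1) (val S)), (1, 1).
exists (2 * 1) => _ [p Tp <-]; have hp := increasing_closed_set_sub Tp.
apply: dist_to_set_shift => //.
have /unit_squareP[? _ ? _] := hp.
apply: increasing_closed_edge; [exact: increasing_closed_setP|exact: unit_square_shift|].
by left; rewrite /= min_r // lerDr.
Qed.

Lemma hausdorff_levy_topology : levy_topology
  (id : generated_topology (metric_open (@hausdorff_dist R)) -> C).
Proof.
apply: metric_levy_topology => [S e e0|S k k0].
  exists e => // T; rewrite /hausdorff_dist gt_max => /andP[h1 h2]; split=> p hp.
    apply: dist_to_set_levy; first exact: increasing_closed_set_sub hp.
    apply: le_lt_trans h1; apply: ub_le_sup; last by exists p.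
    by have [] := dist_to_set_has_sup T S.
  apply: dist_to_set_levy; first exact: increasing_closed_set_sub hp.
  apply: le_lt_trans h2; apply: ub_le_sup; last by exists p.
  by have [] := dist_to_set_has_sup S T.
exists (k / 3); first by rewrite divr_gt0.
have k30 : 0 <= k / 3 by rewrite divr_ge0 // ltW.
move=> T [h1 h2]; apply: (@le_lt_trans _ _ (2 * (k / 3))); last by lra.
rewrite /hausdorff_dist ge_max; apply/andP; split.
  apply: ge_sup; first by have [] := dist_to_set_has_sup T S.
  by move=> _ [p hp <-]; apply: dist_to_set_shift; [exact: increasing_closed_set_sub hp| |exact: h1].
apply: ge_sup; first by have [] := dist_to_set_has_sup S T.
by move=> _ [p hp <-]; apply: dist_to_set_shift; [exact: increasing_closed_set_sub hp| |exact: h2].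
Qed.

End LevyTopology.

(** * The Fell topology *)

Section Fell.
Variable R : realType.
Local Notation C := (increasing_closed_sets R).
Implicit Types (S T : C) (p q : R * R).

Lemma shift_homo (e : R) p q : p.1 <= q.1 -> p.2 <= q.2 ->
  (shift e p).1 <= (shift e q).1 /\ (shift e p).2 <= (shift e q).2.
Proof. by move=> h1 h2; rewrite /= !le_min !ge_min !lerD2r h1 h2 !lexx !orbT. Qed.

(** A compact set disjoint from [S] stays disjoint from it after a small uniform shift, and a point
    of [S] in an open set stays there after a small shift. Conversely, finitely many conditions on
    grid points, hitting a ball or missing a point, force closeness. *)
Lemma fell_levy_topology :
  levy_topology (id : generated_topology (@fell_subbase R) -> C).
Proof.
move=> S; apply/seteqP; split=> U.
  apply: nbhs_subbase; first exact: levy_nbhs_filter.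
  move=> _ [[K [Ksq cK] <-]|[V oV <-]] /= hS; last first.
    have [p [Sp Vp]] := hS.
    have /nbhs_ballP[e /= e0 eV] : nbhs p V by exact: open_nbhs_nbhs.
    exists (e / 2); first by rewrite /= divr_gt0.
    move=> T [h _]; exists (shift (e / 2) p); split; first exact: h.
    by apply: eV; apply: ball_shift => //; exact: increasing_closed_set_sub Sp.
  have : \forall e \near 0^'+, K `<=` (fun p => K p -> ~ val S (shift e p)).
    apply: (iffLR (@compact_near_coveringP _ K) cK _ _ (fun e p => K p -> ~ val S (shift e p))) => x Kx.
    have : nbhs x (~` val S).
      apply: open_nbhs_nbhs; split.
        by apply: closed_openC; have [] := increasing_closed_setP S.
      by move=> Sx; have : (val S `&` K) x by []; rewrite hS.
    move=> /nbhs_ballP[r /= r0 rS].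
    (* [shift e x'] lies in the open ball of radius [2 e] around [x'], and [r / 2 + 2 e < r]. *)
    exists (ball x (r / 2), [set e | 0 < e < r / 4]).
      split; first by apply: nbhsx_ballx; rewrite divr_gt0.
      by near=> e; apply/andP; split; near: e; [exact: nbhs_right_gt|
        apply: nbhs_right_lt; rewrite divr_gt0].
    move=> [x' e] [/= xx' /andP[e0 er]] Kx'; apply: rS.
    have h := @ball_shift R (e + e) x' (addr_gt0 e0 e0) (Ksq _ Kx').
    have E : (e + e) / 2 = e by lra.
    rewrite E in h; apply: le_ball (ball_triangle xx' h); lra.
  move=> [e /= e0 he]; exists (e / 2); first by rewrite /= divr_gt0.
  have e20 : 0 < e / 2 by rewrite divr_gt0.
  move=> T [_ h] /=; apply/seteqP; split=> // p [Tp Kp].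
  apply: (he (e / 2) _ e20 p Kp Kp (h _ Tp)).
  by rewrite /= sub0r normrN ger0_norm ?ltW //; lra.
move=> [e /= e0 eU].
have [N N0 dE] := inv_natr_small e0.
have NR : 0 < N%:R :> R by rewrite ltr0n.
have d0 : 0 < N%:R^-1 :> R by rewrite invr_gt0.
pose g (ij : 'I_N.+1 * 'I_N.+1) : R * R := (ij.1%:R / N%:R, ij.2%:R / N%:R).
(* A grid point of [S] cannot be required to belong to [T], as that is not a Fell open condition, so
   [T] is only asked to meet a ball around it. This loses one more [1 / N] besides the rounding,
   whence the bound of [2 / N] by [e]. *)
pose P (ij : 'I_N.+1 * 'I_N.+1) (T : C) : Prop := unit_square (g ij) ->
  if `[< val S (g ij) >] then val T `&` ball (g ij) N%:R^-1 !=set0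
  else val T `&` [set g ij] = set0.
have : \forall T \near (S : generated_topology (@fell_subbase R)), forall ij, P ij T.
  apply: (@filter_forall (generated_topology (@fell_subbase R)) ('I_N.+1 * 'I_N.+1)%type P
    (nbhs (S : generated_topology (@fell_subbase R))) (nbhs_filter _)) => ij; rewrite /P.
  case: asboolP => Sg.
    near=> T => _; near: T; apply: open_nbhs_nbhs; split.
      by apply: open_subbase; right; exists (ball (g ij) N%:R^-1) => //; exact: ball_open.
    by exists (g ij); split=> //; exact: ballxx.
  have [gsq|] := pselect (unit_square (g ij)); last by move=> ?; near=> T.
  near=> T => _; near: T; apply: open_nbhs_nbhs; split.
    apply: open_subbase; left; exists [set g ij] => //; split; first by move=> _ ->.
    exact: compact_set1.
  by apply/seteqP; split=> // p [Sp /= E]; apply: Sg; rewrite -E.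
apply: filterS => T hT; apply: eU; split=> p hp.
  have hsq := increasing_closed_set_sub hp; have [i [j [hq q1 q2 q3 q4]]] := grid_point N0 hsq.
  have := hT (i, j) hq; rewrite asboolT; last first.
    exact: (increasing_closed_le (increasing_closed_setP S) hp).
  move=> [q [Tq gq]]; have [l1 l2] := le_shift_of_ball d0 (increasing_closed_set_sub Tq) gq.
  have [m1 m2] := shift_homo N%:R^-1 q3 q4.
  rewrite shiftD in m1 m2; [|exact: ltW..].
  have [n1 n2] := shift_le p dE.
  apply: (increasing_closed_le (increasing_closed_setP T) Tq).
  - exact: unit_square_shift (ltW e0) hsq.
  - exact: le_trans l1 (le_trans m1 n1).
  - exact: le_trans l2 (le_trans m2 n2).
have hsq := increasing_closed_set_sub hp; have [i [j [hq q1 q2 q3 q4]]] := grid_point N0 hsq.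
have Tg : val T (g (i, j)) by exact: (increasing_closed_le (increasing_closed_setP T) hp).
have := hT (i, j) hq; case: asboolP => [Sg _|_ h]; last first.
  by have : (val T `&` [set g (i, j)]) (g (i, j)) by []; rewrite h.
have de : N%:R^-1 <= e by lra.
have [l1 l2] := shift_le p de.
apply: (increasing_closed_le (increasing_closed_setP S) Sg).
- exact: unit_square_shift (ltW e0) hsq.
- exact: le_trans q3 l1.
- exact: le_trans q4 l2.
Unshelve. all: by end_near. Qed.

Lemma closed_set_levy_topology tC : closed_set_topologies tC ->
  levy_topology (id : generated_topology tC -> C).
Proof.
move=> [[->|->]|->]; [exact: hausdorff_levy_topology|exact: fell_levy_topology|
  exact: measure_dist_levy_topology].
Qed.

End Fell.

(** * Pointwise convergence and the weak topology *)

Section PointwiseTopology.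
Variables (I : eqType) (V : topologicalType).

Lemma cvg_ptws (T : Type) (F : set_system T) (FF : Filter F) (f : T -> I -> V) (l : I -> V) :
  (forall i, f t i @[t --> F] --> l i) -> f @ F --> (l : {ptws I -> V}).
Proof.
move=> h; apply/cvg_sup => i A [_ [[B oB <-] Bl] sB].
by apply: filterS sB _; apply: (h i); exact: open_nbhs_nbhs.
Qed.

Lemma ptws_cvg (T : Type) (F : set_system T) (FF : Filter F) (f : T -> I -> V) (l : I -> V) :
  f @ F --> (l : {ptws I -> V}) -> forall i, f t i @[t --> F] --> l i.
Proof.
by move=> h i A Ai; exact: h (@proj_continuous I (fun=> V) i l A Ai).
Qed.

End PointwiseTopology.

Section Weak.
Variable R : realType.
Local Notation C := (increasing_closed_sets R).
Local Notation I01 := (@unit_itv R).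

Lemma cvg_levy_density (F : bigraph) (X : Type) (c : X -> C) (x : X) :
  graphon_density F \1_(val (c y)) @[y --> levy_nbhs c x] -->
  graphon_density F \1_(val (c x)).
Proof.
have FF := levy_nbhs_filter c x.
apply/cvgrPdist_le => e e0.
have n0 : 0 < (v1 F + v2 F)%:R :> R by rewrite ltr0n addn_gt0 v1_gt0.
have d0 : 0 < e / (v1 F + v2 F)%:R by rewrite divr_gt0.
exists (e / (v1 F + v2 F)%:R) => //= y h.
apply: le_trans (levy_graphon_density F (increasing_closed_setP _) (increasing_closed_setP _) (ltW d0) h) _.
by rewrite mulrCA divff ?gt_eqF // mulr1.
Qed.

Lemma moment_density (mu : unit_probabilities R) k :
  \int[val mu]_(s in I01) (s ^+ k.+1) = graphon_density (star k) \1_(S_ mu).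
Proof.
rewrite -[in LHS](degree_setK mu) moment_degree_law graphon_density_star //.
  exact: (increasing_closed_set_measurable (degree_set mu)).
exact: (@increasing_closed_set_sub _ (degree_set mu)).
Qed.

(** Closeness for [levy] controls the star densities, that is, the moments, and through them all
    continuous integrals. Conversely, powers are among the test functions of the weak topology. *)
Lemma weak_levy_topology :
  levy_topology (@degree_set R : weak_probabilities R -> C).
Proof.
move=> mu; have FF := levy_nbhs_filter (@degree_set R) mu; apply/seteqP; split=> U.
  move=> [_ [[A oA <-] Amu] sU]; apply: filterS sU _.
  suff : weak_integrals nu @[nu --> levy_nbhs (@degree_set R) mu] -->
      (weak_integrals mu : {ptws unit_continuous R -> R}).
    by apply; exact: open_nbhs_nbhs.
  apply: cvg_ptws => f.
  refine (@cvg_Rintegral_continuous R _ _ FF id mu _ (sval f) (svalP f)) => k.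
  rewrite moment_density; under eq_fun do rewrite moment_density.
  exact: (@cvg_levy_density (star k) _ (@degree_set R) mu).
move=> [e /= e0 eU]; apply: filterS eU _.
apply: (@cvg_moments_levy R _ (nbhs (mu : weak_probabilities R)) _ id mu) => // k.
have := @initial_continuous _ _ (@weak_integrals R) mu.
by move=> /ptws_cvg /(_ (exist _ _ (@exprn_within R k.+1))).
Qed.

End Weak.

(** * Limits of threshold graphs *)

Section Limits.
Variable R : realType.
Local Notation leb := (@lebesgue_measure R).
Local Notation C := (increasing_closed_sets R).
Local Notation I01 := (@unit_itv R).
Implicit Types (S : C).

Lemma cvg_graph_space (T : Type) (F : set_system T) (FF : Filter F)
  (f : T -> graph_space R) (l : graph_space R) :
  (forall G, (f t).1 G @[t --> F] --> l.1 G) ->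
  (f t).2.1 @[t --> F] --> l.2.1 -> (f t).2.2 @[t --> F] --> l.2.2 ->
  f @ F --> l.
Proof.
move=> h1 h2 h3 A [[P Q] /= [hP [[Q1 Q2] /= [hQ1 hQ2] sQ]] sA].
have a1 : F (fun t => P (f t).1) := cvg_ptws FF h1 hP.
have a2 : F (fun t => Q1 (f t).2.1) := h2 _ hQ1.
have a3 : F (fun t => Q2 (f t).2.2) := h3 _ hQ2.
suff : F (fun t => A (f t)) by [].
apply: filterS3 a1 a2 a3 => t p q1 q2.
exact: (sA (f t) (conj p (sQ (f t).2 (conj q1 q2)))).
Qed.

Lemma graph_space_cvg (T : Type) (F : set_system T) (FF : Filter F)
  (f : T -> graph_space R) (l : graph_space R) : f @ F --> l ->
  [/\ forall G, (f t).1 G @[t --> F] --> l.1 G,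
    (f t).2.1 @[t --> F] --> l.2.1 & (f t).2.2 @[t --> F] --> l.2.2].
Proof.
move=> h; have h2 : (f t).2 @[t --> F] --> l.2.
  exact: (cvg_comp _ _ h cvg_snd).
split=> [G| |]; last 2 first.
- exact: (cvg_comp _ _ h2 cvg_fst).
- exact: (cvg_comp _ _ h2 cvg_snd).
have h1 : (f t).1 @[t --> F] --> (l.1 : {ptws bigraph -> R}).
  exact: (cvg_comp _ _ h cvg_fst).
exact: (ptws_cvg FF h1).
Qed.

Lemma cvg_invn_natr (v : nat -> nat) : v n @[n --> \oo] --> \oo ->
  (v n)%:R^-1 @[n --> \oo] --> (0 : R).
Proof.
move=> h; have h' : (v n)%:R @[n --> \oo] --> (+oo : set_system R).
  exact: cvg_comp h cvgr_idn.
apply/gtr0_cvgV0 => //; apply: (h (fun k => 0 < k%:R :> R)).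
by exists 1%N => // k /= k0; rewrite ltr0n.
Qed.

Lemma cvg_succn : n.+1 @[n --> \oo] --> \oo.
Proof. by move=> A [N _ hN]; exists N => // m /= h; apply: hN; exact: leqW. Qed.

Lemma corner_graph_cvg S :
  graph_point R (corner_graph S n) @[n --> \oo] --> Gamma \1_(val S).
Proof.
have inv0 := cvg_invn_natr cvg_succn.
apply: cvg_graph_space => //= F.
apply/cvgrPdist_le => e e0.
have c0 : 0 < (v1 F + v2 F)%:R :> R by rewrite ltr0n addn_gt0 v1_gt0.
have d0 : 0 < e / (v1 F + v2 F)%:R / 2 by rewrite !divr_gt0.
have /cvgrPdist_lt /(_ _ d0) := inv0; apply: filterS => n.
rewrite sub0r normrN gtr0_norm ?invr_gt0 // => hn.
have [T hT ->] := corner_graph_levy S n.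
have n0 : 0 <= n.+1%:R^-1 + n.+1%:R^-1 :> R by rewrite addr_ge0.
apply: le_trans (levy_graphon_density F (increasing_closed_setP _) (increasing_closed_setP _) n0 hT) _.
rewrite mulrC -ler_pdivlMr // [leRHS](splitr (e / _)).
by apply: lerD; exact: ltW.
Qed.

Lemma Gamma_threshold_limit S : threshold_limits R (Gamma \1_(val S)).
Proof.
split; last by exists (corner_graph S); [exact: corner_graph_threshold|exact: corner_graph_cvg].
by exists (corner_graph S); split; [exact: cvg_succn..|exact: corner_graph_cvg].
Qed.

(** Two sequences are at hand: the one whose sizes tend to infinity forces the size coordinates of
    the limit to be 0, and the one of threshold graphs determines the densities. *)
Lemma threshold_limit_Gamma (Gam : graph_space R) : threshold_limits R Gam ->
  exists S, Gam = Gamma \1_(val S).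
Proof.
move=> [[G [v1oo v2oo GGam]] [H Hth HGam]].
have [_ i1 i2] := graph_space_cvg _ GGam.
have [hH _ _] := graph_space_cvg _ HGam.
(* Along an ultrafilter finer than [\oo] the densities keep their limits, while the closed sets of
   the threshold graphs acquire one. *)
have [U [UF sU]] := ultraFilterLemma (@eventually_filter : ProperFilter \oo).
have PU := @ultra_proper _ _ UF.
pose S n : C := sval (cid (threshold_graph_set (Hth n))).
have SE n F : hom_density R F (H n) = graphon_density F \1_(val (S n)).
  by rewrite /S; case: cid.
have [T hT] := levy_ultra S UF; exists T.
have E1 : Gam.1 = fun F => graphon_density F \1_(val T).
  apply/funext => F.
  have h1 : graphon_density F \1_(val (S n)) @[n --> U] --> Gam.1 F.
    apply: (cvg_trans _ (hH F)); rewrite /=; under eq_fun do rewrite -SE.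
    by move=> A /= hA; exact: sU hA.
  apply: (cvg_unique (@Rhausdorff R) h1).
  apply/cvgrPdist_le => e e0.
  have c0 : 0 < (v1 F + v2 F)%:R :> R by rewrite ltr0n addn_gt0 v1_gt0.
  have d0 : 0 < e / (v1 F + v2 F)%:R by rewrite divr_gt0.
  apply: filterS (hT _ d0) => n hn.
  apply: le_trans (levy_graphon_density F (increasing_closed_setP _) (increasing_closed_setP _) (ltW d0) hn) _.
  by rewrite mulrCA divff ?gt_eqF // mulr1.
have E2 : Gam.2.1 = 0 by exact: (cvg_unique (@Rhausdorff R) i1 (cvg_invn_natr v1oo)).
have E3 : Gam.2.2 = 0 by exact: (cvg_unique (@Rhausdorff R) i2 (cvg_invn_natr v2oo)).
by case: Gam E1 E2 E3 {GGam hH HGam i1 i2} => [g1 [g2 g3]] /= -> -> ->.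
Qed.

Definition Gamma_limit S : threshold_limits R :=
  SigSub (mem_set (Gamma_threshold_limit S)).

Definition limit_set (Gam : threshold_limits R) : C :=
  sval (cid (threshold_limit_Gamma (set_valP Gam))).

Lemma limit_setP Gam : val Gam = Gamma \1_(val (limit_set Gam)).
Proof. by rewrite /limit_set; case: cid. Qed.

Lemma density_star_limit Gam k : density (star k) (val Gam) =
  \int[leb]_(x in I01) (degree (val (limit_set Gam)) x ^+ k.+1).
Proof.
by rewrite limit_setP;
exact: (graphon_density_star k (increasing_closed_set_measurable (limit_set Gam))
  (@increasing_closed_set_sub R _)).
Qed.

(** Star densities alone separate: the constant sequence [T] has the degree moments of [S], so it is
    within every [e] of [S]. *)
Lemma Gamma_inj S T : Gamma \1_(val S) = Gamma \1_(val T) -> S = T.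
Proof.
move=> E; apply/val_inj; apply: levy_eq => [||e e0]; [exact: increasing_closed_setP..|].
have m k : \int[leb]_(x in I01) (degree (val T) x ^+ k.+1) =
    \int[leb]_(x in I01) (degree (val S) x ^+ k.+1).
  rewrite -(graphon_density_star k (increasing_closed_set_measurable S) (@increasing_closed_set_sub R S)).
  rewrite -(graphon_density_star k (increasing_closed_set_measurable T) (@increasing_closed_set_sub R T)).
  exact: (congr1 (fun g : graph_space R => g.1 (star k)) (esym E)).
have h : \forall t \near \oo, levy e (val S) (val ((fun _ : nat => T) t)).
  apply: (@levy_of_moments R nat \oo _ (fun _ => T)) => // k.
  by rewrite m; exact: cvg_cst.
by have [n] := filter_ex h.
Qed.

Lemma limit_setK : cancel limit_set Gamma_limit.
Proof. by move=> Gam; apply/val_inj; rewrite /= -limit_setP. Qed.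

Lemma Gamma_limitK : cancel Gamma_limit limit_set.
Proof. by move=> S; apply: Gamma_inj; rewrite -limit_setP. Qed.

(** One inclusion uses the Lipschitz bound for every density, the other only the continuity of the
    star densities. *)
Lemma limit_levy_topology : levy_topology limit_set.
Proof.
move=> Gam; have FF := levy_nbhs_filter limit_set Gam; apply/seteqP; split=> U.
  move=> [_ [[A oA <-] AGam] sU]; apply: filterS sU _.
  suff : val Gam' @[Gam' --> levy_nbhs limit_set Gam] --> (val Gam : graph_space R).
    by apply; exact: open_nbhs_nbhs.
  have -> : val = (fun Gam' : threshold_limits R => Gamma \1_(val (limit_set Gam'))).
    by apply/funext => Gam'; exact: limit_setP.
  apply: cvg_graph_space => [F| |]; [|exact: cvg_cst..].
  exact: (@cvg_levy_density R F _ limit_set Gam).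
move=> [e /= e0 eU]; apply: filterS eU _.
apply: (@levy_of_moments R _ (nbhs Gam) _ limit_set) => // k.
have -> : (fun t => \int[leb]_(x in I01) (degree (val (limit_set t)) x ^+ k.+1)) =
    fun t => density (star k) (val t).
  by apply/funext => t; rewrite density_star_limit.
rewrite -density_star_limit.
have := @initial_continuous _ _ (set_val : threshold_limits R -> graph_space R) Gam.
by move=> /graph_space_cvg [/(_ (star k))].
Qed.

End Limits.

Theorem theorem5p1 (R : realType) :
  exists (iBP : threshold_limits R -> unit_probabilities R)
         (iPC : unit_probabilities R -> increasing_closed_sets R)
         (iCO : increasing_closed_sets R -> increasing_open_sets R)
         (iCW : increasing_closed_sets R -> increasing01_classes R)
         (iOW : increasing_open_sets R -> increasing01_classes R)
         (iWB : increasing01_classes R -> threshold_limits R),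
  (* the mappings *)
  [/\ forall Gam, unique (is_degree_distribution Gam) (iBP Gam),
      forall mu, val (iPC mu) = S_ mu,
      forall S, val (iCO S) = (val S)°,
      forall S, val (iCW S) = ae_class \1_(val S)
    & (forall S, val (iOW S) = ae_class \1_(val S)) /\
      (forall w W, increasing01 W -> val w = ae_class W ->
         val (iWB w) = Gamma W)]
  /\ (* are bijections *)
  [/\ bijective iBP, bijective iPC, bijective iCO, bijective iCW
    & bijective iOW /\ bijective iWB]
  /\ (* and commute *)
  [/\ forall S, iOW (iCO S) = iCW S,
      forall Gam, iWB (iOW (iCO (iPC (iBP Gam)))) = Gam,
      forall mu, iBP (iWB (iOW (iCO (iPC mu)))) = mu,
      forall S, iPC (iBP (iWB (iOW (iCO S)))) = S
    & (forall S, iCO (iPC (iBP (iWB (iOW S)))) = S) /\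
      (forall w, iOW (iCO (iPC (iBP (iWB w)))) = w)]
  /\ (* the objects corresponding to a probability distribution *)
  (forall mu,
     [/\ val (iWB (iCW (iPC mu))) = Gamma_ mu,
         val (iPC mu) = S_ mu,
         val (iCO (iPC mu)) = (S_ mu)°
       & val (iCW (iPC mu)) = ae_class (W_ mu)])
  /\ (forall Gam mu, iBP Gam = mu <-> val Gam = Gamma_ mu)
  /\ (* homeomorphisms *)
  homeomorphism (iBP : threshold_limits R -> weak_probabilities R) /\
  (forall tC, closed_set_topologies tC ->
     homeomorphism
       (iPC : weak_probabilities R -> generated_topology tC) /\
     homeomorphism
       (iCO : generated_topology tC ->
              generated_topology
                (metric_open (@measure_dist R (increasing_open_sets R))))) /\
  (forall tC tW, closed_set_topologies tC -> class_topologies tW ->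
     homeomorphism
       (iCW : generated_topology tC -> generated_topology tW)) /\
  (forall tW, class_topologies tW ->
     homeomorphism
       (iOW : generated_topology
                (metric_open (@measure_dist R (increasing_open_sets R))) ->
              generated_topology tW) /\
     homeomorphism
       (iWB : generated_topology tW -> threshold_limits R)).
Proof.
(* Each map of the theorem is factored through the closed sets, so commutation reduces to cancelling
   the maps into and out of them. *)
pose iBP (Gam : threshold_limits R) := degree_law (limit_set Gam).
pose iOW (P : increasing_open_sets R) := indic_class (open_hull P).
pose iWB (w : increasing01_classes R) := Gamma_limit (class_hull w).
have iBPK : cancel iBP (@Gamma_limit R \o @degree_set R).
  by move=> Gam; rewrite /iBP /= degree_lawK limit_setK.
have BPiK : cancel (@Gamma_limit R \o @degree_set R) iBP.
  by move=> mu; rewrite /iBP /= Gamma_limitK degree_setK.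
have iOWK : cancel iOW (@interior_set R \o @class_hull R).
  by move=> P; rewrite /iOW /= indic_classK open_hullK.
have OWiK : cancel (@interior_set R \o @class_hull R) iOW.
  by move=> w; rewrite /iOW /= interior_setK class_hullK.
have iWBK : cancel iWB (@indic_class R \o @limit_set R).
  by move=> w; rewrite /iWB /= Gamma_limitK class_hullK.
have WBiK : cancel (@indic_class R \o @limit_set R) iWB.
  by move=> Gam; rewrite /iWB /= indic_classK limit_setK.
exists iBP, (@degree_set R), (@interior_set R), (@indic_class R), iOW, iWB.
split; [|split; [|split; [|split; [|split; [|split; [|split; [|split]]]]]]].
- split=> //.
  + move=> Gam; split=> [k|mu hmu].
      by rewrite moment_degree_law density_star_limit.
    rewrite /iBP -(degree_setK mu); congr degree_law; apply/val_inj/levy_eq; [exact: increasing_closed_setP..|].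
    (* A measure with the moments of [Gam] gives, as a constant sequence, a closed set within every
       [e] of that of [Gam]. *)
    move=> e e0; have h : \forall t \near \oo,
        levy e (val (limit_set Gam)) (val ((fun _ : nat => degree_set mu) t)).
      apply: (@levy_of_moments R nat \oo _ (fun _ => degree_set mu)) => // k.
      rewrite -moment_degree_law degree_setK hmu density_star_limit; exact: cvg_cst.
    by have [n] := filter_ex h.
  + split=> [P|w W iW wW]; first exact: ae_class_open_hull.
    have -> : val (iWB w) = Gamma \1_(val (class_hull w)) by [].
    rewrite (class_hullE iW wW); congr pair; apply/funext => F.
    by rewrite -graphon_density_hull.
- split; last by split; [exists (@interior_set R \o @class_hull R)|
    exists (@indic_class R \o @limit_set R)].
  + by exists (@Gamma_limit R \o @degree_set R).
  + by exists (@degree_law R); [exact: degree_setK|exact: degree_lawK].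
  + by exists (@open_hull R); [exact: interior_setK|exact: open_hullK].
  + by exists (@class_hull R); [exact: indic_classK|exact: class_hullK].
- split=> [S|Gam|mu|S|]; last split=> [P|w].
  + by rewrite /iOW interior_setK.
  + by rewrite /iOW /iWB /iBP degree_lawK interior_setK indic_classK limit_setK.
  + by rewrite /iOW /iWB /iBP interior_setK indic_classK Gamma_limitK degree_setK.
  + by rewrite /iOW /iWB /iBP interior_setK indic_classK Gamma_limitK degree_lawK.
  + by rewrite /iOW /iWB /iBP indic_classK Gamma_limitK degree_lawK open_hullK.
  + by rewrite /iOW /iWB /iBP Gamma_limitK degree_lawK interior_setK class_hullK.
- by move=> mu; split=> //; rewrite /iWB indic_classK.
- move=> Gam mu; split=> [<-|E]; first by rewrite -[in LHS](iBPK Gam).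
  by rewrite -(BPiK mu); congr iBP; apply/val_inj; rewrite E.
- exact: (levy_topology_homeomorphism (@limit_levy_topology R) (@weak_levy_topology R)
    iBPK BPiK (fun Gam => degree_lawK (limit_set Gam))).
- move=> tC htC; split.
    exact: (levy_topology_homeomorphism (@weak_levy_topology R)
      (closed_set_levy_topology htC) (@degree_setK R) (@degree_lawK R)).
  exact: (levy_topology_homeomorphism (closed_set_levy_topology htC)
    (@measure_dist_open_levy_topology R) (@interior_setK R) (@open_hullK R) (@interior_setK R)).
- move=> tC tW htC htW.
  exact: (levy_topology_homeomorphism (closed_set_levy_topology htC)
    (class_levy_topology htW) (@indic_classK R) (@class_hullK R) (@indic_classK R)).
move=> tW htW; split.
  exact: (levy_topology_homeomorphism (@measure_dist_open_levy_topology R)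
    (class_levy_topology htW) iOWK OWiK (fun P => indic_classK (open_hull P))).
exact: (levy_topology_homeomorphism (class_levy_topology htW) (@limit_levy_topology R)
  iWBK WBiK (fun w => Gamma_limitK (class_hull w))).
Qed.
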